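(* Let $\nu\in[0,1)$ and let $\theta$ be a smooth function on $[0,1]$ with $\theta>0$ on $(0,1]$, $\theta(0)=0$ and $\theta'(0)=1$. Then for every $t>0$, $$\mathrm{Tr}\,(e^{-t\mathcal M_\nu^\theta})=\frac{\cosh\big(\frac{t}{\theta(1)}(\nu-\frac12)\big)}{\sinh\big(\frac{t}{2\theta(1)}\big)} .$$
   Context: On the unit disk with polar coordinates $(r,\varphi)$, $0<r\le1$, $\varphi\in\mathbb R/2\pi\mathbb Z$, consider the metric $dr^2+\theta(r)^2d\varphi^2$ and the Aharonov–Bohm $1$-form $\nu\,d\varphi$. The associated magnetic Laplacian is $$-\Delta_{A_\nu}=-\frac{\partial^2}{\partial r^2}-\frac{\theta'(r)}{\theta(r)}\frac{\partial}{\partial r}-\frac1{\theta(r)^2}\Big(\frac{\partial}{\partial\varphi}-i\nu\Big)^2 .$$ $\mathcal M_\nu^\theta$ denotes the associated Dirichlet-to-Neumann operator on the circle $r=1$: for boundary data $\Psi=\sum_{k\in\mathbb Z}\Psi_ke^{ik\varphi}$, $\mathcal M_\nu^\theta\Psi=\partial_rv|_{r=1}$, where $v=\sum_kv_k(r)e^{ik\varphi}$ satisfies $-\Delta_{A_\nu}v=0$ for $0<r<1$, $v=\Psi$ at $r=1$, and each $v_k$ is bounded near $r=0$. *)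

(* Defs.v *)
From Stdlib Require Export Reals ZArith.
From Coquelicot Require Export Coquelicot.

Open Scope R_scope.

(** ** The Hilbert space of boundary data

    A boundary datum Psi = sum_k Psi_k e^(i k phi) in L^2 of the circle is
    represented by the family of its Fourier coefficients, an element of
    l^2(Z).  By Parseval the inner product below is that of
    L^2(dphi / (2 pi)); rescaling the measure by the constant length factor of
    the metric at r = 1 changes neither semigroups nor traces. *)

Definition ell2_type := Z -> C.

(** Enumerates Z by grouping n with -n-1, so that sums over Z become series
    over nat; all sums over Z used below are absolutely convergent. *)
Definition fold_Z (a : Z -> R) (n : nat) : R :=
  a (Z.of_nat n) + a (- Z.of_nat n - 1)%Z.

Definition in_ell2 (x : ell2_type) : Prop :=
  ex_series (fold_Z (fun k => Cmod (x k) ^ 2)).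

Definition ell2_norm (x : ell2_type) : R :=
  sqrt (Series (fold_Z (fun k => Cmod (x k) ^ 2))).

Definition ell2_inner (x y : ell2_type) : C :=
  (Series (fold_Z (fun k => Re (Cconj (x k) * y k)%C)),
   Series (fold_Z (fun k => Im (Cconj (x k) * y k)%C))).

Definition ell2_zero : ell2_type := fun _ => RtoC 0.
Definition ell2_plus (x y : ell2_type) : ell2_type := fun k => (x k + y k)%C.
Definition ell2_opp (x : ell2_type) : ell2_type := fun k => (- x k)%C.
Definition ell2_minus (x y : ell2_type) : ell2_type := fun k => (x k - y k)%C.
Definition ell2_scal (c : C) (x : ell2_type) : ell2_type := fun k => (c * x k)%C.

Fixpoint ell2_sum (x : nat -> ell2_type) (n : nat) : ell2_type :=
  match n with
  | O => ell2_zero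
  | S m => ell2_plus (ell2_sum x m) (x m)
  end.

(** Norm convergence of [x] to [y] along the filter [F].  [Series] is total
    (with junk values on divergent series), hence the membership clause. *)
Definition ell2_lim {T : Type} (F : (T -> Prop) -> Prop)
    (x : T -> ell2_type) (y : ell2_type) : Prop :=
  forall eps : posreal,
    F (fun s => in_ell2 (ell2_minus (x s) y) /\
                ell2_norm (ell2_minus (x s) y) < eps).

(** ** Operators: semigroup generated by -M, and trace *)

Definition bounded_operator (B : ell2_type -> ell2_type) : Prop :=
  (forall x, in_ell2 x -> in_ell2 (B x)) /\
  (forall x y, in_ell2 x -> in_ell2 y ->
     B (ell2_plus x y) = ell2_plus (B x) (B y)) /\
  (forall c x, in_ell2 x -> B (ell2_scal c x) = ell2_scal c (B x)) /\
  (exists K : R, forall x, in_ell2 x -> ell2_norm (B x) <= K * ell2_norm x).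

(** An unbounded operator is given by its graph: [M x y] means that [x] is in
    the domain of M and M x = y. *)
Definition operator_graph := ell2_type -> ell2_type -> Prop.

(** [E] is the family (e^(-tM)), t >= 0: the strongly continuous semigroup of
    bounded operators whose infinitesimal generator is exactly -M, domains
    included. *)
Definition is_exp_semigroup (M : operator_graph)
    (E : R -> ell2_type -> ell2_type) : Prop :=
  (forall t, 0 <= t -> bounded_operator (E t)) /\
  (forall x, in_ell2 x -> E 0 x = x) /\
  (forall s t x, 0 <= s -> 0 <= t -> in_ell2 x -> E (s + t) x = E s (E t x)) /\
  (forall x, in_ell2 x -> ell2_lim (at_right 0) (fun h => E h x) x) /\
  (forall x y, in_ell2 x -> in_ell2 y ->
     (M x y <->
      ell2_lim (at_right 0)
        (fun h => ell2_scal (RtoC (/ h)) (ell2_minus (E h x) x))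
        (ell2_opp y))).

Definition orthonormal_basis (b : nat -> ell2_type) : Prop :=
  (forall n, in_ell2 (b n)) /\
  (forall m n, ell2_inner (b m) (b n) =
     if Nat.eqb m n then RtoC 1 else RtoC 0) /\
  (forall x, in_ell2 x ->
     ell2_lim eventually
       (ell2_sum (fun n => ell2_scal (ell2_inner (b n) x) (b n))) x).

(** [B] is trace class with trace [tau].  Absolute convergence of the diagonal
    in every orthonormal basis characterizes the trace class among bounded
    operators. *)
Definition is_trace (B : ell2_type -> ell2_type) (tau : C) : Prop :=
  bounded_operator B /\
  forall b, orthonormal_basis b ->
    ex_series (fun n => Cmod (ell2_inner (b n) (B (b n)))) /\
    is_series (V := C_R_NormedModule) (fun n => ell2_inner (b n) (B (b n))) tau.

(** ** The magnetic Laplacian in polar coordinates *)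

Definition C_derive (f : R -> C) (x : R) : C :=
  (Derive (fun y => Re (f y)) x, Derive (fun y => Im (f y)) x).

Definition d_r (v : R -> R -> C) : R -> R -> C :=
  fun r phi => C_derive (fun rho => v rho phi) r.

Definition d_phi (v : R -> R -> C) : R -> R -> C :=
  fun r phi => C_derive (v r) phi.

Definition C1_interior (v : R -> R -> C) : Prop :=
  forall r phi, 0 < r < 1 ->
    ex_derive (V := C_R_NormedModule) (fun rho => v rho phi) r /\
    ex_derive (V := C_R_NormedModule) (v r) phi /\
    continuous (fun p : R * R => d_r v (fst p) (snd p)) (r, phi) /\
    continuous (fun p : R * R => d_phi v (fst p) (snd p)) (r, phi).

Definition C2_interior (v : R -> R -> C) : Prop :=
  C1_interior v /\ C1_interior (d_r v) /\ C1_interior (d_phi v).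

(** The covariant derivative d/dphi - i nu. *)
Definition D_phi (nu : R) (v : R -> R -> C) : R -> R -> C :=
  fun r phi => (d_phi v r phi - Ci * RtoC nu * v r phi)%C.

(** - Delta_{A_nu} for the metric dr^2 + theta(r)^2 dphi^2. *)
Definition neg_magnetic_laplacian (theta : R -> R) (nu : R)
    (v : R -> R -> C) : R -> R -> C :=
  fun r phi =>
    (- d_r (d_r v) r phi
     - RtoC (Derive theta r / theta r) * d_r v r phi
     - RtoC (1 / theta r ^ 2) * D_phi nu (D_phi nu v) r phi)%C.

(** ** The Dirichlet-to-Neumann operator *)

Definition fourier_coef (f : R -> C) : ell2_type :=
  fun k =>
    (RtoC (/ (2 * PI)) *
     RInt (V := C_R_CompleteNormedModule)
       (fun phi => (f phi * ((cos (IZR k * phi), - sin (IZR k * phi))%R : C))%C)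
       0 (2 * PI))%C.

(** The boundary values at r = 1 are taken in L^2 of the circle: v(r, .) tends
    to Psi and d_r v(r, .) to Phi as r tends to 1 from below.  The operator is
    thus defined on its maximal domain in L^2.  Requiring C^2 regularity inside
    is no loss: the equation is elliptic with smooth coefficients there. *)
Definition DN_operator (theta : R -> R) (nu : R) : operator_graph :=
  fun Psi Phi =>
    in_ell2 Psi /\ in_ell2 Phi /\
    exists v : R -> R -> C,
      C2_interior v /\
      (forall r phi, 0 < r < 1 -> v r (phi + 2 * PI) = v r phi) /\
      (forall r phi, 0 < r < 1 ->
         neg_magnetic_laplacian theta nu v r phi = RtoC 0) /\
      (forall k : Z, exists delta K : R, 0 < delta /\
         forall r, 0 < r < 1 -> r < delta ->
           Cmod (fourier_coef (v r) k) <= K) /\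
      ell2_lim (at_left 1) (fun r => fourier_coef (v r)) Psi /\
      ell2_lim (at_left 1) (fun r => fourier_coef (d_r v r)) Phi.

(** ** The warping function *)

(** Smooth on [0,1] up to the endpoints: restriction of a smooth function on
    the line, so that the values of [theta] outside [0,1] are irrelevant. *)
Definition smooth_on_unit_interval (theta : R -> R) : Prop :=
  exists g : R -> R,
    (forall (n : nat) (x : R), ex_derive_n g n x) /\
    (forall x, 0 <= x <= 1 -> theta x = g x).

(** One-sided derivative at 0. *)
Definition right_derivative_at_0 (theta : R -> R) (l : R) : Prop :=
  filterlim (fun r => (theta r - theta 0) / r) (at_right 0) (locally l).

(* Main.v *)
Require Import Defs.
From Stdlib Require Import ssreflect Lra Lia Psatz FunctionalExtensionality Classical IndefiniteDescription.

(** In the variable [s(r) = int_r^1 d rho / theta(rho)], which tends to infinity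
    at r = 0 because theta(r) ~ r, the k-th Fourier mode of a solution is a
    combination of [exp (+- |k - nu| s)] (of 1 and s if k = nu), and boundedness
    leaves only [exp (- |k - nu| s)].  Hence the Dirichlet-to-Neumann operator is
    the Fourier multiplier [|k - nu| / theta(1)] on its maximal domain, and the
    trace is a sum of two geometric series.

    A strongly continuous semigroup with a diagonal generator is diagonal: local
    boundedness near t = 0 (uniform boundedness principle) makes the telescoping
    estimate [E_(t/n)^n e = exp (- t lambda) e + o(1)] valid on eigenvectors, and
    these span a dense subspace.  The trace in an arbitrary orthonormal basis
    follows from Parseval and dominated convergence. *)

(** * Series and the space l^2(Z) *)

(** An arbitrary [E] is known only through its generator: neither contractivity nor self-adjointness
    is given, and differentiability is available only from the right at t = 0. This is why an error
    estimate over small steps replaces the differentiation of [E t e] at later times. Existence of a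
    semigroup is proved as well, so that the claim about all [E] is not vacuous.

    Since the generator is prescribed with its domain, the operator must be identified as a graph
    and not only on modes: every [Psi] for which [|k - nu| Psi_k] is square summable needs a C^2
    solution with both boundary limits in norm. In the interior bounded coefficients suffice,
    because [exp (- |k - nu| s)] beats every power of k once s > 0. At r = 1, where s tends to 0, no
    decay is left, and convergence comes from domination by [Psi] and [Phi] themselves.

    In the converse inclusion a given solution is never expanded in its Fourier series; it is only
    tested against one mode at a time. Complex functions are handled as pairs of real ones, the
    calculus of derivatives and integrals being real. *)

Lemma sum_n_nonneg_le_Series (a : nat -> R) N :
  (forall n, 0 <= a n) -> ex_series a -> sum_n a N <= Series a.
Proof.
move=> Ha Hex.
have Hl : is_lim_seq (sum_n a) (Series a) by exact: (Series_correct _ Hex).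
apply: (is_lim_seq_incr_compare (sum_n a) (Series a) Hl) => n.
rewrite sum_Sn /plus /=; move: (Ha (S n)); lra.
Qed.

Lemma ex_series_nonneg_bounded (a : nat -> R) M :
  (forall n, 0 <= a n) -> (forall N, sum_n a N <= M) ->
  ex_series a /\ Series a <= M.
Proof.
move=> Ha HM.
have [l Hl] : ex_finite_lim_seq (sum_n a).
  apply: (ex_finite_lim_seq_incr _ M) => [n|//].
  rewrite sum_Sn /plus /=; move: (Ha (S n)); lra.
have Hs : is_series a l by exact: Hl.
split; first by exists l.
rewrite (is_series_unique _ _ Hs).
exact: (is_lim_seq_le _ (fun _ => M) (Finite l) (Finite M) HM Hl (is_lim_seq_const M)).
Qed.

Lemma ex_series_le_nonneg (a b : nat -> R) :
  (forall n, 0 <= a n <= b n) -> ex_series b -> ex_series a.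
Proof.
move=> H Hb; apply: (ex_series_le (K := R_AbsRing) (V := R_CompleteNormedModule) a b) => // n.
rewrite /norm /= /abs /=; rewrite Rabs_pos_eq; move: (H n); lra.
Qed.

Lemma term_le_Series (a : nat -> R) n :
  (forall n, 0 <= a n) -> ex_series a -> a n <= Series a.
Proof.
move=> Ha Hex; apply: Rle_trans (sum_n_nonneg_le_Series a n Ha Hex).
case: n => [|n]; first by rewrite sum_O; lra.
rewrite sum_Sn /plus /=.
have : 0 <= sum_n a n.
  elim: n => [|n IH]; first by rewrite sum_O.
  by rewrite sum_Sn /plus /=; move: (Ha (S n)); lra.
lra.
Qed.

Lemma Series_nonneg (a : nat -> R) : (forall n, 0 <= a n) -> ex_series a -> 0 <= Series a.
Proof. by move=> Ha Hex; apply: Rle_trans (Ha 0%nat) (term_le_Series a 0 Ha Hex). Qed.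

Lemma filter_forall_le {T} (F : (T -> Prop) -> Prop) {FF : Filter F}
    (P : nat -> T -> Prop) N :
  (forall n, F (P n)) -> F (fun s => forall n, (n <= N)%nat -> P n s).
Proof.
move=> H; elim: N => [|N IH].
  apply: filter_imp (H 0%nat) => s Hs n Hn.
  by have -> : n = 0%nat by lia.
apply: filter_imp (filter_and _ _ IH (H (S N))) => s [H1 H2] n Hn.
by case: (Nat.eq_dec n (S N)) => [->//|Hne]; apply: H1; lia.
Qed.

(** Tannery's theorem: cut where the tail of [g] is below eps/2 and control the finitely many
    remaining terms pointwise. An abstract filter is used because the same argument serves h -> 0+,
    r -> 1- and N -> oo. *)
Lemma dominated_convergence_series {T} (F : (T -> Prop) -> Prop) {FF : Filter F}
    (a : T -> nat -> R) (g : nat -> R) :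
  ex_series g ->
  F (fun s => forall n, 0 <= a s n <= g n) ->
  (forall n eps, 0 < eps -> F (fun s => a s n < eps)) ->
  forall eps, 0 < eps -> F (fun s => ex_series (a s) /\ Series (a s) < eps).
Proof.
move=> Hg Hdom Hpt eps Heps.
have Hl : is_lim_seq (sum_n g) (Series g) by exact: (Series_correct _ Hg).
have [N HN] : exists N, Series g - sum_n g N < eps / 2.
  move: Hl; rewrite -is_lim_seq_spec => Hl.
  have He : 0 < eps / 2 by lra.
  have [N HN] := Hl (mkposreal _ He).
  exists N; have := HN N (le_n N); rewrite /= => /Rabs_def2; lra.
have HS : 0 < INR (S N) by apply: lt_0_INR; lia.
have He : 0 < eps / (2 * INR (S N)) by apply: Rdiv_lt_0_compat; lra.
have Hall := @filter_forall_le _ F FF (fun n s => a s n < eps / (2 * INR (S N))) N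
  (fun n => Hpt n _ He).
apply: filter_imp (filter_and _ _ Hdom Hall) => s [H1 H2].
have Hexa : ex_series (a s) by exact: (ex_series_le_nonneg _ g H1 Hg).
split=> //.
have Hfin : sum_n (a s) N <= eps / 2.
  have Hm : forall m, (m <= N)%nat -> sum_n (a s) m <= INR (S m) * (eps / (2 * INR (S N))).
    elim=> [|m IH] Hm.
      by rewrite sum_O [INR 1]/(IZR 1) Rmult_1_l; apply: Rlt_le; apply: H2.
    rewrite sum_Sn [INR (S (S m))]S_INR Rmult_plus_distr_r Rmult_1_l.
    by apply: Rplus_le_compat; [apply: IH; lia | apply: Rlt_le; apply: H2].
  apply: Rle_trans (Hm N (le_n N)) _; apply: Req_le; field; lra.
(* The tails are compared by applying the bound on partial sums to the nonnegative series
   [g - a s]. *)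
have Htail : Series (a s) - sum_n (a s) N <= Series g - sum_n g N.
  have Hd : ex_series (fun n => g n - a s n).
    exact: (ex_series_minus (V := R_NormedModule) g (a s) Hg Hexa).
  have := sum_n_nonneg_le_Series (fun n => g n - a s n) N
     (fun n => ltac:(move: (H1 n); lra)) Hd.
  rewrite Series_minus //.
  have -> : sum_n (fun n => g n - a s n) N = sum_n g N - sum_n (a s) N.
    elim: (N) => [|m IH]; first by rewrite !sum_O.
    by rewrite !sum_Sn IH /plus /=; lra.
  lra.
lra.
Qed.

Lemma Z_fold_index (k : Z) :
  exists n, (k = Z.of_nat n \/ k = (- Z.of_nat n - 1)%Z).
Proof.
case: (Z_le_gt_dec 0 k) => Hk.
  by exists (Z.to_nat k); left; lia.
by exists (Z.to_nat (- k - 1)); right; lia.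
Qed.

Lemma fold_Z_nonneg a n : (forall k, 0 <= a k) -> 0 <= fold_Z a n.
Proof. by move=> H; apply: Rplus_le_le_0_compat. Qed.

Lemma fold_Z_le a b n : (forall k, a k <= b k) -> fold_Z a n <= fold_Z b n.
Proof. by move=> H; apply: Rplus_le_compat. Qed.

Lemma fold_Z_plus a b : fold_Z (fun k => a k + b k) = (fun n => fold_Z a n + fold_Z b n).
Proof. by apply: functional_extensionality => n; rewrite /fold_Z; lra. Qed.

Lemma fold_Z_scal c a : fold_Z (fun k => c * a k) = (fun n => c * fold_Z a n).
Proof. by apply: functional_extensionality => n; rewrite /fold_Z; lra. Qed.

Lemma ex_series_fold_Z_le (a b : Z -> R) :
  (forall k, 0 <= a k <= b k) -> ex_series (fold_Z b) -> ex_series (fold_Z a).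
Proof.
move=> H; apply: ex_series_le_nonneg => n; split.
  by apply: fold_Z_nonneg => k; move: (H k); lra.
by apply: fold_Z_le => k; move: (H k); lra.
Qed.

Lemma Series_fold_Z_le (a b : Z -> R) :
  (forall k, 0 <= a k <= b k) -> ex_series (fold_Z b) ->
  Series (fold_Z a) <= Series (fold_Z b).
Proof.
move=> H; apply: Series_le => n; split.
  by apply: fold_Z_nonneg => k; move: (H k); lra.
by apply: fold_Z_le => k; move: (H k); lra.
Qed.

Lemma term_le_Series_fold_Z (a : Z -> R) k :
  (forall k, 0 <= a k) -> ex_series (fold_Z a) -> a k <= Series (fold_Z a).
Proof.
move=> Ha Hex; have [n Hn] := Z_fold_index k.
have H := term_le_Series (fold_Z a) n (fun n => fold_Z_nonneg a n Ha) Hex.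
apply: Rle_trans _ H; rewrite /fold_Z.
have H1 := Ha (Z.of_nat n); have H2 := Ha (- Z.of_nat n - 1)%Z.
by case: Hn => ->; lra.
Qed.

Lemma dominated_convergence_fold_Z {T} (F : (T -> Prop) -> Prop) {FF : Filter F}
    (a : T -> Z -> R) (g : Z -> R) :
  ex_series (fold_Z g) ->
  F (fun s => forall k, 0 <= a s k <= g k) ->
  (forall k eps, 0 < eps -> F (fun s => a s k < eps)) ->
  forall eps, 0 < eps -> F (fun s => ex_series (fold_Z (a s)) /\ Series (fold_Z (a s)) < eps).
Proof.
move=> Hg Hdom Hpt.
apply: (dominated_convergence_series F (fun s => fold_Z (a s)) (fold_Z g) Hg).
  apply: filter_imp Hdom => s Hs n; split.
    by apply: fold_Z_nonneg => k; move: (Hs k); lra.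
  by apply: fold_Z_le => k; move: (Hs k); lra.
move=> n eps Heps; have He : 0 < eps / 2 by lra.
apply: filter_imp (filter_and _ _ (Hpt (Z.of_nat n) _ He) (Hpt (- Z.of_nat n - 1)%Z _ He)) => s.
by rewrite /fold_Z; lra.
Qed.

Definition ell2_sqnorm (x : ell2_type) : R :=
  Series (fold_Z (fun k => Cmod (x k) ^ 2)).

Lemma Cmod_sq_ge0 (z : C) : 0 <= Cmod z ^ 2.
Proof. exact: pow2_ge_0. Qed.

Lemma ell2_sqnorm_ge0 x : in_ell2 x -> 0 <= ell2_sqnorm x.
Proof.
by move=> Hx; apply: Series_nonneg => // n; apply: fold_Z_nonneg => k; apply: Cmod_sq_ge0.
Qed.

Lemma ell2_norm_ge0 x : 0 <= ell2_norm x.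
Proof. exact: sqrt_pos. Qed.

Lemma ell2_norm_sq x : in_ell2 x -> ell2_norm x ^ 2 = ell2_sqnorm x.
Proof. by move=> Hx; apply: pow2_sqrt; apply: ell2_sqnorm_ge0. Qed.

Lemma ell2_norm_le x M :
  in_ell2 x -> 0 <= M -> ell2_sqnorm x <= M ^ 2 -> ell2_norm x <= M.
Proof.
move=> Hx HM H; apply: Rsqr_incr_0_var => //.
by have := ell2_norm_sq x Hx; rewrite /Rsqr; lra.
Qed.

Lemma Cmod_le_ell2_norm x k : in_ell2 x -> Cmod (x k) <= ell2_norm x.
Proof.
move=> Hx; apply: Rsqr_incr_0_var; last exact: ell2_norm_ge0.
have := term_le_Series_fold_Z (fun k => Cmod (x k) ^ 2) k (fun k => Cmod_sq_ge0 _) Hx.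
by have := ell2_norm_sq x Hx; rewrite /ell2_sqnorm /Rsqr; lra.
Qed.

Lemma ell2_dominated x y c :
  0 <= c -> in_ell2 y -> (forall k, Cmod (x k) <= c * Cmod (y k)) ->
  in_ell2 x /\ ell2_norm x <= c * ell2_norm y.
Proof.
move=> Hc Hy H.
have H2 k : 0 <= Cmod (x k) ^ 2 <= c ^ 2 * Cmod (y k) ^ 2.
  split; first exact: Cmod_sq_ge0.
  rewrite -Rpow_mult_distr; apply: pow_incr; split=> //; exact: Cmod_ge_0.
have Hs : ex_series (fold_Z (fun k => c ^ 2 * Cmod (y k) ^ 2)).
  by rewrite fold_Z_scal; apply: (ex_series_scal (V := R_NormedModule) (c ^ 2)).
have Hx : in_ell2 x by apply: (ex_series_fold_Z_le _ _ H2 Hs).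
split=> //; apply: ell2_norm_le => //.
  by apply: Rmult_le_pos => //; apply: ell2_norm_ge0.
apply: Rle_trans (Series_fold_Z_le _ _ H2 Hs) _.
rewrite fold_Z_scal Series_scal_l Rpow_mult_distr ell2_norm_sq //; exact: Rle_refl.
Qed.

Lemma in_ell2_scal c x : in_ell2 x -> in_ell2 (ell2_scal c x).
Proof.
move=> Hx; apply: (proj1 (ell2_dominated _ x (Cmod c) (Cmod_ge_0 c) Hx _)) => k.
by rewrite /ell2_scal Cmod_mult; apply: Rle_refl.
Qed.

Lemma ell2_norm_scal_le c x : in_ell2 x -> ell2_norm (ell2_scal c x) <= Cmod c * ell2_norm x.
Proof.
move=> Hx; apply: (proj2 (ell2_dominated _ x (Cmod c) (Cmod_ge_0 c) Hx _)) => k.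
by rewrite /ell2_scal Cmod_mult; apply: Rle_refl.
Qed.

Lemma ell2_minus_plus x y : ell2_minus x y = ell2_plus x (ell2_scal (RtoC (-1)) y).
Proof. by apply: functional_extensionality => k; rewrite /ell2_minus /ell2_plus /ell2_scal; ring. Qed.

(** Young's inequality with a free weight, applied coordinatewise; the defect is the square
    [/ c * (c * a - b) ^ 2]. Optimizing [c] later gives the triangle inequality without
    Cauchy-Schwarz. *)
Lemma ell2_sqnorm_plus_le x y c :
  0 < c -> in_ell2 x -> in_ell2 y ->
  in_ell2 (ell2_plus x y) /\
  ell2_sqnorm (ell2_plus x y) <= (1 + c) * ell2_sqnorm x + (1 + / c) * ell2_sqnorm y.
Proof.
move=> Hc Hx Hy.
have H k : 0 <= Cmod (ell2_plus x y k) ^ 2 <=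
    (1 + c) * Cmod (x k) ^ 2 + (1 + / c) * Cmod (y k) ^ 2.
  split; first exact: Cmod_sq_ge0.
  apply: Rle_trans (pow_incr _ _ 2 (conj (Cmod_ge_0 _) (Cmod_triangle _ _))) _.
  set a := Cmod (x k); set b := Cmod (y k).
  have -> : (1 + c) * a ^ 2 + (1 + / c) * b ^ 2 = (a + b) ^ 2 + / c * (c * a - b) ^ 2.
    by field; lra.
  have := Rinv_0_lt_compat _ Hc; have := pow2_ge_0 (c * a - b); nra.
have Hsx : ex_series (fold_Z (fun k => (1 + c) * Cmod (x k) ^ 2)).
  by rewrite fold_Z_scal; apply: (ex_series_scal (V := R_NormedModule) (1 + c)).
have Hsy : ex_series (fold_Z (fun k => (1 + / c) * Cmod (y k) ^ 2)).
  by rewrite fold_Z_scal; apply: (ex_series_scal (V := R_NormedModule) (1 + / c)).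
have Hs : ex_series (fold_Z (fun k => (1 + c) * Cmod (x k) ^ 2 + (1 + / c) * Cmod (y k) ^ 2)).
  by rewrite fold_Z_plus; apply: (ex_series_plus (V := R_NormedModule) _ _ Hsx Hsy).
split; first exact: (ex_series_fold_Z_le _ _ H Hs).
apply: Rle_trans (Series_fold_Z_le _ _ H Hs) _.
rewrite fold_Z_plus Series_plus // !fold_Z_scal !Series_scal_l; exact: Rle_refl.
Qed.

Lemma in_ell2_plus x y : in_ell2 x -> in_ell2 y -> in_ell2 (ell2_plus x y).
Proof. by move=> Hx Hy; apply: (proj1 (ell2_sqnorm_plus_le x y 1 Rlt_0_1 Hx Hy)). Qed.

Lemma in_ell2_minus x y : in_ell2 x -> in_ell2 y -> in_ell2 (ell2_minus x y).
Proof.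
by move=> Hx Hy; rewrite ell2_minus_plus; apply: in_ell2_plus => //; apply: in_ell2_scal.
Qed.

Lemma ell2_norm_plus_le x y :
  in_ell2 x -> in_ell2 y -> ell2_norm (ell2_plus x y) <= ell2_norm x + ell2_norm y.
Proof.
move=> Hx Hy; have Hxy := in_ell2_plus x y Hx Hy.
have Hx0 := ell2_norm_ge0 x; have Hy0 := ell2_norm_ge0 y.
apply: le_epsilon => eps Heps.
(* The optimal weight is the quotient of the two norms; adding eps/2 to each keeps it defined and
   positive when a norm vanishes. *)
set a := ell2_norm x + eps / 2; set b := ell2_norm y + eps / 2.
have Ha : 0 < a by rewrite /a; lra.
have Hb : 0 < b by rewrite /b; lra.
have -> : ell2_norm x + ell2_norm y + eps = a + b by rewrite /a /b; lra.
apply: ell2_norm_le => //; first lra.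
have [_ H] := ell2_sqnorm_plus_le x y (b / a) (Rdiv_lt_0_compat _ _ Hb Ha) Hx Hy.
apply: Rle_trans H _; rewrite -!ell2_norm_sq //.
have Hxa : ell2_norm x ^ 2 <= a ^ 2 by apply: pow_incr; rewrite /a; lra.
have Hyb : ell2_norm y ^ 2 <= b ^ 2 by apply: pow_incr; rewrite /b; lra.
have -> : (a + b) ^ 2 = (1 + b / a) * a ^ 2 + (1 + / (b / a)) * b ^ 2 by field; lra.
have H1 : 0 < b / a by apply: Rdiv_lt_0_compat.
have H2 : 0 < / (b / a) by apply: Rinv_0_lt_compat.
by apply: Rplus_le_compat; apply: Rmult_le_compat_l => //; lra.
Qed.

Lemma ell2_norm_minus_le x y :
  in_ell2 x -> in_ell2 y -> ell2_norm (ell2_minus x y) <= ell2_norm x + ell2_norm y.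
Proof.
move=> Hx Hy; rewrite ell2_minus_plus.
apply: Rle_trans (ell2_norm_plus_le _ _ Hx (in_ell2_scal _ _ Hy)) _.
have := ell2_norm_scal_le (RtoC (-1)) y Hy; rewrite Cmod_R Rabs_left; lra.
Qed.

Lemma in_ell2_zero : in_ell2 ell2_zero.
Proof.
have H n : fold_Z (fun k => Cmod (ell2_zero k) ^ 2) n = 0.
  by rewrite /fold_Z /ell2_zero Cmod_0; ring.
apply: (proj1 (ex_series_nonneg_bounded _ 0 _ _)) => [n|n]; first by rewrite H; lra.
apply: Req_le; elim: n => [|n IH]; first by rewrite sum_O.
by rewrite sum_Sn IH H /plus /=; lra.
Qed.

Lemma ell2_norm_eq0 x : in_ell2 x -> ell2_norm x <= 0 -> forall k, x k = RtoC 0.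
Proof.
move=> Hx H k; apply: Cmod_eq_0; have := Cmod_le_ell2_norm x k Hx; have := Cmod_ge_0 (x k); lra.
Qed.

Lemma ell2_norm_zero : ell2_norm ell2_zero = 0.
Proof.
have H : ell2_norm ell2_zero <= 0 * ell2_norm ell2_zero.
  apply: (proj2 (ell2_dominated _ _ 0 (Rle_refl 0) in_ell2_zero _)) => k.
  by rewrite /ell2_zero Cmod_0; lra.
have := ell2_norm_ge0 ell2_zero; lra.
Qed.

(** Dominated convergence for the squared moduli, with majorant [c ^ 2 * Cmod (g k) ^ 2]. It reduces
    norm limits to coordinatewise limits: strong continuity, the generator, truncations and the
    boundary values. *)
Lemma ell2_lim_dominated {T} (F : (T -> Prop) -> Prop) {FF : Filter F}
    (x : T -> ell2_type) (y g : ell2_type) (c : R) :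
  in_ell2 g ->
  F (fun s => forall k, Cmod (x s k - y k)%C <= c * Cmod (g k)) ->
  (forall k eps, 0 < eps -> F (fun s => Cmod (x s k - y k)%C < eps)) ->
  ell2_lim F x y.
Proof.
move=> Hg Hdom Hpt eps.
have He2 : 0 < eps ^ 2 by apply: pow_lt; apply: cond_pos.
have Hs : ex_series (fold_Z (fun k => c ^ 2 * Cmod (g k) ^ 2)).
  by rewrite fold_Z_scal; apply: (ex_series_scal (V := R_NormedModule) (c ^ 2)).
have H := @dominated_convergence_fold_Z _ F FF (fun s k => Cmod (x s k - y k)%C ^ 2) _ Hs.
apply: filter_imp (H _ _ (eps ^ 2) He2).
- move=> s [H1 H2]; split=> //.
  rewrite -(sqrt_pow2 eps); last exact: Rlt_le (cond_pos eps).
  apply: sqrt_lt_1_alt; split=> //.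
  exact: ell2_sqnorm_ge0.
- apply: filter_imp Hdom => s Hs' k; split; first exact: Cmod_sq_ge0.
  rewrite -Rpow_mult_distr; apply: pow_incr; split=> //; exact: Cmod_ge_0.
- move=> k e He.
  have He' : 0 < sqrt e by apply: sqrt_lt_R0.
  apply: filter_imp (Hpt k _ He') => s Hlt.
  rewrite -(pow2_sqrt e); last lra.
  have := Cmod_ge_0 (x s k - y k)%C; nra.
Qed.

Lemma ell2_lim_coord {T} (F : (T -> Prop) -> Prop) {FF : Filter F}
    (x : T -> ell2_type) (y : ell2_type) k (eps : posreal) :
  ell2_lim F x y -> F (fun s => Cmod (x s k - y k)%C < eps).
Proof.
move=> H; apply: filter_imp (H eps) => s [H1 H2].
exact: Rle_lt_trans (Cmod_le_ell2_norm _ k H1) H2.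
Qed.

(** Fatou's lemma: each partial sum of squares passes to the limit together with its bound
    [M ^ 2]. *)
Lemma ell2_norm_le_of_coord_lim (x : nat -> ell2_type) (y : ell2_type) M :
  0 <= M -> 
  (forall n, in_ell2 (x n) /\ ell2_norm (x n) <= M) ->
  (forall k, is_lim_seq (fun n => Cmod (x n k)) (Cmod (y k))) ->
  in_ell2 y /\ ell2_norm y <= M.
Proof.
move=> HM Hx Hlim.
have Hb N : sum_n (fold_Z (fun k => Cmod (y k) ^ 2)) N <= M ^ 2.
  have Hl : is_lim_seq (fun n => sum_n (fold_Z (fun k => Cmod (x n k) ^ 2)) N)
     (sum_n (fold_Z (fun k => Cmod (y k) ^ 2)) N).
    have Hk k : is_lim_seq (fun n => Cmod (x n k) ^ 2) (Cmod (y k) ^ 2).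
      apply: (is_lim_seq_ext (fun n => Cmod (x n k) * Cmod (x n k))).
        by move=> n; rewrite /= Rmult_1_r.
      rewrite /= !Rmult_1_r.
      by apply: (is_lim_seq_mult' _ _ _ _ (Hlim k) (Hlim k)).
    elim: N => [|N IH].
      apply: (is_lim_seq_ext (fun n => fold_Z (fun k => Cmod (x n k) ^ 2) 0)).
        by move=> n; rewrite sum_O.
      by rewrite sum_O; apply: is_lim_seq_plus'.
    apply: (is_lim_seq_ext (fun n => sum_n (fold_Z (fun k => Cmod (x n k) ^ 2)) N +
       fold_Z (fun k => Cmod (x n k) ^ 2) (S N))).
      by move=> n; rewrite sum_Sn.
    rewrite sum_Sn; apply: is_lim_seq_plus' => //.
    exact: is_lim_seq_plus'.
  apply: (is_lim_seq_le _ (fun _ => M ^ 2) (Finite _) (Finite (M ^ 2)) _ Hl (is_lim_seq_const _)) => n.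
  have [Hin Hle] := Hx n.
  apply: Rle_trans (sum_n_nonneg_le_Series _ N _ Hin) _.
    by move=> m; apply: fold_Z_nonneg => k; apply: Cmod_sq_ge0.
  rewrite -/(ell2_sqnorm (x n)) -(ell2_norm_sq _ Hin).
  by apply: pow_incr; split=> //; apply: ell2_norm_ge0.
have [H1 H2] := ex_series_nonneg_bounded _ (M ^ 2)
  (fun n => fold_Z_nonneg _ n (fun k => Cmod_sq_ge0 (y k))) Hb.
by split=> //; apply: ell2_norm_le.
Qed.

(** * Uniform boundedness *)

Ltac ell2_ext := apply: functional_extensionality => k;
  rewrite /ell2_minus /ell2_plus /ell2_opp /ell2_scal /ell2_zero.

(** Completeness in quantitative form: the limit inherits the Cauchy rate [r], which the uniform
    boundedness argument needs explicitly. *)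
Lemma ell2_complete (x : nat -> ell2_type) (r : nat -> R) :
  (forall n, in_ell2 (x n)) ->
  (forall n m, (n <= m)%nat -> ell2_norm (ell2_minus (x m) (x n)) <= r n) ->
  is_lim_seq r 0 ->
  exists y, in_ell2 y /\ forall n, ell2_norm (ell2_minus y (x n)) <= r n.
Proof.
move=> Hx Hc Hr.
have Hxx n m : in_ell2 (ell2_minus (x m) (x n)) by apply: in_ell2_minus.
have Hk k n m : (n <= m)%nat -> Cmod (x m k - x n k)%C <= r n.
  by move=> Hnm; apply: Rle_trans (Hc n m Hnm); apply: (Cmod_le_ell2_norm (ell2_minus (x m) (x n)) k).
have Hcau (p : C -> R) : (forall z, Rabs (p z) <= Cmod z) -> (forall z w, p (z - w)%C = p z - p w) ->
    forall k, ex_finite_lim_seq (fun n => p (x n k)).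
  move=> Hp Hpm k; apply/ex_lim_seq_cauchy_corr => eps.
  move: Hr; rewrite -is_lim_seq_spec => Hr.
  have He : 0 < eps / 2 by have := cond_pos eps; lra.
  have [N HN] := Hr (mkposreal _ He).
  exists N => n m Hn Hm.
  have HrN := HN N (le_n N); rewrite /= in HrN; move/Rabs_def2: HrN => HrN.
  have H1 := Rle_trans _ _ _ (Hp (x n k - x N k)%C) (Hk k N n Hn).
  have H2 := Rle_trans _ _ _ (Hp (x m k - x N k)%C) (Hk k N m Hm).
  rewrite !Hpm in H1 H2.
  apply: Rabs_def1; move/Rabs_le_between: H1; move/Rabs_le_between: H2; lra.
have Hre z : Rabs (Re z) <= Cmod z := re_le_Cmod z.
have Him z : Rabs (Im z) <= Cmod z.
  by apply: Rle_trans (Rmax_r _ _) (Rmax_Cmod z).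
pose y : ell2_type := fun k =>
  (real (Lim_seq (fun n => Re (x n k))), real (Lim_seq (fun n => Im (x n k)))).
have Hy1 k : is_lim_seq (fun n => Re (x n k)) (Re (y k)).
  by apply: Lim_seq_correct'; apply: (Hcau Re Hre).
have Hy2 k : is_lim_seq (fun n => Im (x n k)) (Im (y k)).
  by apply: Lim_seq_correct'; apply: (Hcau Im Him).
have H n : in_ell2 (ell2_minus y (x n)) /\ ell2_norm (ell2_minus y (x n)) <= r n.
  (* Shifting the index by [n] makes the Cauchy bound valid for every term of the sequence. *)
  apply: (ell2_norm_le_of_coord_lim (fun m => ell2_minus (x (m + n)%nat) (x n))).
  - by apply: Rle_trans (ell2_norm_ge0 _) (Hc n n (le_n n)).
  - by move=> m; split; [apply: Hxx | apply: Hc; lia].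
  - move=> k; rewrite /ell2_minus.
    have HC a b : Cmod (a - b)%C = sqrt ((Re a - Re b) ^ 2 + (Im a - Im b) ^ 2) by [].
    apply: (is_lim_seq_ext (fun m => sqrt ((Re (x (m + n)%nat k) - Re (x n k)) ^ 2 +
       (Im (x (m + n)%nat k) - Im (x n k)) ^ 2))) => [m|]; first by rewrite HC.
    rewrite HC.
    apply: (is_lim_seq_continuous sqrt).
      by apply/continuity_pt_filterlim; apply: continuous_sqrt.
    have Hs (u : nat -> R) (l c : R) : is_lim_seq u l -> is_lim_seq (fun m => (u (m + n)%nat - c) ^ 2) ((l - c) ^ 2).
      move=> /(is_lim_seq_incr_n _ n) Hu.
      have Hd := is_lim_seq_minus' _ _ _ _ Hu (is_lim_seq_const c).
      have Hm := is_lim_seq_mult' _ _ _ _ Hd Hd.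
      rewrite /= Rmult_1_r; apply: is_lim_seq_ext Hm => m; rewrite /= Rmult_1_r //.
    exact: (is_lim_seq_plus' _ _ _ _ (Hs _ _ _ (Hy1 k)) (Hs _ _ _ (Hy2 k))).
exists y; split; last by move=> n; case: (H n).
have -> : y = ell2_plus (ell2_minus y (x 0%nat)) (x 0%nat).
  by ell2_ext; ring.
by apply: in_ell2_plus => //; case: (H 0%nat).
Qed.

Lemma bounded_operator_minus B x y :
  bounded_operator B -> in_ell2 x -> in_ell2 y ->
  B (ell2_minus x y) = ell2_minus (B x) (B y).
Proof.
move=> [HB1 [HB2 [HB3 _]]] Hx Hy.
by rewrite !ell2_minus_plus HB2 // ?HB3 //; apply: in_ell2_scal.
Qed.

Lemma ell2_norm_minus_ge x y :
  in_ell2 x -> in_ell2 y -> ell2_norm x - ell2_norm y <= ell2_norm (ell2_minus x y).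
Proof.
move=> Hx Hy.
have {1}-> : x = ell2_plus (ell2_minus x y) y by ell2_ext; ring.
have := ell2_norm_plus_le _ _ (in_ell2_minus x y Hx Hy) Hy; lra.
Qed.

(** The supremum over the unit ball. The constant in [bounded_operator] is merely some bound; the
    gliding hump needs one that is nearly attained. *)
Lemma operator_norm_exists B : bounded_operator B ->
  exists N, 0 <= N /\ (forall x, in_ell2 x -> ell2_norm (B x) <= N * ell2_norm x) /\
  forall c, c < N -> exists x, in_ell2 x /\ ell2_norm x <= 1 /\ c < ell2_norm (B x).
Proof.
move=> HB; have [HB1 [HB2 [HB3 [K HK]]]] := HB.
pose P r := exists x, in_ell2 x /\ ell2_norm x <= 1 /\ r = ell2_norm (B x).
have Pb : bound P.
  exists (Rabs K) => r [x [Hx [Hx1 ->]]].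
  apply: Rle_trans (HK x Hx) _; have := ell2_norm_ge0 x.
  have := Rle_abs K; have := Rabs_pos K; nra.
have P0 : P (ell2_norm (B ell2_zero)).
  by exists ell2_zero; split; [exact: in_ell2_zero | rewrite ell2_norm_zero; split=> //; lra].
have [N [HN1 HN2]] := completeness P Pb (ex_intro _ _ P0).
have HN0 : 0 <= N by apply: Rle_trans (ell2_norm_ge0 _) (HN1 _ P0).
exists N; split=> //; split.
  (* A vector of norm zero cannot be normalized; there the crude bound [K] already gives 0. *)
  move=> x Hx; case: (Rle_lt_dec (ell2_norm x) 0) => H0.
    have -> : ell2_norm x = 0 by have := ell2_norm_ge0 x; lra.
    have := HK x Hx; have := ell2_norm_ge0 x; have := ell2_norm_ge0 (B x).
    have -> : ell2_norm x = 0 by have := ell2_norm_ge0 x; lra.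
    by rewrite !Rmult_0_r; lra.
  pose y := ell2_scal (RtoC (/ ell2_norm x)) x.
  have Hy : in_ell2 y by apply: in_ell2_scal.
  have Hy1 : ell2_norm y <= 1.
    apply: Rle_trans (ell2_norm_scal_le _ _ Hx) _.
    rewrite Cmod_R Rabs_pos_eq; last by apply: Rlt_le; apply: Rinv_0_lt_compat.
    by apply: Req_le; field; lra.
  have -> : B x = ell2_scal (RtoC (ell2_norm x)) (B y).
    rewrite -HB3 //; congr B; rewrite /y; ell2_ext.
    rewrite Cmult_assoc -RtoC_mult Rinv_r; last lra.
    by rewrite Cmult_1_l.
  apply: Rle_trans (ell2_norm_scal_le _ _ (HB1 _ Hy)) _.
  rewrite Cmod_R Rabs_pos_eq; last lra.
  rewrite Rmult_comm; apply: Rmult_le_compat_r; first lra.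
  by apply: HN1; exists y.
move=> c Hc; apply: NNPP => Hn.
have : N <= c; last lra.
apply: HN2 => r [x [Hx [Hx1 ->]]].
by case: (Rle_lt_dec (ell2_norm (B x)) c) => // H; case: Hn; exists x.
Qed.

(* The two points x + xi and x - xi cannot both have small image, since their images differ by 2 B xi. *)
Lemma bounded_operator_large_nearby B x xi : bounded_operator B -> in_ell2 x -> in_ell2 xi ->
  exists y, in_ell2 y /\ ell2_norm (ell2_minus y x) <= ell2_norm xi /\
    ell2_norm (B xi) <= ell2_norm (B y).
Proof.
move=> HB Hx Hxi; have [HB1 [HB2 [HB3 _]]] := HB.
have Hp : in_ell2 (ell2_plus x xi) by apply: in_ell2_plus.
have Hm : in_ell2 (ell2_minus x xi) by apply: in_ell2_minus.
have H : ell2_norm (B xi) <= / 2 * (ell2_norm (B (ell2_plus x xi)) + ell2_norm (B (ell2_minus x xi))).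
  have E : B xi = ell2_scal (RtoC (/ 2)) (ell2_minus (B (ell2_plus x xi)) (B (ell2_minus x xi))).
    rewrite -bounded_operator_minus // -HB3; last by apply: in_ell2_minus.
    congr B; ell2_ext.
    have -> : (x k + xi k - (x k - xi k))%C = (RtoC 2 * xi k)%C.
      by rewrite RtoC_plus; ring.
    rewrite Cmult_assoc -RtoC_mult Rinv_l; last lra.
    by rewrite Cmult_1_l.
  have Hd : in_ell2 (ell2_minus (B (ell2_plus x xi)) (B (ell2_minus x xi))).
    by apply: in_ell2_minus; apply: HB1.
  rewrite {1}E.
  apply: Rle_trans (ell2_norm_scal_le _ _ Hd) _.
  rewrite Cmod_R Rabs_pos_eq; last lra.
  by apply: Rmult_le_compat_l; [lra|apply: ell2_norm_minus_le; apply: HB1].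
case: (Rle_lt_dec (ell2_norm (B xi)) (ell2_norm (B (ell2_plus x xi)))) => Hc.
  exists (ell2_plus x xi); split=> //; split=> //.
  have -> : ell2_minus (ell2_plus x xi) x = xi by ell2_ext; ring.
  exact: Rle_refl.
exists (ell2_minus x xi); split=> //; split; last lra.
have -> : ell2_minus (ell2_minus x xi) x = ell2_scal (RtoC (-1)) xi by ell2_ext; ring.
apply: Rle_trans (ell2_norm_scal_le _ _ Hxi) _.
by rewrite Cmod_R Rabs_left; lra.
Qed.

(** A gliding hump, in place of Baire's theorem. If the norms are unbounded, pick operators with
    norms [N j >= 4 ^ j] and move a point by at most [3 ^ (- j)] at step j so that its image under
    the j-th operator has norm at least [2 / 3 * N j * 3 ^ (- j)]. Later moves are too small to undo
    this, so the limit point has unbounded images. *)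
Lemma uniform_boundedness (T : nat -> ell2_type -> ell2_type) :
  (forall n, bounded_operator (T n)) ->
  (forall x, in_ell2 x -> exists B, forall n, ell2_norm (T n x) <= B) ->
  exists K, forall n x, in_ell2 x -> ell2_norm (T n x) <= K * ell2_norm x.
Proof.
move=> HT Hpw; apply: NNPP => Hno.
have Hbig j : exists p : nat * R, 4 ^ j <= snd p /\
   (forall x, in_ell2 x -> ell2_norm (T (fst p) x) <= snd p * ell2_norm x) /\
   exists xi, in_ell2 xi /\ ell2_norm xi <= 1 /\ 2 / 3 * snd p < ell2_norm (T (fst p) xi).
  apply: NNPP => Hj; apply: Hno; exists (4 ^ j) => n x Hx.
  have [N [HN0 [HN1 HN2]]] := operator_norm_exists _ (HT n).
  case: (Rle_lt_dec (4 ^ j) N) => Hc; last first.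
    apply: Rle_trans (HN1 x Hx) _.
    by apply: Rmult_le_compat_r; [exact: ell2_norm_ge0|lra].
  case: Hj; exists (n, N) => /=; split=> //; split=> //.
  apply: HN2; have : 0 < 4 ^ j by apply: pow_lt; lra.
  lra.
have [p Hp] := functional_choice _ Hbig.
pose S' j := T (fst (p j)); pose N j := snd (p j).
have Hpos j : 0 < / 3 ^ j by apply: Rinv_0_lt_compat; apply: pow_lt; lra.
(* The membership hypothesis stands under the existential so that [functional_choice] yields a total
   step map, which can then be iterated. *)
have Hstep (jx : nat * ell2_type) : exists y, in_ell2 (snd jx) -> in_ell2 y /\
    ell2_norm (ell2_minus y (snd jx)) <= / 3 ^ (fst jx) /\
    / 3 ^ (fst jx) * (2 / 3 * N (fst jx)) <= ell2_norm (S' (fst jx) y).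
  case: jx => j x /=.
  case: (classic (in_ell2 x)) => Hx; last by exists x.
  have [_ [_ [xi [Hxi [Hxi1 Hxi2]]]]] := Hp j.
  have [y [Hy [Hy1 Hy2]]] := bounded_operator_large_nearby (S' j) x
    (ell2_scal (RtoC (/ 3 ^ j)) xi) (HT _) Hx (in_ell2_scal _ _ Hxi).
  exists y => _; split=> //; split.
    apply: Rle_trans Hy1 _; apply: Rle_trans (ell2_norm_scal_le _ _ Hxi) _.
    rewrite Cmod_R Rabs_pos_eq; last exact: Rlt_le.
    rewrite -{2}(Rmult_1_r (/ 3 ^ j)).
    by apply: Rmult_le_compat_l => //; apply: Rlt_le.
  apply: Rle_trans Hy2.
  have [HB1 [_ [HB3 _]]] := HT (fst (p j)).
  apply: (Rmult_le_reg_l (3 ^ j)); first by apply: pow_lt; lra.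
  rewrite -Rmult_assoc Rinv_r ?Rmult_1_l; last by apply: pow_nonzero; lra.
  apply: Rle_trans (Rlt_le _ _ Hxi2) _.
  have Hin : in_ell2 (S' j (ell2_scal (RtoC (/ 3 ^ j)) xi)) by apply: HB1; apply: in_ell2_scal.
  have -> : T (fst (p j)) xi = ell2_scal (RtoC (3 ^ j)) (S' j (ell2_scal (RtoC (/ 3 ^ j)) xi)).
    rewrite -HB3; last by apply: in_ell2_scal.
    congr (T _); ell2_ext.
    rewrite Cmult_assoc -RtoC_mult Rinv_r ?Cmult_1_l //; apply: pow_nonzero; lra.
  apply: Rle_trans (ell2_norm_scal_le _ _ Hin) _.
  rewrite Cmod_R Rabs_pos_eq; first exact: Rle_refl.
  by apply: pow_le; lra.
have [f Hf] := functional_choice _ Hstep.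
pose x := fix x j := match j with O => ell2_zero | S i => f (i, x i) end.
have Hxin j : in_ell2 (x j).
  by elim: j => [|j IH]; [exact: in_ell2_zero | case: (Hf (j, x j) IH)].
have Hx1 j := proj1 (proj2 (Hf (j, x j) (Hxin j))).
have Hx2 j := proj2 (proj2 (Hf (j, x j) (Hxin j))).
rewrite /= in Hx1 Hx2.
(* The factor 3/2 is the sum of the geometric series of ratio 1/3; the induction is run on the exact
   partial sum [3 / 2 * (/ 3 ^ n - / 3 ^ (n + d))]. *)
have Hcau n m : (n <= m)%nat -> ell2_norm (ell2_minus (x m) (x n)) <= 3 / 2 * / 3 ^ n.
  move=> Hnm; have [d ->] : exists d, m = (n + d)%nat by exists (m - n)%nat; lia.
  apply: Rle_trans (_ : 3 / 2 * (/ 3 ^ n - / 3 ^ (n + d)) <= _); last first.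
    by have := Hpos (n + d)%nat; lra.
  elim: d => [|d IH].
    rewrite Nat.add_0_r Rminus_diag Rmult_0_r.
    have -> : ell2_minus (x n) (x n) = ell2_zero by ell2_ext; ring.
    by rewrite ell2_norm_zero; exact: Rle_refl.
  have -> : ell2_minus (x (n + S d)%nat) (x n) =
    ell2_plus (ell2_minus (x (S (n + d))) (x (n + d)%nat)) (ell2_minus (x (n + d)%nat) (x n)).
    by rewrite Nat.add_succ_r; ell2_ext; ring.
  apply: Rle_trans (ell2_norm_plus_le _ _ _ _) _.
  - by apply: in_ell2_minus; apply: Hxin.
  - by apply: in_ell2_minus; apply: Hxin.
  have H := Hx1 (n + d)%nat; rewrite -/x in H.
  have -> : / 3 ^ (n + S d) = / 3 * / 3 ^ (n + d).
    by rewrite Nat.add_succ_r /= Rinv_mult.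
  apply: Rle_trans (Rplus_le_compat _ _ _ _ H IH) _; lra.
have Hlim : is_lim_seq (fun n => 3 / 2 * / 3 ^ n) 0.
  rewrite -(Rmult_0_r (3 / 2)).
  apply: (is_lim_seq_mult' _ _ _ _ (is_lim_seq_const _)).
  apply: (is_lim_seq_ext (fun n => (/ 3) ^ n)) => [n|]; first by rewrite pow_inv.
  by apply: is_lim_seq_geom; rewrite Rabs_pos_eq; lra.
have [y [Hy Hyn]] := ell2_complete x _ Hxin Hcau Hlim.
have [B HB] := Hpw y Hy.
(* The hump gives 2/3 and the remaining displacement from [x (S j)] to [y] costs at most
   [3 / 2 * / 3 = / 2], both in units of [N j * / 3 ^ j]. The difference is 1/6, and [N j >= 4 ^ j]
   turns the unit into at least [(4 / 3) ^ j]. *)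
have Hbound j : (4 / 3) ^ j / 6 <= B.
  apply: Rle_trans (HB (fst (p j))).
  have [Hp1 [Hp2 _]] := Hp j.
  have Hd : in_ell2 (ell2_minus (x (S j)) y) by apply: in_ell2_minus.
  have HTB := proj1 (HT (fst (p j))).
  have H1 : ell2_norm (S' j (x (S j))) <= ell2_norm (S' j y) + ell2_norm (S' j (ell2_minus (x (S j)) y)).
    rewrite bounded_operator_minus //; last exact: HT.
    have := ell2_norm_minus_ge _ _ (HTB _ (Hxin (S j))) (HTB _ Hy).
    rewrite /S'; lra.
  have H2 := Hp2 _ Hd.
  have H3 : ell2_norm (ell2_minus (x (S j)) y) <= / 2 * / 3 ^ j.
    have E : ell2_minus (x (S j)) y = ell2_scal (RtoC (-1)) (ell2_minus y (x (S j))) by ell2_ext; ring.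
    rewrite E; apply: Rle_trans (ell2_norm_scal_le _ _ (in_ell2_minus _ _ Hy (Hxin (S j)))) _.
    rewrite Cmod_R Rabs_left; last lra.
    have := Hyn (S j); rewrite [3 ^ S j]/= Rinv_mult; lra.
  have H4 := Hx2 j; rewrite -/(x (S j)) in H4.
  have E : (4 / 3) ^ j = 4 ^ j * / 3 ^ j by rewrite /Rdiv Rpow_mult_distr pow_inv.
  have H5 : 4 ^ j * / 3 ^ j <= N j * / 3 ^ j.
    by apply: Rmult_le_compat_r => //; apply: Rlt_le.
  have HN : 0 <= N j by apply: Rle_trans Hp1; apply: pow_le; lra.
  have H6 : N j * ell2_norm (ell2_minus (x (S j)) y) <= N j * (/ 2 * / 3 ^ j).
    exact: Rmult_le_compat_l.
  rewrite -/(S' j) -/(N j) in H2 H6 |- *; rewrite E; lra.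
have Hp43 : 1 < 4 / 3 by lra.
have [n Hn] := Pow_x_infinity (4 / 3) ltac:(rewrite Rabs_pos_eq; lra) (6 * B + 1).
have := Hn n (le_n n); rewrite Rabs_pos_eq; last by apply: pow_le; lra.
have := Hbound n; lra.
Qed.

(** * Semigroups with diagonal generator *)

Lemma at_right_iff (a : R) (P : R -> Prop) :
  at_right a P <-> exists d, 0 < d /\ forall h, a < h < a + d -> P h.
Proof.
split.
  move=> [d Hd]; exists d; split; first exact: cond_pos.
  move=> h Hh; apply: Hd; last lra.
  rewrite /ball /= /AbsRing_ball /= /abs /minus /plus /opp /=.
  by apply: Rabs_def1; lra.
move=> [d [Hd H]]; exists (mkposreal d Hd) => h.
rewrite /ball /= /AbsRing_ball /= /abs /minus /plus /opp /= => /Rabs_def2 Hb Hh.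
by apply: H; lra.
Qed.

Lemma at_left_iff (a : R) (P : R -> Prop) :
  at_left a P <-> exists d, 0 < d /\ forall h, a - d < h < a -> P h.
Proof.
split.
  move=> [d Hd]; exists d; split; first exact: cond_pos.
  move=> h Hh; apply: Hd; last lra.
  rewrite /ball /= /AbsRing_ball /= /abs /minus /plus /opp /=.
  by apply: Rabs_def1; lra.
move=> [d [Hd H]]; exists (mkposreal d Hd) => h.
rewrite /ball /= /AbsRing_ball /= /abs /minus /plus /opp /= => /Rabs_def2 Hb Hh.
by apply: H; lra.
Qed.

(** From [exp (- u) <= 1 / (1 + u) <= 1 - u + u ^ 2]. The quadratic remainder controls both the
    difference quotients of the diagonal semigroup and the error of one small time step. *)
Lemma exp_neg_bounds u : 0 <= u -> 1 - u <= exp (- u) <= 1 /\ exp (- u) <= 1 - u + u ^ 2.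
Proof.
move=> Hu; have H1 := exp_ineq1_le (- u); have H2 := exp_ineq1_le u.
have H3 := exp_pos (- u).
have H4 : exp (- u) * exp u = 1 by rewrite -exp_plus Rplus_opp_l exp_0.
split; nra.
Qed.

Lemma filter_Cmod_mult_small {T} (F : (T -> Prop) -> Prop) {FF : Filter F} (f : T -> R) (z : C) :
  (forall eps, 0 < eps -> F (fun s => Rabs (f s) < eps)) ->
  forall eps, 0 < eps -> F (fun s => Cmod (RtoC (f s) * z)%C < eps).
Proof.
move=> H eps Heps; have Hz := Cmod_ge_0 z.
have He : 0 < eps / (Cmod z + 1) by apply: Rdiv_lt_0_compat; lra.
apply: filter_imp (H _ He) => s Hs; rewrite Cmod_mult Cmod_R.
apply: Rle_lt_trans (_ : Rabs (f s) * (Cmod z + 1) < eps).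
  by have := Rabs_pos (f s); nra.
have -> : eps = eps / (Cmod z + 1) * (Cmod z + 1) by field; lra.
by apply: Rmult_lt_compat_r; lra.
Qed.

Definition diag_op (d : Z -> R) (x : ell2_type) : ell2_type := fun k => (RtoC (d k) * x k)%C.

(** Multiplication on its maximal domain: [in_ell2 y] is the domain condition on [x]. *)
Definition diag_graph (lam : Z -> R) : operator_graph := fun x y =>
  in_ell2 x /\ in_ell2 y /\ forall k, y k = (RtoC (lam k) * x k)%C.

Definition diag_semigroup (lam : Z -> R) (t : R) : ell2_type -> ell2_type :=
  diag_op (fun k => exp (- (t * lam k))).

Lemma diag_op_contraction d x : (forall k, 0 <= d k <= 1) -> in_ell2 x ->
  in_ell2 (diag_op d x) /\ ell2_norm (diag_op d x) <= 1 * ell2_norm x.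
Proof.
move=> Hd Hx; apply: ell2_dominated => // [|k]; first lra.
rewrite /diag_op Cmod_mult Cmod_R Rabs_pos_eq; last by move: (Hd k); lra.
by apply: Rmult_le_compat_r; [exact: Cmod_ge_0 | move: (Hd k); lra].
Qed.

Lemma diag_op_bounded d : (forall k, 0 <= d k <= 1) -> bounded_operator (diag_op d).
Proof.
move=> Hd; split; first by move=> x Hx; case: (diag_op_contraction d x Hd Hx).
split; first by move=> x y _ _; rewrite /diag_op; ell2_ext; ring.
split; first by move=> c x _; rewrite /diag_op; ell2_ext; ring.
by exists 1 => x Hx; case: (diag_op_contraction d x Hd Hx).
Qed.

Section DiagonalSemigroup.
Variable lam : Z -> R.
Hypothesis lam_ge0 : forall k, 0 <= lam k.

Lemma diag_semigroup_coef t k : 0 <= t -> 0 <= exp (- (t * lam k)) <= 1.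
Proof.
move=> Ht; have Hu : 0 <= t * lam k by apply: Rmult_le_pos.
have := exp_neg_bounds _ Hu; have := exp_pos (- (t * lam k)); lra.
Qed.

Lemma diag_semigroup_strongly_continuous x : in_ell2 x ->
  ell2_lim (at_right 0) (fun h => diag_semigroup lam h x) x.
Proof.
move=> Hx.
have E h k : (diag_semigroup lam h x k - x k)%C = (RtoC (exp (- (h * lam k)) - 1) * x k)%C.
  by rewrite /diag_semigroup /diag_op RtoC_minus; ring.
have Hb h k : 0 < h -> Rabs (exp (- (h * lam k)) - 1) <= Rmin 1 (h * lam k).
  move=> Hh; have Hu : 0 <= h * lam k by apply: Rmult_le_pos => //; lra.
  have := exp_neg_bounds _ Hu; have := exp_pos (- (h * lam k)) => H1 H2.
  by rewrite Rabs_left1; [apply: Rmin_glb; lra | lra].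
apply: (ell2_lim_dominated _ _ _ x 1 Hx).
  apply/at_right_iff; exists 1; split; first lra.
  move=> h [Hh _] k; rewrite E Cmod_mult Cmod_R.
  apply: Rmult_le_compat_r; first exact: Cmod_ge_0.
  exact: Rle_trans (Hb h k Hh) (Rmin_l _ _).
move=> k eps Heps; have Hl := lam_ge0 k.
apply: (filter_imp (fun h => Cmod (RtoC (exp (- (h * lam k)) - 1) * x k)%C < eps)).
  by move=> h; rewrite E.
apply: filter_Cmod_mult_small eps Heps => eps Heps.
apply/at_right_iff; exists (eps / (lam k + 1)); split; first by apply: Rdiv_lt_0_compat; lra.
move=> h [Hh Hh2]; rewrite Rplus_0_l in Hh2.
apply: Rle_lt_trans (Hb h k Hh) _; apply: Rle_lt_trans (Rmin_r _ _) _.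
apply: Rle_lt_trans (_ : h * (lam k + 1) < _); first nra.
have -> : eps = eps / (lam k + 1) * (lam k + 1) by field; lra.
by apply: Rmult_lt_compat_r; lra.
Qed.

Lemma diag_semigroup_diff_quotient h k x : h <> 0 ->
  ell2_scal (RtoC (/ h)) (ell2_minus (diag_semigroup lam h x) x) k =
  (RtoC ((exp (- (h * lam k)) - 1 + h * lam k) / h) * x k - RtoC (lam k) * x k)%C.
Proof.
move=> Hh; rewrite /ell2_scal /ell2_minus /diag_semigroup /diag_op.
have -> : (exp (- (h * lam k)) - 1 + h * lam k) / h = / h * (exp (- (h * lam k)) - 1) + lam k by field.
rewrite RtoC_plus RtoC_mult RtoC_minus; ring.
Qed.

(** The two bounds play different roles: [l] is uniform in [h] and provides the dominating sequence
    [lam k * x k], square summable exactly on the domain; [h * l ^ 2] gives the limit in each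
    coordinate. *)
Lemma diff_quotient_bound h l : 0 < h -> 0 <= l ->
  0 <= (exp (- (h * l)) - 1 + h * l) / h <= Rmin l (h * l ^ 2).
Proof.
move=> Hh Hl; have Hu : 0 <= h * l by apply: Rmult_le_pos => //; lra.
have [H1 H2] := exp_neg_bounds _ Hu.
have Hi := Rinv_0_lt_compat _ Hh.
split; first by apply: Rmult_le_pos; lra.
apply: Rmin_glb; apply: (Rmult_le_reg_r h) => //; rewrite /Rdiv Rmult_assoc Rinv_l; nra.
Qed.

Lemma diff_quotient_small k z eps : 0 < eps ->
  at_right 0 (fun h => Cmod (RtoC ((exp (- (h * lam k)) - 1 + h * lam k) / h) * z)%C < eps).
Proof.
move=> Heps; have Hl := lam_ge0 k.
apply: filter_Cmod_mult_small eps Heps => eps Heps.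
have Hl2 : 0 < lam k ^ 2 + 1 by have := pow2_ge_0 (lam k); lra.
apply/at_right_iff; exists (eps / (lam k ^ 2 + 1)); split; first by apply: Rdiv_lt_0_compat.
move=> h [Hh Hh2]; rewrite Rplus_0_l in Hh2.
have [H1 H2] := diff_quotient_bound h (lam k) Hh Hl.
rewrite Rabs_pos_eq //; apply: Rle_lt_trans H2 _; apply: Rle_lt_trans (Rmin_r _ _) _.
apply: Rle_lt_trans (_ : h * (lam k ^ 2 + 1) < _); first nra.
have -> : eps = eps / (lam k ^ 2 + 1) * (lam k ^ 2 + 1) by field; lra.
by apply: Rmult_lt_compat_r; lra.
Qed.

Lemma diag_semigroup_generator x y : in_ell2 x -> in_ell2 y ->
  (diag_graph lam x y <->
   ell2_lim (at_right 0)
     (fun h => ell2_scal (RtoC (/ h)) (ell2_minus (diag_semigroup lam h x) x)) (ell2_opp y)).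
Proof.
move=> Hx Hy; split.
  move=> [_ [_ Hxy]].
  have E h k : h <> 0 -> 
    (ell2_scal (RtoC (/ h)) (ell2_minus (diag_semigroup lam h x) x) k - ell2_opp y k)%C =
    (RtoC ((exp (- (h * lam k)) - 1 + h * lam k) / h) * x k)%C.
    by move=> Hh; rewrite diag_semigroup_diff_quotient // /ell2_opp Hxy; ring.
  apply: (ell2_lim_dominated _ _ _ y 1 Hy).
    apply/at_right_iff; exists 1; split; first lra.
    move=> h [Hh _] k; rewrite E; last lra.
    rewrite Hxy !Cmod_mult Rmult_1_l !Cmod_R.
    apply: Rmult_le_compat_r; first exact: Cmod_ge_0.
    have [H1 H2] := diff_quotient_bound h (lam k) Hh (lam_ge0 k).
    rewrite !Rabs_pos_eq //; apply: Rle_trans H2 _; exact: Rmin_l.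
  move=> k eps Heps.
  have Hn : at_right 0 (fun h => h <> 0).
    by apply/at_right_iff; exists 1; split; [lra | move=> h Hh; lra].
  apply: filter_imp (filter_and _ _ Hn (diff_quotient_small k (x k) eps Heps)) => h [Hh].
  by rewrite E.
(* Conversely, a norm limit determines every coordinate. A positive defect [D] in coordinate k is
   contradicted at a common small [h] at which the assumed limit and the true coordinate limit both
   hold within D/2. *)
move=> Hlim; split=> //; split=> // k.
apply: NNPP => Hne.
have Hd : (y k - RtoC (lam k) * x k)%C <> RtoC 0.
  move=> H; apply: Hne.
  have -> : y k = (y k - RtoC (lam k) * x k + RtoC (lam k) * x k)%C by ring.
  by rewrite H; ring.
have Hpos := proj1 (Cmod_gt_0 _) Hd.
set D := Cmod _ in Hpos.
have He : 0 < D / 2 by lra.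
have Hn : at_right 0 (fun h => h <> 0).
  by apply/at_right_iff; exists 1; split; [lra | move=> h Hh; lra].
have H1 := @ell2_lim_coord _ _ (@filter_filter _ _ (at_right_proper_filter 0)) _ _ k (mkposreal _ He) Hlim.
have H2 := diff_quotient_small k (x k) (D / 2) He.
have [h [Hh [H3 H4]]] := filter_ex (F := at_right 0) _ (filter_and _ _ Hn (filter_and _ _ H1 H2)).
move: H3; rewrite diag_semigroup_diff_quotient // /ell2_opp /=.
set w := (RtoC _ * x k)%C in H4 *; move=> H3.
have : D <= Cmod (w - RtoC (lam k) * x k - - y k)%C + Cmod w.
  rewrite /D -[Cmod w]Cmod_opp.
  apply: Rle_trans (Cmod_triangle _ _); apply: Req_le; congr Cmod; ring.
lra.
Qed.

Lemma diag_is_exp_semigroup : is_exp_semigroup (diag_graph lam) (diag_semigroup lam).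
Proof.
split.
  by move=> t Ht; apply: diag_op_bounded => k; apply: diag_semigroup_coef.
split.
  move=> x Hx; rewrite /diag_semigroup /diag_op; ell2_ext.
  by rewrite Rmult_0_l Ropp_0 exp_0 Cmult_1_l.
split.
  move=> s t x _ _ _; rewrite /diag_semigroup /diag_op; ell2_ext.
  have -> : - ((s + t) * lam k) = - (s * lam k) + - (t * lam k) by ring.
  by rewrite exp_plus RtoC_mult Cmult_assoc.
split; first exact: diag_semigroup_strongly_continuous.
exact: diag_semigroup_generator.
Qed.

End DiagonalSemigroup.

Lemma bounded_above_of_eventually (u : nat -> R) N B :
  (forall n, (N <= n)%nat -> u n <= B) -> exists B', forall n, u n <= B'.
Proof.
elim: N B => [|N IH] B H; first by exists B => n; apply: H; lia.
apply: (IH (Rmax B (u N))) => n Hn.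
case: (Nat.eq_dec n N) => [->|Hne]; first exact: Rmax_r.
by apply: Rle_trans (Rmax_l _ _); apply: H; lia.
Qed.

(** Strong continuity is only pointwise in [x]. If no uniform bound held near 0, there would be
    times [h n <= / INR (S n)] with norms exceeding n, whereas each orbit [E (h n) x] is bounded
    because it converges to [x]. *)
Lemma exp_semigroup_locally_bounded M E : is_exp_semigroup M E ->
  exists d K, 0 < d /\ 0 <= K /\
    forall h x, 0 <= h <= d -> in_ell2 x -> ell2_norm (E h x) <= K * ell2_norm x.
Proof.
move=> [HB [H0 [_ [Hc _]]]]; apply: NNPP => Hno.
have Hn n : exists h, 0 <= h <= / INR (S n) /\
    exists x, in_ell2 x /\ INR n * ell2_norm x < ell2_norm (E h x).
  apply: NNPP => H; apply: Hno; exists (/ INR (S n)), (INR n).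
  have HS : 0 < INR (S n) by apply: lt_0_INR; lia.
  split; first exact: Rinv_0_lt_compat.
  split; first exact: pos_INR.
  move=> h x Hh Hx; case: (Rle_lt_dec (ell2_norm (E h x)) (INR n * ell2_norm x)) => // Hlt.
  by case: H; exists h; split=> //; exists x.
have [h Hh] := functional_choice _ Hn.
have [K HK] : exists K, forall n x, in_ell2 x -> ell2_norm (E (h n) x) <= K * ell2_norm x.
  apply: uniform_boundedness => [n|x Hx].
    by apply: HB; case: (Hh n) => [[]].
  have /at_right_iff [d [Hd Hd2]] := Hc x Hx (mkposreal 1 Rlt_0_1).
  have [N HN] := archimed_cor1 d Hd.
  apply: (bounded_above_of_eventually _ N (ell2_norm x + 1)) => n HnN.
  have [[Hh1 Hh2] _] := Hh n.
  (* The filter [at_right 0] says nothing at time 0, where [E 0 x = x] is used instead. *)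
  case: (Req_dec (h n) 0) => [->|Hne]; first by rewrite H0 //; lra.
  have Hlt : h n < d.
    apply: Rle_lt_trans Hh2 _; apply: Rle_lt_trans (proj1 HN).
    apply: Rinv_le_contravar; first by apply: lt_0_INR; lia.
    by apply: le_INR; lia.
  have [H1 H2] := Hd2 (h n) ltac:(lra); rewrite /= in H2.
  have HE : in_ell2 (E (h n) x) by apply: (proj1 (HB _ Hh1)).
  have := ell2_norm_minus_ge _ _ HE Hx; lra.
have [n HnK] := INR_unbounded (Rabs K).
have [_ [x [Hx Hlt]]] := Hh n.
have := HK n x Hx; have := ell2_norm_ge0 x; have := Rle_abs K; nra.
Qed.

(** Over a time step [h = t / n] the error [D h] is o(h) by the generator condition at 0. The n
    errors are transported with factors at most [K], so their total is [n * K * o(t / n)], which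
    tends to 0. The restriction to small [t] is due to [K] bounding the operators only near 0. *)
Lemma exp_semigroup_eigenvector_local M E e l :
  is_exp_semigroup M E -> in_ell2 e -> 0 <= l -> M e (ell2_scal (RtoC l) e) ->
  exists d, 0 < d /\ forall t, 0 <= t <= d -> E t e = ell2_scal (RtoC (exp (- (t * l)))) e.
Proof.
move=> HE He Hl HM.
have [d [K [Hd [HK0 HK]]]] := exp_semigroup_locally_bounded M E HE.
have [HB [H0 [Hsg [_ Hgen]]]] := HE.
exists d; split=> // t Ht.
have Hin s x : 0 <= s -> in_ell2 x -> in_ell2 (E s x) by move=> Hs; apply: (proj1 (HB s Hs)).
case: (Req_dec t 0) => [->|Ht0].
  by rewrite H0 //; ell2_ext; rewrite Rmult_0_l Ropp_0 exp_0 Cmult_1_l.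
pose D h := ell2_minus (E h e) (ell2_scal (RtoC (exp (- (h * l)))) e).
have HD h : 0 <= h -> in_ell2 (D h) by move=> Hh; apply: in_ell2_minus; [apply: Hin|apply: in_ell2_scal].
have HDs m h : 0 <= h -> INR m * h <= d -> ell2_norm (D (INR m * h)) <= INR m * (K * ell2_norm (D h)).
  move=> Hh; elim: m => [|m IH] Hm.
    rewrite /= !Rmult_0_l; have -> : D 0 = ell2_zero.
      by rewrite /D H0 //; ell2_ext; rewrite Rmult_0_l Ropp_0 exp_0; ring.
    by rewrite ell2_norm_zero; lra.
  have Hm0 : 0 <= INR m * h by apply: Rmult_le_pos => //; apply: pos_INR.
  have HS : INR (S m) * h = INR m * h + h by rewrite S_INR; ring.
  rewrite HS in Hm *.
  (* One telescoping step: the first application [E h e] is replaced by its scalar multiple of [e],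
     and the error [D h] is carried along by [E (INR m * h)]. *)
  have -> : D (INR m * h + h) = ell2_plus (E (INR m * h) (D h))
      (ell2_scal (RtoC (exp (- (h * l)))) (D (INR m * h))).
    have HBm := HB _ Hm0.
    rewrite /D (bounded_operator_minus _ _ _ HBm); [| exact: Hin | exact: in_ell2_scal].
    rewrite Hsg //; have [_ [_ [-> // _]]] := HBm.
    have -> : - ((INR m * h + h) * l) = - (h * l) + - (INR m * h * l) by ring.
    rewrite exp_plus RtoC_mult; ell2_ext; ring.
  apply: Rle_trans (ell2_norm_plus_le _ _ _ _) _.
  - by apply: Hin => //; apply: HD.
  - by apply: in_ell2_scal; apply: HD.
  have H1 := HK (INR m * h) (D h) ltac:(lra) (HD h Hh).
  have H2 : ell2_norm (ell2_scal (RtoC (exp (- (h * l)))) (D (INR m * h))) <= ell2_norm (D (INR m * h)).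
    apply: Rle_trans (ell2_norm_scal_le _ _ (HD _ Hm0)) _.
    rewrite Cmod_R Rabs_pos_eq; last exact: Rlt_le (exp_pos _).
    have Hhl : 0 <= h * l by apply: Rmult_le_pos.
    have [[_ He1] _] := exp_neg_bounds _ Hhl.
    have := ell2_norm_ge0 (D (INR m * h)); nra.
  have H3 := IH ltac:(lra).
  rewrite S_INR; lra.
have Hsmall eps : 0 < eps -> ell2_norm (D t) <= t * K * (eps + eps).
  move=> Heps.
  have Hy : in_ell2 (ell2_scal (RtoC l) e) by apply: in_ell2_scal.
  have /at_right_iff [d1 [Hd1 Hd1']] := proj1 (Hgen e _ He Hy) HM (mkposreal _ Heps).
  have Hne := ell2_norm_ge0 e.
  (* Below [d2] the quadratic remainder [(h * l) ^ 2 * ell2_norm e] is at most [h * eps]. This is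
     one of the two eps; the other comes from the difference quotient at 0. *)
  pose d2 := eps / (l ^ 2 * ell2_norm e + 1).
  have Hden : 0 < l ^ 2 * ell2_norm e + 1.
    by have := Rmult_le_pos _ _ (pow2_ge_0 l) Hne; lra.
  have Hd2 : 0 < d2 by apply: Rdiv_lt_0_compat.
  have Hmin : 0 < Rmin d1 d2 / t by apply: Rdiv_lt_0_compat; [apply: Rmin_pos|lra].
  have [n [Hn Hn0]] := archimed_cor1 _ Hmin.
  have HnR : 0 < INR n by apply: lt_0_INR.
  pose h := t / INR n.
  have Hh : 0 < h by apply: Rdiv_lt_0_compat; lra.
  have Hhm : h < Rmin d1 d2.
    have -> : Rmin d1 d2 = t * (Rmin d1 d2 / t) by field.
    by apply: Rmult_lt_compat_l; lra.
  have Hh1 : h < d1 by have := Rmin_l d1 d2; lra.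
  have Hh2 : h < d2 by have := Rmin_r d1 d2; lra.
  have Hnh : INR n * h = t by rewrite /h; field; lra.
  have H1 := HDs n h ltac:(lra) ltac:(lra); rewrite Hnh in H1.
  apply: Rle_trans H1 _.
  have [H2 H3] := Hd1' h ltac:(lra); rewrite /= in H3.
  set Q := ell2_minus _ _ in H2 H3.
  have HDh : ell2_norm (D h) <= h * (eps + eps).
    (* [Q] is the difference quotient minus its limit [- l e], so [h * Q] is the error with respect
       to the affine approximation of the exponential; the second term corrects that
       approximation. *)
    have ED : D h = ell2_minus (ell2_scal (RtoC h) Q)
        (ell2_scal (RtoC (exp (- (h * l)) - 1 + h * l)) e).
      rewrite /D /Q; ell2_ext.
      rewrite RtoC_plus RtoC_minus RtoC_mult RtoC_inv; last lra.
      have Hhc : RtoC h <> RtoC 0 by move/RtoC_inj; lra.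
      by field.
    rewrite ED; apply: Rle_trans (ell2_norm_minus_le _ _ _ _) _.
    - exact: in_ell2_scal.
    - exact: in_ell2_scal.
    have H4 := ell2_norm_scal_le (RtoC h) Q H2.
    rewrite Cmod_R Rabs_pos_eq in H4; last lra.
    have H5 := ell2_norm_scal_le (RtoC (exp (- (h * l)) - 1 + h * l)) e He.
    have Hhl : 0 <= h * l by apply: Rmult_le_pos; lra.
    have [H6 H7] := exp_neg_bounds _ Hhl.
    rewrite Cmod_R Rabs_pos_eq in H5; last lra.
    have H8 : (exp (- (h * l)) - 1 + h * l) * ell2_norm e <= h * (h * (l ^ 2 * ell2_norm e + 1)).
      apply: Rle_trans (Rmult_le_compat_r _ _ ((h * l) ^ 2) Hne _) _; first lra.
      have := pow2_ge_0 h; nra.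
    have H9 : h * (l ^ 2 * ell2_norm e + 1) <= eps.
      apply: Rlt_le; apply: Rlt_le_trans (Rmult_lt_compat_r _ _ _ Hden Hh2) _.
      by apply: Req_le; rewrite /d2; field; lra.
    have H10 := Rmult_le_compat_l h _ _ (Rlt_le _ _ Hh) H9.
    have H11 : h * ell2_norm Q <= h * eps by apply: Rmult_le_compat_l; lra.
    lra.
  rewrite -Hnh.
  apply: Rle_trans (Rmult_le_compat_l _ _ _ (Rlt_le _ _ HnR)
    (Rmult_le_compat_l _ _ _ HK0 HDh)) _.
  apply: Req_le; ring.
have HDt : ell2_norm (D t) <= 0.
  apply: le_epsilon => eps Heps; rewrite Rplus_0_l.
  have Hden : 0 < 2 * (t * K + 1).
    by have := Rmult_le_pos t K ltac:(lra) HK0; lra.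
  have Hq : 0 < eps / (2 * (t * K + 1)) by apply: Rdiv_lt_0_compat.
  apply: Rle_trans (Hsmall _ Hq) _.
  apply: Rle_trans (_ : (t * K + 1) * (eps / (2 * (t * K + 1)) + eps / (2 * (t * K + 1))) <= _).
    by apply: Rmult_le_compat_r; lra.
  by apply: Req_le; field; lra.
have Hz := ell2_norm_eq0 (D t) (HD t ltac:(lra)) HDt.
apply: functional_extensionality => k.
have := Hz k; rewrite /D /ell2_minus => H.
have -> : E t e k = (E t e k - ell2_scal (RtoC (exp (- (t * l)))) e k + ell2_scal (RtoC (exp (- (t * l)))) e k)%C by ring.
by rewrite H; ring.
Qed.

Lemma exp_semigroup_eigenvector M E e l t :
  is_exp_semigroup M E -> in_ell2 e -> 0 <= l -> M e (ell2_scal (RtoC l) e) ->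
  0 <= t -> E t e = ell2_scal (RtoC (exp (- (t * l)))) e.
Proof.
move=> HE He Hl HM Ht.
have [d [Hd Hloc]] := exp_semigroup_eigenvector_local M E e l HE He Hl HM.
have [HB [H0 [Hsg _]]] := HE.
have H m h : 0 <= h <= d -> E (INR m * h) e = ell2_scal (RtoC (exp (- (INR m * h * l)))) e.
  move=> Hh; elim: m => [|m IH].
    rewrite /= Rmult_0_l H0 //; ell2_ext.
    by rewrite Rmult_0_l Ropp_0 exp_0 Cmult_1_l.
  have Hm0 : 0 <= INR m * h by apply: Rmult_le_pos; [apply: pos_INR|lra].
  have -> : INR (S m) * h = INR m * h + h by rewrite S_INR; ring.
  rewrite Hsg //; last lra.
  rewrite Hloc //; have [_ [_ [-> // _]]] := HB _ Hm0.
  rewrite IH.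
  have -> : - ((INR m * h + h) * l) = - (h * l) + - (INR m * h * l) by ring.
  by rewrite exp_plus RtoC_mult; ell2_ext; ring.
(* The denominator [t + 1] instead of [t] also covers [t = 0]. *)
have Hq : 0 < d / (t + 1) by apply: Rdiv_lt_0_compat; lra.
have [n [Hn Hn0]] := archimed_cor1 _ Hq.
have HnR : 0 < INR n by apply: lt_0_INR.
have -> : t = INR n * (t / INR n) by field; lra.
apply: H; split; first by apply: Rdiv_le_0_compat.
apply: Rle_trans (_ : (t + 1) * (d / (t + 1)) <= d); last by apply: Req_le; field; lra.
by apply: Rmult_le_compat; [lra | apply: Rlt_le; apply: Rinv_0_lt_compat | lra | lra].
Qed.

(** * Finitely supported sequences and uniqueness of the semigroup *)

Definition ell2_unit (j : Z) : ell2_type := fun k => if Z.eqb k j then RtoC 1 else RtoC 0.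

Lemma is_series_single (a : nat -> R) m :
  (forall n, n <> m -> a n = 0) -> is_series a (a m).
Proof.
move=> H.
have HS n : sum_n a (S n) = sum_n a n + a (S n) by rewrite sum_Sn.
have Hlt i : (i < m)%nat -> (sum_n a i : R) = 0.
  elim: i => [|i IH] Hi; first by rewrite sum_O H //; lia.
  by rewrite HS IH ?H; [ring | lia | lia].
have Hm : (sum_n a m : R) = a m.
  case E : m => [|p]; first by rewrite sum_O.
  by rewrite HS Hlt; [ring | lia].
apply: (filterlim_ext_loc (fun _ => a m)); last exact: filterlim_const.
exists m => n; elim: n => [|n IH] Hn; first by (have E : m = 0%nat by lia); rewrite -Hm E.
case: (Nat.eq_dec m (S n)) => [<-//|Hne].
rewrite HS (H (S n)); last lia.
rewrite Rplus_0_r; apply: IH; lia.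
Qed.

Lemma is_series_fold_Z_single (a : Z -> R) j :
  (forall k, k <> j -> a k = 0) -> is_series (fold_Z a) (a j).
Proof.
move=> H; have [m Hm] := Z_fold_index j.
have E : fold_Z a m = a j.
  rewrite /fold_Z; case: Hm => Hm.
    by rewrite (H (- Z.of_nat m - 1)%Z) -?Hm; [ring | lia].
  by rewrite (H (Z.of_nat m)) -?Hm; [ring | lia].
rewrite -E; apply: is_series_single => n Hn.
by rewrite /fold_Z !H; [lra | lia | lia].
Qed.

Lemma in_ell2_unit j : in_ell2 (ell2_unit j).
Proof.
exists (Cmod (ell2_unit j j) ^ 2).
apply: (is_series_fold_Z_single (fun k => Cmod (ell2_unit j k) ^ 2)) => k Hk.
by rewrite /ell2_unit (proj2 (Z.eqb_neq _ _) Hk) Cmod_0; ring.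
Qed.

(** Built from unit vectors by recursion, so that a linear operator can be evaluated on it by
    induction. Adding m and -m-1 together follows [fold_Z]; the indices kept are [- n <= k < n]. *)
Fixpoint ell2_trunc (x : ell2_type) (n : nat) : ell2_type :=
  match n with
  | O => ell2_zero
  | S m => ell2_plus (ell2_trunc x m)
     (ell2_plus (ell2_scal (x (Z.of_nat m)) (ell2_unit (Z.of_nat m)))
        (ell2_scal (x (- Z.of_nat m - 1)%Z) (ell2_unit (- Z.of_nat m - 1)%Z)))
  end.

Lemma ell2_trunc_coord x n k :
  ell2_trunc x n k = if (Z.leb (- Z.of_nat n) k && Z.ltb k (Z.of_nat n))%bool then x k else RtoC 0.
Proof.
elim: n => [|n IH].
  rewrite /= /ell2_zero.
  by case: (Z.leb_spec 0 k) => H1; case: (Z.ltb_spec k 0) => H2 //=; lia.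
rewrite [ell2_trunc x (S n)]/= /ell2_plus IH /ell2_scal /ell2_unit.
case: (Z.eqb_spec k (Z.of_nat n)) => H1; case: (Z.eqb_spec k (- Z.of_nat n - 1)) => H2;
case: (Z.leb_spec (- Z.of_nat n) k) => H3; case: (Z.ltb_spec k (Z.of_nat n)) => H4;
case: (Z.leb_spec (- Z.of_nat (S n)) k) => H5; case: (Z.ltb_spec k (Z.of_nat (S n))) => H6;
rewrite /=; try lia; rewrite -?H1 -?H2; ring.
Qed.

Lemma in_ell2_trunc x n : in_ell2 (ell2_trunc x n).
Proof.
elim: n => [|n IH]; first exact: in_ell2_zero.
apply: in_ell2_plus => //; apply: in_ell2_plus; apply: in_ell2_scal; exact: in_ell2_unit.
Qed.

Lemma ell2_trunc_lim x : in_ell2 x -> ell2_lim eventually (ell2_trunc x) x.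
Proof.
move=> Hx; apply: (ell2_lim_dominated _ _ _ x 1 Hx).
  exists 0%nat => n _ k; rewrite ell2_trunc_coord Rmult_1_l.
  case: andb.
    have -> : (x k - x k)%C = RtoC 0 by ring.
    by rewrite Cmod_0; apply: Cmod_ge_0.
  have -> : (RtoC 0 - x k)%C = (- x k)%C by ring.
  by rewrite Cmod_opp; apply: Rle_refl.
move=> k eps Heps; exists (S (Z.to_nat (Z.abs k))) => n Hn.
rewrite ell2_trunc_coord.
case: (Z.leb_spec (- Z.of_nat n) k) => H1; last lia.
case: (Z.ltb_spec k (Z.of_nat n)) => H2; last lia.
have -> : (x k - x k)%C = RtoC 0 by ring.
by rewrite Cmod_0.
Qed.

Lemma bounded_operators_agree A B : bounded_operator A -> bounded_operator B ->
  (forall j, A (ell2_unit j) = B (ell2_unit j)) ->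
  forall x, in_ell2 x -> A x = B x.
Proof.
move=> HA HB Hu x Hx.
have [HA1 [HA2 [HA3 [K HK]]]] := HA; have [HB1 [HB2 [HB3 [L HL]]]] := HB.
have Ht n : A (ell2_trunc x n) = B (ell2_trunc x n).
  elim: n => [|n IH].
    (* The zero vector is written as a multiple by 0 so that homogeneity evaluates the operators on
       it. *)
    have E : ell2_trunc x 0 = ell2_scal (RtoC 0) ell2_zero by rewrite /=; ell2_ext; ring.
    rewrite E HA3 ?HB3; try exact: in_ell2_zero.
    by ell2_ext; ring.
  rewrite [ell2_trunc x (S n)]/=.
  set p := ell2_scal _ _; set q := ell2_scal _ _.
  have Hp : in_ell2 p by apply: in_ell2_scal; apply: in_ell2_unit.
  have Hq : in_ell2 q by apply: in_ell2_scal; apply: in_ell2_unit.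
  have Hpq := in_ell2_plus _ _ Hp Hq.
  have Htr := in_ell2_trunc x n.
  rewrite HA2 // HB2 // IH HA2 // HB2 // /p /q.
  by rewrite !HA3 ?HB3 ?Hu //; apply: in_ell2_unit.
have Hd n : in_ell2 (ell2_minus (ell2_trunc x n) x).
  by apply: in_ell2_minus => //; apply: in_ell2_trunc.
have HAB : in_ell2 (ell2_minus (A x) (B x)) by apply: in_ell2_minus; [apply: HA1|apply: HB1].
have Hle n : ell2_norm (ell2_minus (A x) (B x)) <= (K + L) * ell2_norm (ell2_minus (ell2_trunc x n) x).
  (* As [A] and [B] agree on the truncation, their difference at [x] involves only the truncation
     error. *)
  have -> : ell2_minus (A x) (B x) = ell2_minus (B (ell2_minus (ell2_trunc x n) x)) (A (ell2_minus (ell2_trunc x n) x)).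
    rewrite (bounded_operator_minus A) // ?(bounded_operator_minus B) //; try exact: in_ell2_trunc.
    by rewrite Ht; ell2_ext; ring.
  apply: Rle_trans (ell2_norm_minus_le _ _ (HB1 _ (Hd n)) (HA1 _ (Hd n))) _.
  have := HK _ (Hd n); have := HL _ (Hd n); lra.
have H0 : ell2_norm (ell2_minus (A x) (B x)) <= 0.
  apply: le_epsilon => eps Heps; rewrite Rplus_0_l.
  have HKL : 0 < Rabs (K + L) + 1 by have := Rabs_pos (K + L); lra.
  have Hq : 0 < eps / (Rabs (K + L) + 1) by apply: Rdiv_lt_0_compat.
  have [N HN] := ell2_trunc_lim x Hx (mkposreal _ Hq).
  have [_ H1] := HN N (le_n N); rewrite /= in H1.
  apply: Rle_trans (Hle N) _.
  have H2 := ell2_norm_ge0 (ell2_minus (ell2_trunc x N) x).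
  apply: Rle_trans (_ : (Rabs (K + L) + 1) * ell2_norm (ell2_minus (ell2_trunc x N) x) <= _).
    by apply: Rmult_le_compat_r => //; have := Rle_abs (K + L); lra.
  have -> : eps = (Rabs (K + L) + 1) * (eps / (Rabs (K + L) + 1)) by field; lra.
  by apply: Rmult_le_compat_l; lra.
have Hz := ell2_norm_eq0 _ HAB H0.
apply: functional_extensionality => k; have := Hz k; rewrite /ell2_minus => H.
have -> : A x k = (A x k - B x k + B x k)%C by ring.
by rewrite H; ring.
Qed.

Lemma diag_exp_semigroup_unique lam E t x : (forall k, 0 <= lam k) ->
  is_exp_semigroup (diag_graph lam) E -> 0 <= t -> in_ell2 x -> E t x = diag_semigroup lam t x.
Proof.
move=> Hlam HE Ht Hx.
apply: bounded_operators_agree Hx.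
- exact: (proj1 HE).
- by apply: diag_op_bounded => k; apply: diag_semigroup_coef.
move=> j.
rewrite (exp_semigroup_eigenvector (diag_graph lam) E (ell2_unit j) (lam j) t) //.
- rewrite /diag_semigroup /diag_op; ell2_ext; rewrite /ell2_unit.
  by case: Z.eqb_spec => [->|_]; ring.
- exact: in_ell2_unit.
- split; first exact: in_ell2_unit.
  split; first by apply: in_ell2_scal; apply: in_ell2_unit.
  move=> k; rewrite /ell2_scal /ell2_unit.
  by case: Z.eqb_spec => [->|_]; ring.
Qed.

(** * Traces of diagonal operators *)

Lemma Cconj_mult_self (z : C) : (Cconj z * z)%C = RtoC (Cmod z ^ 2).
Proof. by rewrite -Cmod_conj Cmod2_conj -Cmod2_conj Cmod_conj Cmod2_conj; ring. Qed.

Lemma ell2_inner_unit x j : ell2_inner x (ell2_unit j) = Cconj (x j).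
Proof.
have E : forall p : C -> R, p (RtoC 0) = 0 ->
    Series (fold_Z (fun k => p (Cconj (x k) * ell2_unit j k)%C)) = p (Cconj (x j)).
  move=> p Hp; apply: is_series_unique.
  have -> : p (Cconj (x j)) = p (Cconj (x j) * ell2_unit j j)%C.
    by rewrite /ell2_unit Z.eqb_refl Cmult_1_r.
  apply: (is_series_fold_Z_single (fun k => p (Cconj (x k) * ell2_unit j k)%C)) => k Hk.
  by rewrite /ell2_unit (proj2 (Z.eqb_neq _ _) Hk) Cmult_0_r.
by rewrite /ell2_inner (E Re) // (E Im) //; case: (Cconj (x j)).
Qed.

Lemma ell2_inner_diag x d : ell2_inner x (diag_op d x) =
  RtoC (Series (fold_Z (fun k => d k * Cmod (x k) ^ 2))).
Proof.
have E k : (Cconj (x k) * diag_op d x k)%C = RtoC (d k * Cmod (x k) ^ 2).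
  rewrite RtoC_mult -Cconj_mult_self /diag_op; ring.
rewrite /ell2_inner /RtoC; congr pair; first by apply: Series_ext => n; rewrite /fold_Z !E.
(* All imaginary parts vanish. With 0 written as [0 * Series _], both sides are series and can be
   compared term by term. *)
have -> : 0 = 0 * Series (fun _ => 0) by ring.
rewrite -Series_scal_l; apply: Series_ext => n.
by rewrite /fold_Z !E /=; ring.
Qed.

(* The partial sum of the Fourier expansion of the k-th unit vector has k-th coordinate sum_n |b_n k|^2. *)
Lemma orthonormal_basis_coord b k : orthonormal_basis b ->
  is_series (fun n => Cmod (b n k) ^ 2) 1.
Proof.
move=> [Hb1 [_ Hb3]].
have Hlim := Hb3 (ell2_unit k) (in_ell2_unit k).
(* [ell2_sum] at [S N] and [sum_n] at [N] both have the terms 0 to N. *)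
have E N : ell2_sum (fun n => ell2_scal (ell2_inner (b n) (ell2_unit k)) (b n)) (S N) k =
    RtoC (sum_n (fun n => Cmod (b n k) ^ 2) N).
  have Et n : ell2_scal (ell2_inner (b n) (ell2_unit k)) (b n) k = RtoC (Cmod (b n k) ^ 2).
    by rewrite /ell2_scal ell2_inner_unit Cconj_mult_self.
  elim: N => [|N IH].
    by rewrite sum_O -Et /= /ell2_plus /ell2_zero Cplus_0_l.
  by rewrite sum_Sn /plus /= RtoC_plus -IH -Et.
apply/(is_lim_seq_spec (sum_n (fun n => Cmod (b n k) ^ 2)) 1) => eps.
have [N HN] : eventually (fun n => Cmod (ell2_sum (fun n => ell2_scal (ell2_inner (b n) (ell2_unit k)) (b n)) n k
   - ell2_unit k k)%C < eps) by apply: ell2_lim_coord Hlim.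
exists N => n Hn; have := HN (S n) ltac:(lia).
by rewrite E {1}/ell2_unit Z.eqb_refl -RtoC_minus Cmod_R.
Qed.

Lemma is_series_RtoC (a : nat -> R) l :
  is_series a l -> is_series (V := C_R_NormedModule) (fun n => RtoC (a n)) (RtoC l).
Proof.
move=> H.
have E N : sum_n (G := C_R_NormedModule) (fun n => RtoC (a n)) N = RtoC (sum_n a N).
  elim: N => [|N IH]; first by rewrite !sum_O.
  rewrite !sum_Sn IH; apply: injective_projections => //.
  by rewrite /= /plus /=; apply: Rplus_0_l.
apply: (filterlim_ext (fun N => RtoC (sum_n a N))) => [N|]; first by rewrite E.
apply/filterlim_locally => eps.
have /filterlim_locally Hl := H.
apply: filter_imp (Hl eps) => N HN.
by split=> //=; apply: ball_center.
Qed.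

Lemma sum_Series_fold_Z (f : nat -> Z -> R) N :
  (forall n, ex_series (fold_Z (f n))) ->
  is_series (fold_Z (fun k => sum_n (fun n => f n k) N)) (sum_n (fun n => Series (fold_Z (f n))) N).
Proof.
move=> Hf; elim: N => [|N IH].
  rewrite sum_O; apply: is_series_ext (Series_correct _ (Hf 0%nat)) => m.
  by rewrite /fold_Z !sum_O.
rewrite sum_Sn; apply: is_series_ext (is_series_plus _ _ _ _ IH (Series_correct _ (Hf (S N)))) => m.
by rewrite /fold_Z !sum_Sn /plus /=; ring.
Qed.

Lemma diag_is_trace (d : Z -> R) B w :
  (forall k, 0 <= d k <= 1) -> is_series (fold_Z d) w ->
  bounded_operator B -> (forall x, in_ell2 x -> B x = diag_op d x) ->
  is_trace B (RtoC w).
Proof.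
move=> Hd Hw HB HBd; split=> // b Hb.
have [Hb1 _] := Hb.
pose p n k := Cmod (b n k) ^ 2.
have Hp n k : 0 <= p n k by apply: Cmod_sq_ge0.
have Hp1 k := orthonormal_basis_coord b k Hb.
pose c n := Series (fold_Z (fun k => d k * p n k)).
have Hc n : ell2_inner (b n) (B (b n)) = RtoC (c n) by rewrite HBd // ell2_inner_diag.
have Hex n : ex_series (fold_Z (fun k => d k * p n k)).
  apply: ex_series_fold_Z_le (Hb1 n) => k; have := Hd k; have := Hp n k; rewrite /p; nra.
have Hc0 n : 0 <= c n.
  apply: Series_nonneg => // m; apply: fold_Z_nonneg => k.
  by apply: Rmult_le_pos; [case: (Hd k) | ].
have Hs : is_series c w.
  pose r N k := d k * (1 - sum_n (fun n => p n k) N).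
  have Hr N k : 0 <= r N k <= d k.
    have H1 : sum_n (fun n => p n k) N <= 1.
      rewrite -(is_series_unique _ _ (Hp1 k)).
      apply: (sum_n_nonneg_le_Series (fun n => p n k)); first by move=> n; apply: Hp.
      by exists 1; apply: Hp1.
    have H2 : 0 <= sum_n (fun n => p n k) N.
      elim: (N) => [|m IH]; first by rewrite sum_O.
      by rewrite sum_Sn; apply: Rplus_le_le_0_compat.
    have := Hd k; rewrite /r; nra.
  have Hsum N : is_series (fold_Z (r N)) (w - sum_n c N).
    have H := sum_Series_fold_Z (fun n k => d k * p n k) N Hex.
    apply: is_series_ext (is_series_minus _ _ _ _ Hw H) => m.
    have Hk k : sum_n (fun n => d k * p n k) N = d k * sum_n (fun n => p n k) N.
      exact: (sum_n_mult_l (K := R_Ring) (d k) (fun n => p n k) N).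
    by rewrite /fold_Z !Hk /r /minus /plus /opp /=; ring.
  apply/(is_lim_seq_spec (sum_n c) w) => eps.
  have Hdc : eventually (fun N => ex_series (fold_Z (r N)) /\ Series (fold_Z (r N)) < eps).
    apply: (dominated_convergence_fold_Z eventually r d (ex_intro _ w Hw)) (cond_pos eps).
      by exists 0%nat => N _.
    move=> k e He.
    have Hl : is_lim_seq (sum_n (fun n => p n k)) 1 := Hp1 k.
    move: Hl; rewrite -is_lim_seq_spec => Hl.
    have [N HN] := Hl (mkposreal e He).
    exists N => n Hn; have := HN n Hn; rewrite /= => /Rabs_def2 H1.
    have := Hr n k; have := Hd k; rewrite /r; nra.
  apply: filter_imp Hdc => N [_ H2].
  rewrite (is_series_unique _ _ (Hsum N)) in H2.
  have H3 : 0 <= w - sum_n c N.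
    rewrite -(is_series_unique _ _ (Hsum N)).
    apply: Series_nonneg; last by exists (w - sum_n c N).
    by move=> m; apply: fold_Z_nonneg => k; case: (Hr N k).
  by rewrite Rabs_left1; lra.
split.
  exists w; apply: is_series_ext Hs => n.
  by rewrite Hc Cmod_R Rabs_pos_eq.
apply: (is_series_ext (fun n => RtoC (c n))) => [n|]; first by rewrite Hc.
exact: is_series_RtoC.
Qed.

(** Since 0 <= nu < 1, the sign of [k - nu] changes between 0 and 1. The indices k >= 1 and k <= -1
    give geometric series of ratio [exp (- a)] with first terms [exp (- (a * (1 - nu)))] and
    [exp (- (a * (1 + nu)))], and k = 0 is added separately. *)
Lemma is_series_exp_abs_shift nu a : 0 <= nu < 1 -> 0 < a ->
  is_series (fold_Z (fun k => exp (- (a * Rabs (IZR k - nu)))))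
    (cosh (a * (nu - 1 / 2)) / sinh (a / 2)).
Proof.
move=> Hnu Ha.
pose q := exp (- a).
have Hq0 : 0 < q := exp_pos _.
have Hq1 : q < 1 by rewrite -exp_0; apply: exp_increasing; lra.
have Hg : is_series (fun n => q ^ n) (/ (1 - q)) by apply: is_series_geom; rewrite Rabs_pos_eq; lra.
have Hqn n : q ^ n = exp (- (a * INR n)).
  elim: n => [|n IH]; first by rewrite /= Rmult_0_r Ropp_0 exp_0.
  by rewrite [q ^ S n]/= IH S_INR /q -exp_plus; congr exp; ring.
pose f n := exp (- (a * Rabs (IZR (Z.of_nat n) - nu))).
pose g n := exp (- (a * Rabs (IZR (- Z.of_nat n - 1) - nu))).
have HG c : is_series (fun n => c * q ^ n) (c * / (1 - q)) := is_series_scal_l c _ _ Hg.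
have Hgs : is_series g (exp (- (a * (1 + nu))) * / (1 - q)).
  apply: is_series_ext (HG _) => n.
  rewrite Hqn /g -exp_plus; congr exp.
  rewrite minus_IZR opp_IZR -INR_IZR_INZ Rabs_left; first ring.
  have := pos_INR n; lra.
have Hfs : is_series f (exp (- (a * nu)) + exp (- (a * (1 - nu))) * / (1 - q)).
  apply: is_series_decr_1.
  have -> : plus (exp (- (a * nu)) + exp (- (a * (1 - nu))) * / (1 - q)) (opp (f 0%nat)) =
      exp (- (a * (1 - nu))) * / (1 - q).
    rewrite /f /plus /opp /= Rabs_left1; last lra.
    have -> : - (a * - (0 - nu)) = - (a * nu) by ring.
    ring.
  apply: is_series_ext (HG _) => n.
  rewrite Hqn /f -exp_plus; congr exp.
  rewrite -INR_IZR_INZ S_INR Rabs_pos_eq; first ring.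
  have := pos_INR n; lra.
have -> : cosh (a * (nu - 1 / 2)) / sinh (a / 2) =
   (exp (- (a * nu)) + exp (- (a * (1 - nu))) * / (1 - q)) + exp (- (a * (1 + nu))) * / (1 - q).
  rewrite /cosh /sinh.
  (* In terms of [u] and [s] the identity is between rational functions; [s > 1] keeps the
     denominators away from 0. *)
  set u := exp (a * nu); set s := exp (a / 2).
  have Hu : 0 < u := exp_pos _.
  have Hs : 1 < s by rewrite -exp_0; apply: exp_increasing; lra.
  have -> : exp (a * (nu - 1 / 2)) = u / s.
    have -> : a * (nu - 1 / 2) = a * nu + - (a / 2) by field.
    by rewrite exp_plus exp_Ropp.
  have -> : exp (- (a * (nu - 1 / 2))) = s / u.
    have -> : - (a * (nu - 1 / 2)) = a / 2 + - (a * nu) by field.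
    by rewrite exp_plus exp_Ropp.
  have Eq : q = / s ^ 2.
    have -> : q = exp (- (a / 2)) * exp (- (a / 2)) by rewrite -exp_plus; congr exp; field.
    by rewrite exp_Ropp -/s; field; lra.
  have -> : exp (- (a / 2)) = / s by rewrite exp_Ropp.
  have -> : exp (- (a * nu)) = / u by rewrite exp_Ropp.
  have -> : exp (- (a * (1 - nu))) = u * q.
    by rewrite /u /q -exp_plus; congr exp; ring.
  have -> : exp (- (a * (1 + nu))) = / u * q.
    by rewrite /u /q -exp_Ropp -exp_plus; congr exp; ring.
  rewrite Eq; field.
  have Hs2 : s * s - 1 > 0 by nra.
  by repeat split; nra.
exact: (is_series_plus _ _ _ _ Hfs Hgs).
Qed.

(** * The radial equation *)

Lemma is_derive_zero_constant (f : R -> R) a b :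
  (forall r, a < r < b -> is_derive f r 0) -> forall x y, a < x < b -> a < y < b -> f x = f y.
Proof.
move=> Hf.
have H x y : a < x < b -> a < y < b -> x < y -> f x = f y.
  by move=> Hx Hy Hxy; apply: eq_is_derive => // t Ht; apply: Hf; lra.
move=> x y Hx Hy; case: (Rtotal_order x y) => [Hl|[->//|Hl]]; first exact: H.
by symmetry; apply: H => //; lra.
Qed.

(* With p = theta f', the quantities (p - mu f) e^(- mu s) and (p + mu f) e^(mu s) are constant;
   boundedness of f as s -> oo forces the first to vanish. *)
Lemma bounded_radial_solution (theta s f p : R -> R) mu :
  0 <= mu ->
  (forall r, 0 < r < 1 -> 0 < theta r) ->
  (forall r, 0 < r < 1 -> is_derive s r (- / theta r)) ->
  (forall A, exists d, 0 < d /\ forall r, 0 < r < d -> A < s r) ->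
  (forall r, 0 < r < 1 -> is_derive f r (p r / theta r)) ->
  (forall r, 0 < r < 1 -> is_derive p r (mu ^ 2 * f r / theta r)) ->
  (exists d K, 0 < d /\ forall r, 0 < r < 1 -> r < d -> Rabs (f r) <= K) ->
  forall r, 0 < r < 1 -> p r = mu * f r.
Proof.
move=> Hmu Hth Hs Hsinf Hf Hp [d [K [Hd HK]]].
have HC : forall r, 0 < r < 1 -> is_derive (fun r => (p r - mu * f r) * exp (- (mu * s r))) r 0.
  move=> r Hr; have H1 := Hs r Hr; have H2 := Hf r Hr; have H3 := Hp r Hr; have H4 := Hth r Hr.
  auto_derive.
    by repeat split; [eexists; exact: H3 | eexists; exact: H2 | eexists; exact: H1].
  rewrite (is_derive_unique _ _ _ H1) (is_derive_unique _ _ _ H2) (is_derive_unique _ _ _ H3).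
  by field; lra.
have Hh : 0 < / 2 < 1 by lra.
set C := (p (/ 2) - mu * f (/ 2)) * exp (- (mu * s (/ 2))).
have HCr r : 0 < r < 1 -> p r - mu * f r = C * exp (mu * s r).
  move=> Hr; rewrite /C -(is_derive_zero_constant _ 0 1 HC r (/ 2) Hr Hh) Rmult_assoc -exp_plus.
  by rewrite Rplus_opp_l exp_0 Rmult_1_r.
clearbody C.
(* Both cases are reduced to the boundedness of [Rabs C * s r] near 0, which contradicts s -> oo
   unless C = 0. For mu = 0 the function [f + C * s] is constant; for mu > 0 one has [C * exp (mu *
   s r) = D * exp (- (mu * s r)) - 2 * mu * f r], and [exp (mu * s r)] exceeds [mu * s r]. *)
have Hbound : exists B d', 0 < d' /\ forall r, 0 < r < 1 -> r < d' -> Rabs C * s r <= B.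
  case: (Req_dec mu 0) => Hmu0.
    have HD : forall r, 0 < r < 1 -> is_derive (fun r => f r + C * s r) r 0.
      move=> r Hr; have H1 := Hs r Hr; have H2 := Hf r Hr; have H4 := Hth r Hr.
      auto_derive; first by repeat split; [eexists; exact: H2 | eexists; exact: H1].
      rewrite (is_derive_unique _ _ _ H1) (is_derive_unique _ _ _ H2).
      have := HCr r Hr; rewrite Hmu0 !Rmult_0_l exp_0 Rminus_0_r Rmult_1_r => ->.
      by field; lra.
    exists (K + Rabs (f (/ 2) + C * s (/ 2))).
    have [d0 [Hd0 Hd1]] := Hsinf 0.
    exists (Rmin d d0); split; first exact: Rmin_pos.
    move=> r Hr Hrd.
    have Hr1 : r < d by apply: Rlt_le_trans Hrd (Rmin_l _ _).
    have Hr2 : r < d0 by apply: Rlt_le_trans Hrd (Rmin_r _ _).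
    have Hsr : 0 < s r by apply: Hd1; lra.
    rewrite -(Rabs_pos_eq (s r)); last lra.
    rewrite -Rabs_mult -(is_derive_zero_constant _ 0 1 HD r (/ 2) Hr Hh).
    have := HK r Hr Hr1.
    have -> : C * s r = (f r + C * s r) - f r by ring.
    have -> : f r + (f r + C * s r - f r) = f r + C * s r by ring.
    have := Rabs_triang (f r + C * s r) (- f r); rewrite Rabs_Ropp.
    by rewrite /Rminus; lra.
  have Hmupos : 0 < mu by lra.
  have HD : forall r, 0 < r < 1 -> is_derive (fun r => (p r + mu * f r) * exp (mu * s r)) r 0.
    move=> r Hr; have H1 := Hs r Hr; have H2 := Hf r Hr; have H3 := Hp r Hr; have H4 := Hth r Hr.
    auto_derive.
      by repeat split; [eexists; exact: H3 | eexists; exact: H2 | eexists; exact: H1].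
    rewrite (is_derive_unique _ _ _ H1) (is_derive_unique _ _ _ H2) (is_derive_unique _ _ _ H3).
    by field; lra.
  set D := (p (/ 2) + mu * f (/ 2)) * exp (mu * s (/ 2)).
  have HDr r : 0 < r < 1 -> p r + mu * f r = D * exp (- (mu * s r)).
    move=> Hr; rewrite /D -(is_derive_zero_constant _ 0 1 HD r (/ 2) Hr Hh) Rmult_assoc -exp_plus.
    by rewrite Rplus_opp_r exp_0 Rmult_1_r.
  clearbody D.
  exists ((Rabs D + 2 * mu * K) / mu).
  have [d0 [Hd0 Hd1]] := Hsinf 0.
  exists (Rmin d d0); split; first exact: Rmin_pos.
  move=> r Hr Hrd.
  have Hr1 : r < d by apply: Rlt_le_trans Hrd (Rmin_l _ _).
  have Hr2 : r < d0 by apply: Rlt_le_trans Hrd (Rmin_r _ _).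
  have Hsr : 0 < s r by apply: Hd1; lra.
  have Hms : 0 <= mu * s r by apply: Rmult_le_pos; lra.
  have E : C * exp (mu * s r) = D * exp (- (mu * s r)) - 2 * mu * f r.
    rewrite -(HCr r Hr) -(HDr r Hr); ring.
  have H1 : Rabs (C * exp (mu * s r)) <= Rabs D + 2 * mu * K.
    rewrite E.
    have T1 := Rabs_triang (D * exp (- (mu * s r))) (- (2 * mu * f r)).
    rewrite Rabs_Ropp !Rabs_mult (Rabs_pos_eq (exp _)) in T1; last exact: Rlt_le (exp_pos _).
    rewrite (Rabs_pos_eq 2) in T1; last lra.
    rewrite (Rabs_pos_eq mu) in T1; last lra.
    have [[_ T2] _] := exp_neg_bounds _ Hms.
    have T3 := HK r Hr Hr1; have T4 := Rabs_pos D.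
    have T5 : Rabs D * exp (- (mu * s r)) <= Rabs D * 1 by apply: Rmult_le_compat_l.
    have T6 : 2 * mu * Rabs (f r) <= 2 * mu * K by apply: Rmult_le_compat_l; lra.
    rewrite /Rminus; lra.
  rewrite Rabs_mult (Rabs_pos_eq (exp _)) in H1; last exact: Rlt_le (exp_pos _).
  have H2 := exp_ineq1_le (mu * s r); have H3 := Rabs_pos C.
  apply: (Rmult_le_reg_r mu) => //.
  have -> : (Rabs D + 2 * mu * K) / mu * mu = Rabs D + 2 * mu * K by field; lra.
  nra.
have HC0 : C = 0.
  apply: NNPP => HCne; have HCpos := Rabs_pos_lt C HCne.
  have [B [d' [Hd' HB]]] := Hbound.
  have [d0 [Hd0 Hd1]] := Hsinf (B / Rabs C).
  pose m := Rmin (Rmin d' d0) 1.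
  have Hm : 0 < m by apply: Rmin_pos; [apply: Rmin_pos|lra].
  have Hm1 : m <= 1 := Rmin_r _ _.
  have Hm2 : m <= d' by apply: Rle_trans (Rmin_l _ _) (Rmin_l _ _).
  have Hm3 : m <= d0 by apply: Rle_trans (Rmin_l _ _) (Rmin_r _ _).
  have H1 := HB (m / 2) ltac:(lra) ltac:(lra).
  have H2 := Hd1 (m / 2) ltac:(lra).
  have : Rabs C * (B / Rabs C) < Rabs C * s (m / 2) by apply: Rmult_lt_compat_l.
  have -> : Rabs C * (B / Rabs C) = B by field; lra.
  lra.
move=> r Hr; have := HCr r Hr; rewrite HC0 Rmult_0_l; lra.
Qed.

Section RadialVariable.
Variable theta : R -> R.
Hypothesis theta_smooth : smooth_on_unit_interval theta.
Hypothesis theta_pos : forall r, 0 < r <= 1 -> 0 < theta r.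
Hypothesis theta_0 : theta 0 = 0.
Hypothesis theta'_0 : right_derivative_at_0 theta 1.

Lemma locally_open_interval (a b r : R) (P : R -> Prop) :
  a < r < b -> (forall x, a < x < b -> P x) -> locally r P.
Proof.
move=> Hr HP; have Hd : 0 < Rmin (r - a) (b - r) by apply: Rmin_pos; lra.
exists (mkposreal _ Hd) => x.
rewrite /ball /= /AbsRing_ball /= /abs /minus /plus /opp /= => /Rabs_def2 Hx.
have := Rmin_l (r - a) (b - r); have := Rmin_r (r - a) (b - r) => H1 H2.
by apply: HP; lra.
Qed.

(** Near a point of the open interval [theta] coincides with its smooth extension; at the endpoints
    it need not, its values outside [0,1] being arbitrary. *)
Lemma theta_derive r : 0 < r < 1 ->
  is_derive theta r (Derive theta r) /\ continuous (Derive theta) r.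
Proof.
move=> Hr; have [g [Hg1 Hg2]] := theta_smooth.
have Hloc x : 0 < x < 1 -> locally x (fun y => g y = theta y).
  by move=> Hx; apply: (locally_open_interval 0 1) => // y Hy; rewrite Hg2 //; lra.
have Hd x : 0 < x < 1 -> is_derive theta x (Derive g x).
  move=> Hx; apply: (is_derive_ext_loc g) => //; first exact: Hloc.
  by apply: Derive_correct; apply: (Hg1 1%nat).
have HE x : 0 < x < 1 -> Derive theta x = Derive g x.
  by move=> Hx; apply: is_derive_unique; apply: Hd.
split; first by rewrite HE //; apply: Hd.
apply: (continuous_ext_loc _ (Derive g)).
  by apply: (locally_open_interval 0 1) => // y Hy; rewrite HE.
apply: (ex_derive_continuous (V := R_NormedModule)); exact: (Hg1 2%nat).
Qed.

Lemma theta_lim_1 eps : 0 < eps -> at_left 1 (fun r => Rabs (theta r - theta 1) < eps).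
Proof.
move=> Heps; have [g [Hg1 Hg2]] := theta_smooth.
have Hc : continuous g 1.
  by apply: (ex_derive_continuous (V := R_NormedModule)); apply: (Hg1 1%nat).
have /filterlim_locally Hl := Hc.
have [d Hd] := Hl (mkposreal _ Heps).
apply/at_left_iff; exists (Rmin d 1); split; first by apply: Rmin_pos; [apply: cond_pos|lra].
move=> r [Hr1 Hr2]; have H1 := Rmin_l d 1; have H2 := Rmin_r d 1.
rewrite !Hg2; try lra.
apply: (Hd r); rewrite /ball /= /AbsRing_ball /= /abs /minus /plus /opp /=.
by apply: Rabs_def1; lra.
Qed.

(* s r is the theta^(-1)-length of [r, 1], so that the radial modes are exp (- |k - nu| s). *)
Lemma radial_variable_exists : exists s : R -> R,
  (forall r, 0 < r < 1 -> is_derive s r (- / theta r)) /\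
  (forall r, 0 < r < 1 -> 0 < s r) /\
  (forall A, exists d, 0 < d /\ forall r, 0 < r < d -> A < s r) /\
  (forall eps, 0 < eps -> at_left 1 (fun r => s r < eps)).
Proof.
have [g [Hg1 Hg2]] := theta_smooth.
have Hgc x : continuous g x.
  by apply: (ex_derive_continuous (V := R_NormedModule)); apply: (Hg1 1%nat).
(* Positivity of the extension [g] slightly beyond 1 makes [s] differentiable at 1 itself, hence
   continuous there with value 0. *)
have [e [He Hge]] : exists e, 0 < e /\ forall x, 0 < x < 1 + e -> 0 < g x.
  have Hg1pos : 0 < g 1 by rewrite -Hg2; [apply: theta_pos|]; lra.
  have /filterlim_locally Hl := Hgc 1.
  have [d Hd] := Hl (mkposreal _ Hg1pos).
  exists d; split; first exact: cond_pos.
  move=> x Hx; case: (Rle_lt_dec x 1) => Hx1; first by rewrite -Hg2; [apply: theta_pos|]; lra.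
  have : ball (g 1) (g 1) (g x).
    apply: (Hd x); rewrite /ball /= /AbsRing_ball /= /abs /minus /plus /opp /=.
    by apply: Rabs_def1; lra.
  by rewrite /ball /= /AbsRing_ball /= /abs /minus /plus /opp /= => /Rabs_def2; lra.
have Hic x : 0 < x < 1 + e -> continuous (fun x => / g x) x.
  move=> Hx; apply: (continuous_comp g Rinv) => //.
  by apply: continuous_Rinv; have := Hge x Hx; lra.
have Hex r : 0 < r < 1 + e -> ex_RInt (fun x => / g x) r 1.
  move=> Hr; apply: (ex_RInt_continuous (V := R_CompleteNormedModule)) => z Hz; apply: Hic.
  have := Rmin_l r 1; have := Rmax_l r 1; split.
    by apply: Rlt_le_trans (proj1 Hz); apply: Rmin_glb_lt; lra.
  by apply: Rle_lt_trans (proj2 Hz) _; apply: Rmax_lub_lt; lra.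
pose s r := RInt (fun x => / g x) r 1.
have Hs r : 0 < r < 1 + e -> is_derive s r (- / g r).
  move=> Hr; apply: (is_derive_RInt' (fun x => / g x) s r 1); last exact: Hic.
  apply: (locally_open_interval 0 (1 + e)) => // x Hx.
  by apply: RInt_correct; apply: Hex.
have Hs' r : 0 < r < 1 -> is_derive s r (- / theta r).
  by move=> Hr; rewrite Hg2; [apply: Hs|]; lra.
exists s; split=> //; split; last split.
- move=> r Hr; apply: RInt_gt_0; first lra.
    by move=> x Hx; apply: Rinv_0_lt_compat; apply: Hge; lra.
  by move=> x Hx; apply: Hic; lra.
- move=> A.
  have /filterlim_locally Hl := theta'_0.
  have /at_right_iff [d [Hd Hd2]] := Hl (mkposreal 1 Rlt_0_1).
  have Hth r : 0 < r < d -> theta r < 2 * r.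
    move=> Hr; have := Hd2 r ltac:(lra).
    rewrite /ball /= /AbsRing_ball /= /abs /minus /plus /opp /= theta_0 Rminus_0_r => /Rabs_def2 [H _].
    have -> : theta r = theta r / r * r by field; lra.
    by apply: Rmult_lt_compat_r; lra.
  pose m := Rmin d 1 / 2.
  have Hm : 0 < m by rewrite /m; have := Rmin_pos d 1 Hd Rlt_0_1; lra.
  have Hmd : m < d by rewrite /m; have := Rmin_l d 1; have := Rmin_pos d 1 Hd Rlt_0_1; lra.
  have Hm1 : m < 1 by rewrite /m; have := Rmin_r d 1; lra.
  (* Because theta(r) < 2 r near 0, the derivative [- / theta x + / 2 * / x] is negative, and [s]
     grows at least like [- / 2 * ln r]. *)
  have Hdec r : 0 < r < m -> s m + / 2 * ln m <= s r + / 2 * ln r.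
    move=> Hr.
    have Hder x : 0 < x < 1 -> is_derive (fun x => s x + / 2 * ln x) x (- / theta x + / 2 * / x).
      move=> Hx; apply: (is_derive_plus (V := R_NormedModule)); first exact: Hs'.
      apply: (is_derive_scal ln x (/ 2) (/ x)).
      by apply: is_derive_ln; lra.
    have [c [Hc1 Hc2]] := MVT_gen (fun x => s x + / 2 * ln x) r m (fun x => - / theta x + / 2 * / x) 
      ltac:(rewrite Rmin_left ?Rmax_right; try lra; move=> x Hx; apply: Hder; lra)
      ltac:(rewrite Rmin_left ?Rmax_right; try lra; move=> x Hx; apply/continuity_pt_filterlim;
        apply: (ex_derive_continuous (V := R_NormedModule)); eexists; apply: Hder; lra).
    rewrite Rmin_left ?Rmax_right in Hc1; try lra.
    have H1 : 0 < theta c by apply: theta_pos; lra.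
    have H2 := Hth c ltac:(lra).
    have H3 : / 2 * / c <= / theta c.
      rewrite -Rinv_mult; apply: Rinv_le_contravar; lra.
    have : (- / theta c + / 2 * / c) * (m - r) <= 0 by nra.
    lra.
  pose B := A - (s m + / 2 * ln m).
  (* For [r < exp (- 2 * B)] the term [- / 2 * ln r] exceeds [B], the amount by which [A] exceeds
     the value at [m]. *)
  exists (Rmin m (exp (- 2 * B))); split; first by apply: Rmin_pos => //; apply: exp_pos.
  move=> r [Hr0 Hr1].
  have Hrm : r < m by apply: Rlt_le_trans Hr1 (Rmin_l _ _).
  have Hre : r < exp (- 2 * B) by apply: Rlt_le_trans Hr1 (Rmin_r _ _).
  have := ln_increasing _ _ Hr0 Hre; rewrite ln_exp.
  have := Hdec r ltac:(lra); rewrite /B; lra.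
- move=> eps Heps.
  have Hc : continuous s 1.
    by apply: (ex_derive_continuous (V := R_NormedModule)); eexists; apply: Hs; lra.
  have Hs1 : s 1 = 0 by rewrite /s RInt_point.
  have /filterlim_locally Hl := Hc.
  have [d Hd] := Hl (mkposreal _ Heps).
  apply/at_left_iff; exists d; split; first exact: cond_pos.
  move=> r Hr; have : ball (s 1) eps (s r).
    apply: (Hd r); rewrite /ball /= /AbsRing_ball /= /abs /minus /plus /opp /=.
    by apply: Rabs_def1; lra.
  by rewrite Hs1 /ball /= /AbsRing_ball /= /abs /minus /plus /opp /= => /Rabs_def2; lra.
Qed.

End RadialVariable.

(** * Complex-valued functions and termwise differentiation *)

Lemma is_derive_C_of_components (f : R -> C) x a b :
  is_derive (fun t => Re (f t)) x a -> is_derive (fun t => Im (f t)) x b ->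
  is_derive (V := C_R_NormedModule) f x ((a, b) : C).
Proof.
move=> Ha Hb.
have H1 := is_derive_scal_l (K := R_AbsRing) (V := C_R_NormedModule) _ _ _ ((1, 0) : C) Ha.
have H2 := is_derive_scal_l (K := R_AbsRing) (V := C_R_NormedModule) _ _ _ ((0, 1) : C) Hb.
have H := is_derive_plus _ _ _ _ _ H1 H2.
have E z w : plus (scal z ((1, 0) : C_R_NormedModule)) (scal w ((0, 1) : C_R_NormedModule)) = (z, w) :> C.
  by apply: injective_projections; rewrite /= /plus /scal /= /mult /=; ring.
rewrite E in H; apply: is_derive_ext H => t.
by rewrite E; case: (f t).
Qed.

Lemma ex_derive_C_iff (f : R -> C) x :
  ex_derive (V := C_R_NormedModule) f x <->
  ex_derive (fun t => Re (f t)) x /\ ex_derive (fun t => Im (f t)) x.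
Proof.
split; last first.
  by move=> [[a Ha] [b Hb]]; exists ((a, b) : C); apply: is_derive_C_of_components.
move=> [l Hl]; split.
- exists (Re l).
  apply: filterdiff_ext_lin.
    apply: (filterdiff_comp' (V := C_R_NormedModule) f fst x _ fst Hl).
    by apply: filterdiff_linear; apply: is_linear_fst.
  by move=> y.
- exists (Im l).
  apply: filterdiff_ext_lin.
    apply: (filterdiff_comp' (V := C_R_NormedModule) f snd x _ snd Hl).
    by apply: filterdiff_linear; apply: is_linear_snd.
  by move=> y.
Qed.

Lemma continuous_C_iff {U : UniformSpace} (f : U -> C) x :
  continuous f x <-> continuous (fun t => Re (f t)) x /\ continuous (fun t => Im (f t)) x.
Proof.
split.
  move=> H; split.
    by apply: (continuous_comp f (fst : C -> R)) => //; case: (f x) => a b; apply: continuous_fst.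
  by apply: (continuous_comp f (snd : C -> R)) => //; case: (f x) => a b; apply: continuous_snd.
move=> [/filterlim_locally H1 /filterlim_locally H2].
apply/filterlim_locally => eps.
by apply: filter_imp (filter_and _ _ (H1 eps) (H2 eps)) => y [Ha Hb].
Qed.

Lemma RInt_C_components (f : R -> C) a b :
  ex_RInt (fun t => Re (f t)) a b -> ex_RInt (fun t => Im (f t)) a b ->
  RInt (V := C_R_CompleteNormedModule) f a b =
  ((RInt (fun t => Re (f t)) a b, RInt (fun t => Im (f t)) a b) : C).
Proof.
move=> H1 H2; apply: (is_RInt_unique (V := C_R_CompleteNormedModule)).
exact: (is_RInt_fct_extend_pair (U := R_NormedModule) (V := R_NormedModule) f a b _ _
  (RInt_correct _ _ _ H1) (RInt_correct _ _ _ H2)).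
Qed.

(** A summable bound on second derivatives makes the Taylor remainders summable: two uses of the
    mean value theorem give [M k * (y - x) ^ 2] for each term, and the sum of these is o(y - x). *)
Lemma is_derive_Series_fold_Z (f f' f'' : Z -> R -> R) (M : Z -> R) a b x :
  a < x < b ->
  (forall k y, a < y < b -> is_derive (f k) y (f' k y)) ->
  (forall k y, a < y < b -> is_derive (f' k) y (f'' k y)) ->
  (forall k y, a < y < b -> Rabs (f'' k y) <= M k) ->
  ex_series (fold_Z M) ->
  (forall y, a < y < b -> ex_series (fold_Z (fun k => f k y))) ->
  (forall y, a < y < b -> ex_series (fold_Z (fun k => f' k y))) ->
  is_derive (fun y => Series (fold_Z (fun k => f k y))) x (Series (fold_Z (fun k => f' k x))).
Proof.
move=> Hx Hf Hf' HM HMs Hs Hs'.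
have MV (g g' : R -> R) y : (forall z, a < z < b -> is_derive g z (g' z)) -> a < y < b ->
    exists c, g y - g x = g' c * (y - x) /\ a < c < b /\ Rabs (c - x) <= Rabs (y - x).
  move=> Hg Hy.
  have Hmin : a < Rmin x y by apply: Rmin_glb_lt; lra.
  have Hmax : Rmax x y < b by apply: Rmax_lub_lt; lra.
  have [c [Hc1 Hc2]] := MVT_gen g x y g' ltac:(move=> z Hz; apply: Hg; lra)
     ltac:(move=> z Hz; apply/continuity_pt_filterlim;
        apply: (ex_derive_continuous (V := R_NormedModule)); eexists; apply: Hg; lra).
  exists c; split=> //; split; first lra.
  by move: Hc1; rewrite /Rmin /Rmax; case: Rle_dec => H Hc; [rewrite !Rabs_pos_eq | rewrite !Rabs_left1]; lra.
have HT k y : a < y < b -> Rabs (f k y - f k x - (y - x) * f' k x) <= M k * (y - x) ^ 2.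
  move=> Hy; have [c [Hc1 [Hc2 Hc3]]] := MV _ _ y (Hf k) Hy.
  have [e [He1 [He2 _]]] := MV _ _ c (Hf' k) Hc2.
  have -> : f k y - f k x - (y - x) * f' k x = (f' k c - f' k x) * (y - x) by rewrite Hc1; ring.
  rewrite He1 !Rabs_mult -(pow2_abs (y - x)).
  have := HM k e He2; have := Rabs_pos (f'' k e); have := Rabs_pos (c - x).
  have := Rabs_pos (y - x) => P1 P2 P3 P4.
  have P5 : Rabs (f'' k e) * Rabs (c - x) <= M k * Rabs (y - x) by apply: Rmult_le_compat.
  rewrite /= Rmult_1_r -Rmult_assoc; exact: Rmult_le_compat_r.
have HMk k : 0 <= M k by apply: Rle_trans (Rabs_pos _) (HM k x Hx).
pose F y := Series (fold_Z (fun k => f k y)); pose F' := Series (fold_Z (fun k => f' k x)).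
pose S := Series (fold_Z M).
have HS : 0 <= S by apply: Series_nonneg => // n; apply: fold_Z_nonneg.
have HF y : a < y < b -> Rabs (F y - F x - (y - x) * F') <= S * (y - x) ^ 2.
  move=> Hy; rewrite /F /F' -Series_scal_l -Series_minus; [|exact: Hs|exact: Hs].
  have Hsc : ex_series (fun n => (y - x) * fold_Z (fun k => f' k x) n).
    by apply: (ex_series_scal (V := R_NormedModule)); apply: Hs'.
  have Hmi : ex_series (fun n => fold_Z (fun k => f k y) n - fold_Z (fun k => f k x) n).
    by apply: (ex_series_minus (V := R_NormedModule)); apply: Hs.
  rewrite -Series_minus // [S * _]Rmult_comm /S -Series_scal_l.
  have Hb n : Rabs (fold_Z (fun k => f k y) n - fold_Z (fun k => f k x) n -
     (y - x) * fold_Z (fun k => f' k x) n) <= (y - x) ^ 2 * fold_Z M n.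
    rewrite /fold_Z; set k1 := Z.of_nat n; set k2 := (- k1 - 1)%Z.
    have := HT k1 y Hy; have := HT k2 y Hy => T1 T2.
    have -> : f k1 y + f k2 y - (f k1 x + f k2 x) - (y - x) * (f' k1 x + f' k2 x) =
      (f k1 y - f k1 x - (y - x) * f' k1 x) + (f k2 y - f k2 x - (y - x) * f' k2 x) by ring.
    apply: Rle_trans (Rabs_triang _ _) _; lra.
  have Hsm : ex_series (fun n => (y - x) ^ 2 * fold_Z M n).
    exact: (ex_series_scal (V := R_NormedModule) ((y - x) ^ 2)).
  apply: Rle_trans (Series_Rabs _ _) _.
    by apply: ex_series_le_nonneg Hsm => n; split; [exact: Rabs_pos | exact: Hb].
  by apply: Series_le => // n; split; [exact: Rabs_pos | exact: Hb].
split; first exact: is_linear_scal_l.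
move=> z Hz; have <- : x = z := is_filter_lim_locally_unique x z Hz.
move=> eps; have HS1 : 0 < S + 1 by lra.
have Hd : 0 < Rmin (Rmin (x - a) (b - x)) (eps / (S + 1)).
  apply: Rmin_pos; first by apply: Rmin_pos; lra.
  by apply: Rdiv_lt_0_compat => //; apply: cond_pos.
exists (mkposreal _ Hd) => y.
rewrite /ball /= /AbsRing_ball /= /abs /minus /plus /opp /= => Hb.
have B1 : Rabs (y - x) < Rmin (x - a) (b - x) by apply: Rlt_le_trans Hb (Rmin_l _ _).
have B2 : Rabs (y - x) < eps / (S + 1) by apply: Rlt_le_trans Hb (Rmin_r _ _).
have B3 : Rabs (y - x) < x - a by apply: Rlt_le_trans B1 (Rmin_l _ _).
have B4 : Rabs (y - x) < b - x by apply: Rlt_le_trans B1 (Rmin_r _ _).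
move/Rabs_def2: B3 => B3; move/Rabs_def2: B4 => B4.
change (Rabs (F y - F x - (y - x) * F') <= eps * Rabs (y - x)).
have := HF y ltac:(lra); rewrite -(pow2_abs (y - x)) => H.
apply: Rle_trans H _.
have P1 := Rabs_pos (y - x).
have -> : S * Rabs (y - x) ^ 2 = (S * Rabs (y - x)) * Rabs (y - x) by ring.
apply: Rmult_le_compat_r => //.
apply: Rle_trans (_ : (S + 1) * (eps / (S + 1)) <= _); last by apply: Req_le; field; lra.
by apply: Rmult_le_compat; lra.
Qed.

(** * Exponentially damped trigonometric series *)

(** This class contains the coefficients of every boundary datum and is stable under the factors of
    linear growth produced by differentiation, while any damping [exp (- c |k|)] with c > 0 makes it
    summable. *)
Definition subexponential (a : Z -> R) : Prop :=
  forall eps, 0 < eps -> exists K, forall k, Rabs (a k) <= K * exp (eps * Rabs (IZR k)).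

Lemma subexponential_bounded a K : (forall k, Rabs (a k) <= K) -> subexponential a.
Proof.
move=> H eps Heps; exists K => k.
have HK : 0 <= K by apply: Rle_trans (Rabs_pos _) (H k).
have := exp_ineq1_le (eps * Rabs (IZR k)).
have := Rmult_le_pos _ _ (Rlt_le _ _ Heps) (Rabs_pos (IZR k)) => H1 H2.
have := H k; nra.
Qed.

(** Half of the exponent absorbs the linear factor, by [n + 1 <= (1 + 2 / eps) * exp (eps / 2 *
    n)]. *)
Lemma subexponential_mult (m a : Z -> R) c :
  (forall k, Rabs (m k) <= c * (Rabs (IZR k) + 1)) -> subexponential a ->
  subexponential (fun k => m k * a k).
Proof.
move=> Hm Ha eps Heps.
have [K HK] := Ha (eps / 2) ltac:(lra).
exists (c * (1 + 2 / eps) * K) => k.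
set n := Rabs (IZR k); have Hn : 0 <= n := Rabs_pos _.
have Hc : 0 <= c.
  by have := Hm 0%Z; rewrite Rabs_R0; have := Rabs_pos (m 0%Z); lra.
have He : exp (eps * n) = exp (eps / 2 * n) * exp (eps / 2 * n).
  by rewrite -exp_plus; congr exp; field.
have H1 : n + 1 <= (1 + 2 / eps) * exp (eps / 2 * n).
  have H2 := exp_ineq1_le (eps / 2 * n).
  have Hi : 0 < 2 / eps by apply: Rdiv_lt_0_compat; lra.
  have H3 : 2 / eps * (eps / 2 * n) = n by field; lra.
  have H4 : 0 <= eps / 2 * n by apply: Rmult_le_pos; lra.
  have := Rmult_le_compat_l (2 / eps) _ _ (Rlt_le _ _ Hi) H2; nra.
rewrite Rabs_mult He.
have H2 := Hm k; have H3 := HK k; rewrite -/n in H2 H3.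
have H4 : Rabs (m k) <= c * ((1 + 2 / eps) * exp (eps / 2 * n)).
  by apply: Rle_trans H2 _; apply: Rmult_le_compat_l.
have := Rmult_le_compat _ _ _ _ (Rabs_pos _) (Rabs_pos _) H4 H3; nra.
Qed.

Lemma subexponential_opp a : subexponential a -> subexponential (fun k => - a k).
Proof. by move=> H eps Heps; have [K HK] := H eps Heps; exists K => k; rewrite Rabs_Ropp. Qed.

Lemma ex_series_exp_neg_abs c : 0 < c -> ex_series (fold_Z (fun k => exp (- (c * Rabs (IZR k))))).
Proof.
move=> Hc; have := is_series_exp_abs_shift 0 c ltac:(lra) Hc => H.
eexists; apply: is_series_ext H => n; rewrite /fold_Z; by rewrite !Rminus_0_r.
Qed.

Section DampedSeries.
Variables (mu om : Z -> R) (c : R).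
Hypothesis mu_lb : forall k, Rabs (IZR k) - 1 <= mu k.
Hypothesis mu_ge0 : forall k, 0 <= mu k.
Hypothesis mu_ub : forall k, Rabs (mu k) <= 1 * (Rabs (IZR k) + 1).
Hypothesis om_ub : forall k, Rabs (om k) <= c * (Rabs (IZR k) + 1).

(** Rates and frequencies are kept independent: the harmonic extension has [om k = k], while its
    product with the character of index -j, needed for the j-th Fourier coefficient, has
    [om k = k - j] with the same rates. *)
Definition damped_term (a b : Z -> R) (sigma phi : R) (k : Z) : R :=
  exp (- (mu k * sigma)) * (a k * cos (om k * phi) + b k * sin (om k * phi)).

Definition damped_series (a b : Z -> R) (sigma phi : R) : R :=
  Series (fold_Z (damped_term a b sigma phi)).

Definition damped_bound (a b : Z -> R) (sigma : R) (k : Z) : R :=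
  (Rabs (a k) + Rabs (b k)) * exp (- (mu k * sigma)).

Lemma damped_term_le a b s0 sigma phi k : s0 <= sigma ->
  Rabs (damped_term a b sigma phi k) <= damped_bound a b s0 k.
Proof.
move=> Hs; rewrite /damped_term /damped_bound Rabs_mult Rmult_comm.
rewrite (Rabs_pos_eq (exp _)); last exact: Rlt_le (exp_pos _).
apply: Rmult_le_compat; [exact: Rabs_pos | exact: Rlt_le (exp_pos _) | |].
  apply: Rle_trans (Rabs_triang _ _) _; rewrite !Rabs_mult.
  have Hc : Rabs (cos (om k * phi)) <= 1 by apply: Rabs_le; apply: COS_bound.
  have Hsn : Rabs (sin (om k * phi)) <= 1 by apply: Rabs_le; apply: SIN_bound.
  have := Rabs_pos (a k); have := Rabs_pos (b k); nra.
have H : mu k * s0 <= mu k * sigma by apply: Rmult_le_compat_l.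
have [Hlt|Heq] := Rle_lt_or_eq_dec _ _ H; last by rewrite Heq; apply: Rle_refl.
by apply: Rlt_le; apply: exp_increasing; lra.
Qed.

(** The coefficients cost at most [exp (sigma / 2 * |k|)] and the damping gains
    [exp (- sigma * (|k| - 1))]; a geometric majorant of rate sigma/2 remains. *)
Lemma ex_series_damped_bound a b sigma : subexponential a -> subexponential b -> 0 < sigma ->
  ex_series (fold_Z (damped_bound a b sigma)).
Proof.
move=> Ha Hb Hs.
have [K HK] := Ha (sigma / 2) ltac:(lra); have [L HL] := Hb (sigma / 2) ltac:(lra).
apply: (ex_series_fold_Z_le _ (fun k => ((K + L) * exp sigma) * exp (- (sigma / 2 * Rabs (IZR k))))).
  move=> k; split.
    apply: Rmult_le_pos; last exact: Rlt_le (exp_pos _).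
    by have := Rabs_pos (a k); have := Rabs_pos (b k); lra.
  have HE : exp (- (mu k * sigma)) <= exp sigma * exp (- (sigma * Rabs (IZR k))).
    rewrite -exp_plus.
    have H : - (mu k * sigma) <= sigma + - (sigma * Rabs (IZR k)) by have := mu_lb k; nra.
    have [Hlt|->] := Rle_lt_or_eq_dec _ _ H; last exact: Rle_refl.
    by apply: Rlt_le; apply: exp_increasing.
  have H1 : Rabs (a k) + Rabs (b k) <= (K + L) * exp (sigma / 2 * Rabs (IZR k)).
    have := HK k; have := HL k; lra.
  rewrite /damped_bound.
  apply: Rle_trans (Rmult_le_compat _ _ _ _ _ _ H1 HE) _.
  - by have := Rabs_pos (a k); have := Rabs_pos (b k); lra.
  - exact: Rlt_le (exp_pos _).
  apply: Req_le.
  have -> : exp (- (sigma / 2 * Rabs (IZR k))) = exp (sigma / 2 * Rabs (IZR k)) * exp (- (sigma * Rabs (IZR k))).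
    by rewrite -exp_plus; congr exp; field.
  ring.
rewrite fold_Z_scal; apply: (ex_series_scal (V := R_NormedModule)).
by apply: ex_series_exp_neg_abs; lra.
Qed.

Lemma ex_series_damped_term a b sigma phi : subexponential a -> subexponential b -> 0 < sigma ->
  ex_series (fold_Z (damped_term a b sigma phi)).
Proof.
move=> Ha Hb Hs; apply: ex_series_Rabs.
apply: ex_series_le_nonneg (ex_series_damped_bound a b sigma Ha Hb Hs) => n.
split; first exact: Rabs_pos.
apply: Rle_trans (Rabs_triang _ _) _.
by apply: Rplus_le_compat; apply: damped_term_le; apply: Rle_refl.
Qed.

Lemma damped_series_le a b s0 sigma phi : subexponential a -> subexponential b -> 0 < s0 ->
  s0 <= sigma -> Rabs (damped_series a b sigma phi) <= Series (fold_Z (damped_bound a b s0)).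
Proof.
move=> Ha Hb Hs0 Hs.
have Hle n : 0 <= Rabs (fold_Z (damped_term a b sigma phi) n) <= fold_Z (damped_bound a b s0) n.
  split; first exact: Rabs_pos.
  apply: Rle_trans (Rabs_triang _ _) _.
  by apply: Rplus_le_compat; apply: damped_term_le.
have Hex := ex_series_damped_bound a b s0 Ha Hb Hs0.
apply: Rle_trans (Series_Rabs _ (ex_series_le_nonneg _ _ Hle Hex)) _.
exact: Series_le.
Qed.

Lemma is_derive_damped_term_sigma a b sigma phi k :
  is_derive (fun s => damped_term a b s phi k) sigma
    (damped_term (fun k => - (mu k * a k)) (fun k => - (mu k * b k)) sigma phi k).
Proof. by rewrite /damped_term; auto_derive => //; ring. Qed.

Lemma is_derive_damped_term_phi a b sigma phi k :
  is_derive (fun p => damped_term a b sigma p k) phi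
    (damped_term (fun k => om k * b k) (fun k => - (om k * a k)) sigma phi k).
Proof. by rewrite /damped_term; auto_derive => //; ring. Qed.

Lemma subexponential_mu a : subexponential a -> subexponential (fun k => - (mu k * a k)).
Proof. by move=> H; apply: subexponential_opp; apply: subexponential_mult H. Qed.

Lemma subexponential_om a : subexponential a -> subexponential (fun k => om k * a k).
Proof. by move=> H; apply: subexponential_mult H. Qed.

Lemma is_derive_damped_series_sigma a b sigma phi : subexponential a -> subexponential b -> 0 < sigma ->
  is_derive (fun s => damped_series a b s phi) sigma
    (damped_series (fun k => - (mu k * a k)) (fun k => - (mu k * b k)) sigma phi).
Proof.
move=> Ha Hb Hs.
have Ha' := subexponential_mu a Ha; have Hb' := subexponential_mu b Hb.
have Ha'' := subexponential_mu _ Ha'; have Hb'' := subexponential_mu _ Hb'.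
(* The lower end sigma/2 keeps the interval away from 0, where the damping disappears; the majorant
   taken there is uniform on the interval. *)
apply: (is_derive_Series_fold_Z (fun k s => damped_term a b s phi k)
  (fun k s => damped_term _ _ s phi k)
  (fun k s => damped_term _ _ s phi k)
  (damped_bound (fun k => - (mu k * - (mu k * a k))) (fun k => - (mu k * - (mu k * b k))) (sigma / 2))
  (sigma / 2) (sigma + 1)).
- lra.
- by move=> k y Hy; apply: is_derive_damped_term_sigma.
- by move=> k y Hy; apply: is_derive_damped_term_sigma.
- by move=> k y Hy; apply: damped_term_le; lra.
- by apply: ex_series_damped_bound => //; lra.
- by move=> y Hy; apply: ex_series_damped_term => //; lra.
- by move=> y Hy; apply: ex_series_damped_term => //; lra.
Qed.

Lemma is_derive_damped_series_phi a b sigma phi : subexponential a -> subexponential b -> 0 < sigma ->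
  is_derive (fun p => damped_series a b sigma p) phi
    (damped_series (fun k => om k * b k) (fun k => - (om k * a k)) sigma phi).
Proof.
move=> Ha Hb Hs.
have Ha' := subexponential_om b Hb; have Hb' := subexponential_opp _ (subexponential_om a Ha).
have Ha'' := subexponential_om _ Hb'; have Hb'' := subexponential_opp _ (subexponential_om _ Ha').
apply: (is_derive_Series_fold_Z (fun k p => damped_term a b sigma p k)
  (fun k p => damped_term _ _ sigma p k)
  (fun k p => damped_term _ _ sigma p k)
  (damped_bound (fun k => om k * - (om k * a k)) (fun k => - (om k * (om k * b k))) sigma)
  (phi - 1) (phi + 1)).
- lra.
- by move=> k y Hy; apply: is_derive_damped_term_phi.
- by move=> k y Hy; apply: is_derive_damped_term_phi.
- by move=> k y Hy; apply: damped_term_le; lra.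
- exact: ex_series_damped_bound.
- by move=> y Hy; apply: ex_series_damped_term.
- by move=> y Hy; apply: ex_series_damped_term.
Qed.

(** A Lipschitz estimate, moving first in sigma and then in phi. Both partial derivatives are again
    damped series, bounded on [sigma / 2 < s] by the summable majorants at sigma/2. *)
Lemma continuous_damped_series a b sigma phi : subexponential a -> subexponential b -> 0 < sigma ->
  continuous (fun p : R * R => damped_series a b (fst p) (snd p)) (sigma, phi).
Proof.
move=> Ha Hb Hs.
have Ha1 := subexponential_mu a Ha; have Hb1 := subexponential_mu b Hb.
have Ha2 := subexponential_om b Hb; have Hb2 := subexponential_opp _ (subexponential_om a Ha).
have Hs2 : 0 < sigma / 2 by lra.
pose S1 := Series (fold_Z (damped_bound (fun k => - (mu k * a k)) (fun k => - (mu k * b k)) (sigma / 2))).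
pose S2 := Series (fold_Z (damped_bound (fun k => om k * b k) (fun k => - (om k * a k)) (sigma / 2))).
have HS1 : 0 <= S1.
  by apply: Rle_trans (Rabs_pos _) (damped_series_le _ _ _ sigma phi Ha1 Hb1 Hs2 _); lra.
have HS2 : 0 <= S2.
  by apply: Rle_trans (Rabs_pos _) (damped_series_le _ _ _ sigma phi Ha2 Hb2 Hs2 _); lra.
have HL s p : sigma / 2 < s ->
    Rabs (damped_series a b s p - damped_series a b sigma phi) <= S1 * Rabs (s - sigma) + S2 * Rabs (p - phi).
  move=> Hss.
  have H1 : Rabs (damped_series a b s p - damped_series a b sigma p) <= S1 * Rabs (s - sigma).
    have Hmin : sigma / 2 < Rmin sigma s by apply: Rmin_glb_lt; lra.
    have [e [He1 ->]] := MVT_gen (fun s => damped_series a b s p) sigma s 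
      (fun s => damped_series (fun k => - (mu k * a k)) (fun k => - (mu k * b k)) s p)
      ltac:(move=> z Hz; apply: is_derive_damped_series_sigma => //; lra)
      ltac:(move=> z Hz; apply/continuity_pt_filterlim;
        apply: (ex_derive_continuous (V := R_NormedModule) (fun s => damped_series a b s p)); eexists;
        apply: is_derive_damped_series_sigma => //; lra).
    rewrite Rabs_mult; apply: Rmult_le_compat_r; first exact: Rabs_pos.
    by apply: damped_series_le => //; lra.
  have H2 : Rabs (damped_series a b sigma p - damped_series a b sigma phi) <= S2 * Rabs (p - phi).
    have [e [He1 ->]] := MVT_gen (fun p => damped_series a b sigma p) phi p
      (fun p => damped_series (fun k => om k * b k) (fun k => - (om k * a k)) sigma p)
      ltac:(move=> z Hz; apply: is_derive_damped_series_phi => //; lra)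
      ltac:(move=> z Hz; apply/continuity_pt_filterlim;
        apply: (ex_derive_continuous (V := R_NormedModule) (fun p => damped_series a b sigma p)); eexists;
        apply: is_derive_damped_series_phi => //; lra).
    rewrite Rabs_mult; apply: Rmult_le_compat_r; first exact: Rabs_pos.
    by apply: damped_series_le => //; lra.
  have -> : damped_series a b s p - damped_series a b sigma phi =
    (damped_series a b s p - damped_series a b sigma p) + (damped_series a b sigma p - damped_series a b sigma phi) by ring.
  apply: Rle_trans (Rabs_triang _ _) _; lra.
apply/filterlim_locally => eps.
have HS : 0 < S1 + S2 + 1 by lra.
have Hd : 0 < Rmin (sigma / 2) (eps / (S1 + S2 + 1)).
  by apply: Rmin_pos => //; apply: Rdiv_lt_0_compat => //; apply: cond_pos.
exists (mkposreal _ Hd) => -[s p] [].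
rewrite /ball /= /AbsRing_ball /= /abs /minus /plus /opp /= => B1 B2.
have B3 := Rlt_le_trans _ _ _ B1 (Rmin_l _ _).
have B4 := Rlt_le_trans _ _ _ B1 (Rmin_r _ _).
have B5 := Rlt_le_trans _ _ _ B2 (Rmin_r _ _).
move/Rabs_def2: B3 => B3.
apply: Rle_lt_trans (HL s p _) _; first lra.
rewrite /Rminus; set e := eps / _ in B4 B5.
have E : (S1 + S2 + 1) * e = eps by rewrite /e; field; lra.
have := Rabs_pos (s + - sigma); have := Rabs_pos (p + - phi); nra.
Qed.

End DampedSeries.

(* Integrating term by term is avoided: the terms with om k <> 0 have an explicit periodic antiderivative. *)
Lemma RInt_damped_series mu om c a b sigma j :
  (forall k, Rabs (IZR k) - 1 <= mu k) -> (forall k, 0 <= mu k) ->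
  (forall k, Rabs (mu k) <= 1 * (Rabs (IZR k) + 1)) ->
  (forall k, Rabs (om k) <= c * (Rabs (IZR k) + 1)) ->
  (forall k, exists m, om k = IZR m) -> (forall k, om k = 0 <-> k = j) ->
  subexponential a -> subexponential b -> 0 < sigma ->
  ex_RInt (damped_series mu om a b sigma) 0 (2 * PI) /\
  RInt (damped_series mu om a b sigma) 0 (2 * PI) = 2 * PI * (exp (- (mu j * sigma)) * a j).
Proof.
move=> Hmu1 Hmu2 Hmu3 Hom Homz Homj Ha Hb Hs.
(* [A] and [B] are the coefficients of the termwise antiderivative: [a cos + b sin] integrates to
   [(a / om) sin - (b / om) cos]. The term of zero frequency is removed by the value 0 at [j] and
   reappears as the constant [C]; all other frequencies are nonzero integers, so [inv] is bounded by
   1. *)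
pose inv k := if Z.eqb k j then 0 else / om k.
have Hinv k : Rabs (inv k) <= 1 * (Rabs (IZR k) + 1).
  rewrite /inv; have Hk := Rabs_pos (IZR k).
  case: Z.eqb_spec => Hkj; first by rewrite Rabs_R0; lra.
  have [m Hm] := Homz k.
  have Hm0 : m <> 0%Z by move=> H0; apply: Hkj; apply/Homj; rewrite Hm H0.
  have Hm1 : 1 <= Rabs (IZR m) by rewrite -abs_IZR; apply: IZR_le; lia.
  rewrite Rabs_inv Hm Rmult_1_l.
  apply: Rle_trans (_ : 1 <= _); last lra.
  rewrite -Rinv_1; apply: Rinv_le_contravar; lra.
pose A k := - (inv k * b k); pose B k := inv k * a k.
have HA : subexponential A by apply: subexponential_opp; apply: subexponential_mult Hb; exact: Hinv.
have HB : subexponential B by apply: subexponential_mult Ha; exact: Hinv.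
pose P := damped_series mu om A B sigma.
pose C := exp (- (mu j * sigma)) * a j.
have Hoj : om j = 0 by apply/Homj.
have HP phi : is_derive P phi (damped_series mu om a b sigma phi - C).
  have H := is_derive_damped_series_phi mu om c Hmu1 Hmu2 Hom A B sigma phi HA HB Hs.
  have E : damped_series mu om (fun k => om k * B k) (fun k => - (om k * A k)) sigma phi =
      damped_series mu om a b sigma phi - C.
    apply: is_series_unique.
    have H1 : is_series (fold_Z (damped_term mu om a b sigma phi)) (damped_series mu om a b sigma phi).
      by apply: Series_correct; apply: (ex_series_damped_term mu om Hmu1 Hmu2).
    have H2 : is_series (fold_Z (fun k => if Z.eqb k j then C else 0)) C.
      have := is_series_fold_Z_single (fun k => if Z.eqb k j then C else 0) j.
      rewrite Z.eqb_refl; apply => k Hk.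
      by rewrite (proj2 (Z.eqb_neq _ _) Hk).
    apply: is_series_ext (is_series_minus _ _ _ _ H1 H2) => n.
    have Et k : damped_term mu om (fun k => om k * B k) (fun k => - (om k * A k)) sigma phi k =
       damped_term mu om a b sigma phi k - (if Z.eqb k j then C else 0).
      rewrite /damped_term /A /B /inv; case: Z.eqb_spec => [->|Hk].
        by rewrite Hoj !Rmult_0_l cos_0 sin_0 /C; ring.
      have Ho : om k <> 0 by move/Homj.
      by field.
    by rewrite /fold_Z !Et /minus /plus /opp /=; ring.
  by rewrite -E.
have Hc phi : continuous (damped_series mu om a b sigma) phi.
  apply: (ex_derive_continuous (V := R_NormedModule)); eexists.
  exact: (is_derive_damped_series_phi mu om c).
have HPper : P (2 * PI) = P 0.
  apply: Series_ext => n; rewrite /fold_Z /damped_term.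
  have Hp k : cos (om k * (2 * PI)) = 1 /\ sin (om k * (2 * PI)) = 0.
    have [m ->] := Homz k.
    have Hsin : sin (IZR m * PI) = 0 by apply: sin_eq_0_1; exists m.
    have -> : IZR m * (2 * PI) = 2 * (IZR m * PI) by ring.
    by rewrite cos_2a_sin sin_2a Hsin; split; ring.
  by rewrite !(proj1 (Hp _)) !(proj2 (Hp _)) !Rmult_0_r cos_0 sin_0 !Rmult_0_r.
have HI : is_RInt (fun phi => damped_series mu om a b sigma phi - C) 0 (2 * PI) 0.
  have := is_RInt_derive (V := R_CompleteNormedModule) P (fun phi => damped_series mu om a b sigma phi - C) 0 (2 * PI).
  rewrite HPper /minus plus_opp_r; apply => [phi _|phi _]; first exact: HP.
  by apply: (continuous_minus (V := R_NormedModule)); [exact: Hc | exact: continuous_const].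
have HI2 := is_RInt_const (V := R_NormedModule) 0 (2 * PI) C.
have HI3 := is_RInt_plus (V := R_NormedModule) _ _ _ _ _ _ HI HI2.
have HF : is_RInt (damped_series mu om a b sigma) 0 (2 * PI) (2 * PI * C).
  have -> : 2 * PI * C = plus (0 : R_NormedModule) (scal (2 * PI - 0) (C : R_NormedModule)).
    by rewrite /plus /scal /= /mult /=; ring.
  apply: is_RInt_ext HI3 => x _; rewrite /plus /=; ring.
split; first by eexists; exact: HF.
exact: is_RInt_unique.
Qed.

(** * Fourier modes of a harmonic function *)

(** What [C1_interior] demands of the real part and of the imaginary part separately. *)
Definition C1_strip (u : R -> R -> R) : Prop :=
  forall r phi, 0 < r < 1 ->
    ex_derive (fun rho => u rho phi) r /\ ex_derive (u r) phi /\
    continuous (fun p : R * R => Derive (fun rho => u rho (snd p)) (fst p)) (r, phi) /\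
    continuous (fun p : R * R => Derive (u (fst p)) (snd p)) (r, phi).

Lemma C1_interior_iff v : C1_interior v <->
  C1_strip (fun r phi => Re (v r phi)) /\ C1_strip (fun r phi => Im (v r phi)).
Proof.
split.
  move=> H; split=> r phi Hr; have [H1 [H2 [H3 H4]]] := H r phi Hr.
    split; first by apply: (proj1 (proj1 (ex_derive_C_iff _ _) H1)).
    split; first by apply: (proj1 (proj1 (ex_derive_C_iff _ _) H2)).
    split; first by apply: (proj1 (proj1 (continuous_C_iff _ _) H3)).
    by apply: (proj1 (proj1 (continuous_C_iff _ _) H4)).
  split; first by apply: (proj2 (proj1 (ex_derive_C_iff _ _) H1)).
  split; first by apply: (proj2 (proj1 (ex_derive_C_iff _ _) H2)).
  split; first by apply: (proj2 (proj1 (continuous_C_iff _ _) H3)).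
  by apply: (proj2 (proj1 (continuous_C_iff _ _) H4)).
move=> [H H'] r phi Hr; have [H1 [H2 [H3 H4]]] := H r phi Hr; have [H1' [H2' [H3' H4']]] := H' r phi Hr.
split; first by apply/ex_derive_C_iff.
split; first by apply/ex_derive_C_iff.
by split; apply/continuous_C_iff.
Qed.

Lemma continuous_section {U : UniformSpace} (f : R * R -> U) r phi :
  continuous f (r, phi) -> continuous (fun y => f (r, y)) phi.
Proof.
move=> H; apply: (continuous_comp_2 (fun _ => r) (fun y => y) (fun a b => f (a, b))).
- exact: continuous_const.
- exact: continuous_id.
- by apply: continuous_ext H => -[].
Qed.

(** The k-th Fourier coefficient in real form: testing (Re f, Im f) against (cos, sin) gives its
    real part and against (-sin, cos) its imaginary part, up to the factor 1/(2 pi). Only the common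
    differential relations and periodicity are kept, so that both parts are treated at once. *)
Definition trig_pair (k : R) (w1 w2 : R -> R) : Prop :=
  (forall phi, is_derive w1 phi (- k * w2 phi)) /\ (forall phi, is_derive w2 phi (k * w1 phi)) /\
  w1 (2 * PI) = w1 0 /\ w2 (2 * PI) = w2 0.

(** Passing from (w1, w2) to (w2, -w1) multiplies the tested coefficient by i; two rotations give
    -1. *)
Lemma trig_pair_rotate k w1 w2 : trig_pair k w1 w2 -> trig_pair k w2 (fun phi => - w1 phi).
Proof.
move=> [H1 [H2 [H3 H4]]]; split.
  move=> phi; have -> : - k * - w1 phi = k * w1 phi by ring.
  exact: H2.
split; last by rewrite H3 H4.
move=> phi; have -> : k * w2 phi = opp (- k * w2 phi) by rewrite /opp /=; ring.
exact: (is_derive_opp (V := R_NormedModule)).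
Qed.

Lemma sin_period_Z k : sin (IZR k * (2 * PI)) = 0.
Proof. by apply: sin_eq_0_1; exists (2 * k)%Z; rewrite mult_IZR; ring. Qed.

Lemma cos_period_Z k : cos (IZR k * (2 * PI)) = 1.
Proof.
have -> : IZR k * (2 * PI) = 2 * (IZR k * PI) by ring.
have Hsin : sin (IZR k * PI) = 0 by apply: sin_eq_0_1; exists k.
by rewrite cos_2a_sin Hsin; ring.
Qed.

Lemma trig_pair_cos_sin k :
  trig_pair (IZR k) (fun phi => cos (IZR k * phi)) (fun phi => sin (IZR k * phi)).
Proof.
split; first by move=> phi; auto_derive => //; ring.
split; first by move=> phi; auto_derive => //; ring.
by rewrite sin_period_Z cos_period_Z !Rmult_0_r cos_0 sin_0.
Qed.

Lemma trig_pair_sin_cos k :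
  trig_pair (IZR k) (fun phi => - sin (IZR k * phi)) (fun phi => cos (IZR k * phi)).
Proof.
split; first by move=> phi; auto_derive => //; ring.
split; first by move=> phi; auto_derive => //; ring.
by rewrite sin_period_Z cos_period_Z !Rmult_0_r cos_0 sin_0.
Qed.

Lemma ex_derive_continuous_R (f : R -> R) x : ex_derive f x -> continuous f x.
Proof. exact: (ex_derive_continuous (V := R_NormedModule)). Qed.

Lemma trig_pair_continuous k (w1 w2 : R -> R) (phi : R) : trig_pair k w1 w2 -> continuous w1 phi /\ continuous w2 phi.
Proof.
by move=> [H1 [H2 _]]; split; apply: ex_derive_continuous_R; eexists; [exact: H1 | exact: H2].
Qed.

Definition pairing (w1 w2 f1 f2 : R -> R) : R := RInt (fun phi => f1 phi * w1 phi + f2 phi * w2 phi) 0 (2 * PI).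

Lemma continuous_pairing_integrand (w1 w2 f1 f2 : R -> R) (phi : R) :
  continuous w1 phi -> continuous w2 phi -> continuous f1 phi -> continuous f2 phi ->
  continuous (fun phi => f1 phi * w1 phi + f2 phi * w2 phi) phi.
Proof.
move=> H1 H2 H3 H4; apply: (continuous_plus (V := R_NormedModule)).
  exact: (continuous_mult (K := R_AbsRing) f1 w1).
exact: (continuous_mult (K := R_AbsRing) f2 w2).
Qed.

Lemma ex_RInt_continuous_all (f : R -> R) a b : (forall x : R, continuous f x) -> ex_RInt f a b.
Proof. by move=> H; apply: (ex_RInt_continuous (V := R_CompleteNormedModule)) => z _; apply: H. Qed.

Lemma RInt_lin (f g : R -> R) c d a b : ex_RInt f a b -> ex_RInt g a b ->
  RInt (fun x => c * f x + d * g x) a b = c * RInt f a b + d * RInt g a b.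
Proof.
move=> Hf Hg; apply: is_RInt_unique.
have H1 := is_RInt_scal (V := R_NormedModule) _ _ _ c _ (RInt_correct (V := R_CompleteNormedModule) _ _ _ Hf).
have H2 := is_RInt_scal (V := R_NormedModule) _ _ _ d _ (RInt_correct (V := R_CompleteNormedModule) _ _ _ Hg).
exact: (is_RInt_plus (V := R_NormedModule) _ _ _ _ _ _ H1 H2).
Qed.

Lemma RInt_eq (f g : R -> R) a b : (forall x, f x = g x) -> RInt f a b = RInt g a b.
Proof. by move=> H; apply: RInt_ext => x _; apply: H. Qed.

Definition smooth1 (f : R -> R) : Prop :=
  (forall x, ex_derive f x) /\ (forall x : R, continuous (Derive f) x).

Lemma smooth1_continuous f (x : R) : smooth1 f -> continuous f x.
Proof. by move=> [H _]; apply: ex_derive_continuous_R. Qed.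

Lemma Derive_plus_scal f g c x : ex_derive f x -> ex_derive g x ->
  Derive (fun y => f y + c * g y) x = Derive f x + c * Derive g x.
Proof.
move=> Hf Hg; rewrite Derive_plus ?Derive_scal //.
exact: ex_derive_scal.
Qed.

Lemma smooth1_plus_scal f g c : smooth1 f -> smooth1 g -> smooth1 (fun x => f x + c * g x).
Proof.
move=> [Hf1 Hf2] [Hg1 Hg2]; split.
  move=> x; apply: (ex_derive_plus (V := R_NormedModule)) => //.
  exact: ex_derive_scal.
move=> x; apply: (continuous_ext (fun y => Derive f y + c * Derive g y)).
  by move=> y; rewrite Derive_plus_scal.
apply: (continuous_plus (V := R_NormedModule)) => //.
by apply: (continuous_scal_r (V := R_NormedModule)).
Qed.

(** Integration by parts on the circle; the boundary terms cancel by periodicity. The derivative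
    falls on the test pair and rotates it with a factor k. *)
Lemma pairing_derive k w1 w2 f1 f2 : trig_pair k w1 w2 -> smooth1 f1 -> smooth1 f2 ->
  f1 (2 * PI) = f1 0 -> f2 (2 * PI) = f2 0 ->
  pairing w1 w2 (Derive f1) (Derive f2) = k * pairing w2 (fun phi => - w1 phi) f1 f2.
Proof.
move=> Hw Hf1 Hf2 Hp1 Hp2; have [Hw1 [Hw2 [Hw3 Hw4]]] := Hw.
pose F phi := f1 phi * w1 phi + f2 phi * w2 phi.
pose dF phi := 1 * (Derive f1 phi * w1 phi + Derive f2 phi * w2 phi) + - k * (f1 phi * w2 phi + f2 phi * - w1 phi).
have HF phi : is_derive F phi (dF phi).
  have E1 : ex_derive f1 phi by apply: (proj1 Hf1).
  have E2 : ex_derive f2 phi by apply: (proj1 Hf2).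
  rewrite /F; auto_derive.
    by repeat split => //; eexists; [exact: Hw1 | exact: Hw2].
  rewrite (is_derive_unique _ _ _ (Hw1 phi)) (is_derive_unique _ _ _ (Hw2 phi)) /dF.
  have -> : Derive (fun x => f1 x) phi = Derive f1 phi by [].
  have -> : Derive (fun x => f2 x) phi = Derive f2 phi by [].
  ring.
have Hcw phi := trig_pair_continuous k w1 w2 phi Hw.
have Hcw' phi := trig_pair_continuous _ _ _ phi (trig_pair_rotate _ _ _ Hw).
have HA phi : continuous (fun phi => Derive f1 phi * w1 phi + Derive f2 phi * w2 phi) phi.
  by case: (Hcw phi) => C1 C2; apply: continuous_pairing_integrand => //; [apply: (proj2 Hf1) | apply: (proj2 Hf2)].
have HB phi : continuous (fun phi => f1 phi * w2 phi + f2 phi * - w1 phi) phi.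
  by case: (Hcw' phi) => C1 C2; apply: continuous_pairing_integrand => //; apply: smooth1_continuous.
have HI : is_RInt dF 0 (2 * PI) (minus (F (2 * PI)) (F 0)).
  apply: (is_RInt_derive (V := R_CompleteNormedModule)) => phi _; first exact: HF.
  apply: (continuous_plus (V := R_NormedModule)); first by apply: (continuous_scal_r (V := R_NormedModule)).
  by apply: (continuous_scal_r (V := R_NormedModule)).
have H0 : RInt dF 0 (2 * PI) = 0.
  by rewrite (is_RInt_unique _ _ _ _ HI) /F Hp1 Hp2 Hw3 Hw4 /minus plus_opp_r.
rewrite RInt_lin in H0; try exact: ex_RInt_continuous_all.
rewrite /pairing; lra.
Qed.

Lemma pairing_lin (w1 w2 f1 f2 g1 g2 : R -> R) (c d : R) :
  (forall x : R, continuous w1 x /\ continuous w2 x) ->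
  (forall x : R, continuous f1 x) -> (forall x : R, continuous f2 x) ->
  (forall x : R, continuous g1 x) -> (forall x : R, continuous g2 x) ->
  pairing w1 w2 (fun x => c * f1 x + d * g1 x) (fun x => c * f2 x + d * g2 x) =
  c * pairing w1 w2 f1 f2 + d * pairing w1 w2 g1 g2.
Proof.
move=> Hw Hf1 Hf2 Hg1 Hg2; rewrite /pairing -RInt_lin.
- by apply: RInt_eq => x; ring.
- by apply: ex_RInt_continuous_all => x; case: (Hw x) => ? ?; apply: continuous_pairing_integrand.
- by apply: ex_RInt_continuous_all => x; case: (Hw x) => ? ?; apply: continuous_pairing_integrand.
Qed.

(* The covariant derivative acts on the k-th Fourier mode as multiplication by i (k - nu). *)
Lemma pairing_covariant k nu w1 w2 f1 f2 : trig_pair k w1 w2 -> smooth1 f1 -> smooth1 f2 ->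
  f1 (2 * PI) = f1 0 -> f2 (2 * PI) = f2 0 ->
  pairing w1 w2 (fun x => Derive f1 x + nu * f2 x) (fun x => Derive f2 x + - nu * f1 x) =
  (k - nu) * pairing w2 (fun phi => - w1 phi) f1 f2.
Proof.
move=> Hw Hf1 Hf2 Hp1 Hp2.
have Hcw x := trig_pair_continuous k w1 w2 x Hw.
have Hc1 x := smooth1_continuous f1 x Hf1; have Hc2 x := smooth1_continuous f2 x Hf2.
have Hc1' x : continuous (fun x => - f1 x) x by apply: (continuous_opp (V := R_NormedModule)).
transitivity (1 * pairing w1 w2 (Derive f1) (Derive f2) + nu * pairing w1 w2 f2 (fun x => - f1 x)).
  rewrite -pairing_lin //; [| exact: (proj2 Hf1) | exact: (proj2 Hf2)].
  by apply: RInt_eq => x; ring.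
rewrite (pairing_derive k) //.
(* The summand with factor 0 pads the identity to the two-term shape of [RInt_lin]. *)
have -> : pairing w1 w2 f2 (fun x => - f1 x) = - 1 * pairing w2 (fun phi => - w1 phi) f1 f2 + 0 * pairing w1 w2 f1 f2.
  rewrite /pairing -RInt_lin; first by apply: RInt_eq => x; ring.
    apply: ex_RInt_continuous_all => x.
    by case: (trig_pair_continuous _ _ _ x (trig_pair_rotate _ _ _ Hw)) => ? ?; apply: continuous_pairing_integrand.
  by apply: ex_RInt_continuous_all => x; case: (Hcw x) => ? ?; apply: continuous_pairing_integrand.
ring.
Qed.

(** Each covariant derivative contributes [k - nu] and one rotation of the test pair, and two
    rotations produce the minus sign. *)
Lemma pairing_covariant_twice k nu w1 w2 f1 f2 : trig_pair k w1 w2 ->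
  smooth1 f1 -> smooth1 f2 -> smooth1 (Derive f1) -> smooth1 (Derive f2) ->
  (forall x, f1 (x + 2 * PI) = f1 x) -> (forall x, f2 (x + 2 * PI) = f2 x) ->
  let g1 x := Derive f1 x + nu * f2 x in let g2 x := Derive f2 x + - nu * f1 x in
  pairing w1 w2 (fun x => Derive g1 x + nu * g2 x) (fun x => Derive g2 x + - nu * g1 x) =
  - (k - nu) ^ 2 * pairing w1 w2 f1 f2.
Proof.
move=> Hw Hf1 Hf2 Hf1' Hf2' Hp1 Hp2 g1 g2.
(* The second integration by parts needs [g1] and [g2] to be periodic, hence the periodicity of the
   first derivatives. *)
have Hdp f : (forall x, ex_derive f x) -> (forall x, f (x + 2 * PI) = f x) -> Derive f (2 * PI) = Derive f 0.
  move=> Hf Hp; rewrite -(Derive_ext _ _ 0 Hp); symmetry; apply: is_derive_unique.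
  have Hd : is_derive (fun x : R => x + 2 * PI) 0 1 by auto_derive.
  have Hf0 := Derive_correct f (0 + 2 * PI) (Hf _).
  have := is_derive_comp f (fun x => x + 2 * PI) 0 _ _ Hf0 Hd.
  by rewrite /scal /= /mult /= Rmult_1_l Rplus_0_l.
have Hq1 : f1 (2 * PI) = f1 0 by rewrite -(Hp1 0) Rplus_0_l.
have Hq2 : f2 (2 * PI) = f2 0 by rewrite -(Hp2 0) Rplus_0_l.
have Hg1 : g1 (2 * PI) = g1 0 by rewrite /g1 Hq2 (Hdp f1) //; apply: (proj1 Hf1).
have Hg2 : g2 (2 * PI) = g2 0 by rewrite /g2 Hq1 (Hdp f2) //; apply: (proj1 Hf2).
rewrite (pairing_covariant k) //; try exact: smooth1_plus_scal.
rewrite (pairing_covariant k) //; last exact: trig_pair_rotate.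
have -> : pairing (fun phi => - w1 phi) (fun phi => - w2 phi) f1 f2 = -1 * pairing w1 w2 f1 f2 + 0 * pairing w1 w2 f1 f2.
  have Hex : ex_RInt (fun x => f1 x * w1 x + f2 x * w2 x) 0 (2 * PI).
    apply: ex_RInt_continuous_all => x; case: (trig_pair_continuous _ _ _ x Hw) => ? ?.
    by apply: continuous_pairing_integrand => //; apply: smooth1_continuous.
  by rewrite /pairing -RInt_lin //; apply: RInt_eq => x; ring.
ring.
Qed.

(** Differentiation under the integral sign, which is where the joint continuity of the radial
    derivative enters. *)
Lemma is_derive_pairing (w1 w2 : R -> R) u1 u2 (r : R) : (forall x : R, continuous w1 x /\ continuous w2 x) ->
  C1_strip u1 -> C1_strip u2 -> 0 < r < 1 ->
  is_derive (fun r => pairing w1 w2 (u1 r) (u2 r)) r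
    (pairing w1 w2 (fun phi => Derive (fun rho => u1 rho phi) r) (fun phi => Derive (fun rho => u2 rho phi) r)).
Proof.
move=> Hw Hu1 Hu2 Hr.
have Hd y t : 0 < y < 1 -> is_derive (fun z => u1 z t * w1 t + u2 z t * w2 t) y
    (Derive (fun rho => u1 rho t) y * w1 t + Derive (fun rho => u2 rho t) y * w2 t).
  move=> Hy; have [E1 _] := Hu1 y t Hy; have [E2 _] := Hu2 y t Hy.
  by auto_derive => //; ring.
have -> : pairing w1 w2 (fun phi => Derive (fun rho => u1 rho phi) r) (fun phi => Derive (fun rho => u2 rho phi) r) =
  RInt (fun t => Derive (fun z => u1 z t * w1 t + u2 z t * w2 t) r) 0 (2 * PI).
  by apply: RInt_ext => t _; symmetry; apply: is_derive_unique; apply: Hd.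
apply: (is_derive_RInt_param (fun z t => u1 z t * w1 t + u2 z t * w2 t) 0 (2 * PI) r).
- apply: (locally_open_interval 0 1) => // y Hy t _.
  by eexists; apply: Hd.
- move=> t _; apply/continuity_2d_pt_filterlim.
  have [_ [_ [K1 _]]] := Hu1 r t Hr; have [_ [_ [K2 _]]] := Hu2 r t Hr.
  have [W1 W2] := Hw t.
  have HW (w : R -> R) : continuous w t -> continuous (fun p : R * R => w (snd p)) (r, t).
    by move=> Hwt; apply: (continuous_comp snd w) => //; apply: continuous_snd.
  apply: (continuous_ext_loc _ (fun p : R * R => Derive (fun rho => u1 rho (snd p)) (fst p) * w1 (snd p)
     + Derive (fun rho => u2 rho (snd p)) (fst p) * w2 (snd p))).
    have [d Hl] : locally r (fun y => 0 < y < 1) by apply: (locally_open_interval 0 1).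
    by exists d => -[y z] [Hy _]; symmetry; apply: is_derive_unique; apply: Hd; apply: Hl.
  apply: (continuous_plus (V := R_NormedModule)).
    exact: (continuous_mult (K := R_AbsRing) (fun p : R * R => Derive (fun rho => u1 rho (snd p)) (fst p)) _ _ K1 (HW w1 W1)).
  exact: (continuous_mult (K := R_AbsRing) (fun p : R * R => Derive (fun rho => u2 rho (snd p)) (fst p)) _ _ K2 (HW w2 W2)).
- apply: (locally_open_interval 0 1) => // y Hy.
  apply: ex_RInt_continuous_all => t; have [W1 W2] := Hw t.
  have [_ [E1 _]] := Hu1 y t Hy; have [_ [E2 _]] := Hu2 y t Hy.
  by apply: continuous_pairing_integrand => //; apply: ex_derive_continuous_R.
Qed.

Lemma C1_strip_smooth1 u r : C1_strip u -> 0 < r < 1 -> smooth1 (u r).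
Proof.
move=> Hu Hr; split=> x; first by have [_ [H _]] := Hu r x Hr.
have [_ [_ [_ H]]] := Hu r x Hr.
exact: (continuous_section (fun p : R * R => Derive (u (fst p)) (snd p))).
Qed.

Lemma fourier_coef_components (f : R -> C) k :
  (forall x : R, continuous (fun t => Re (f t)) x) -> (forall x : R, continuous (fun t => Im (f t)) x) ->
  fourier_coef f k = 
  ((/ (2 * PI) * pairing (fun phi => cos (IZR k * phi)) (fun phi => sin (IZR k * phi)) (fun t => Re (f t)) (fun t => Im (f t)),
    / (2 * PI) * pairing (fun phi => - sin (IZR k * phi)) (fun phi => cos (IZR k * phi)) (fun t => Re (f t)) (fun t => Im (f t))) : C).
Proof.
move=> H1 H2.
have Hcs x := trig_pair_continuous _ _ _ x (trig_pair_cos_sin k).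
have Hsc x := trig_pair_continuous _ _ _ x (trig_pair_sin_cos k).
have E1 x : Re (f x * ((cos (IZR k * x), - sin (IZR k * x))%R : C))%C = Re (f x) * cos (IZR k * x) + Im (f x) * sin (IZR k * x).
  by rewrite /=; rewrite /Re /Im; ring.
have E2 x : Im (f x * ((cos (IZR k * x), - sin (IZR k * x))%R : C))%C = Re (f x) * - sin (IZR k * x) + Im (f x) * cos (IZR k * x).
  by rewrite /=; rewrite /Re /Im; ring.
rewrite /fourier_coef RInt_C_components.
- rewrite (RInt_ext _ _ _ _ (fun x _ => E1 x)) (RInt_ext _ _ _ _ (fun x _ => E2 x)).
  by apply: injective_projections; rewrite /= /pairing; ring.
- apply: (ex_RInt_ext (fun x => Re (f x) * cos (IZR k * x) + Im (f x) * sin (IZR k * x))) => [x _|]; first by rewrite E1.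
  by apply: ex_RInt_continuous_all => x; case: (Hcs x) => ? ?; apply: continuous_pairing_integrand.
- apply: (ex_RInt_ext (fun x => Re (f x) * - sin (IZR k * x) + Im (f x) * cos (IZR k * x))) => [x _|]; first by rewrite E2.
  by apply: ex_RInt_continuous_all => x; case: (Hsc x) => ? ?; apply: continuous_pairing_integrand.
Qed.

(** Carries the relation between normal derivative and value of a mode from the interior circles to
    r = 1, by uniqueness of limits. *)
Lemma boundary_limit (F : (R -> Prop) -> Prop) {FF : ProperFilter F} (th a b : R -> R) t0 a0 b0 mu :
  (forall eps, 0 < eps -> F (fun r => Rabs (th r - t0) < eps)) ->
  (forall eps, 0 < eps -> F (fun r => Rabs (a r - a0) < eps)) ->
  (forall eps, 0 < eps -> F (fun r => Rabs (b r - b0) < eps)) ->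
  F (fun r => th r * a r = mu * b r) -> t0 * a0 = mu * b0.
Proof.
move=> Ht Ha Hb He.
have L (f : R -> R) l : (forall eps, 0 < eps -> F (fun r => Rabs (f r - l) < eps)) -> filterlim f F (locally l).
  by move=> H; apply/filterlim_locally => eps; apply: H; apply: cond_pos.
have H1 : filterlim (fun r => th r * a r) F (locally (t0 * a0)).
  exact: (filterlim_comp_2 th a Rmult (L _ _ Ht) (L _ _ Ha) (filterlim_mult (K := R_AbsRing) t0 a0)).
have H2 : filterlim (fun r => mu * b r) F (locally (mu * b0)).
  exact: (filterlim_comp_2 (fun _ => mu) b Rmult (filterlim_const mu) (L _ _ Hb) (filterlim_mult (K := R_AbsRing) mu b0)).
have H3 : filterlim (fun r => mu * b r) F (locally (t0 * a0)).
  exact (filterlim_ext_loc _ _ He H1).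
exact: (filterlim_locally_unique (V := R_NormedModule) _ _ _ H3 H2).
Qed.

Lemma D_phi_components nu v r phi :
  D_phi nu v r phi =
  ((Derive (fun y => Re (v r y)) phi + nu * Im (v r phi),
    Derive (fun y => Im (v r y)) phi + - nu * Re (v r phi)) : C).
Proof. by apply: injective_projections; rewrite /= /Re /Im; ring. Qed.

Lemma neg_magnetic_laplacian_components theta nu v r phi :
  let v1 r phi := Re (v r phi) in let v2 r phi := Im (v r phi) in
  let g1 x := Derive (v1 r) x + nu * v2 r x in let g2 x := Derive (v2 r) x + - nu * v1 r x in
  neg_magnetic_laplacian theta nu v r phi =
  ((- Derive (fun rho => Derive (fun s => v1 s phi) rho) r
     - Derive theta r / theta r * Derive (fun rho => v1 rho phi) r
     - 1 / theta r ^ 2 * (Derive g1 phi + nu * g2 phi),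
    - Derive (fun rho => Derive (fun s => v2 s phi) rho) r
     - Derive theta r / theta r * Derive (fun rho => v2 rho phi) r
     - 1 / theta r ^ 2 * (Derive g2 phi + - nu * g1 phi)) : C).
Proof.
move=> v1 v2 g1 g2.
have E : D_phi nu (D_phi nu v) r phi = ((Derive g1 phi + nu * g2 phi, Derive g2 phi + - nu * g1 phi) : C).
  have E1 : (fun y => Re (D_phi nu v r y)) = g1.
    by apply: functional_extensionality => y; rewrite D_phi_components.
  have E2 : (fun y => Im (D_phi nu v r y)) = g2.
    by apply: functional_extensionality => y; rewrite D_phi_components.
  by rewrite D_phi_components E1 E2 -E1 -E2.
rewrite /neg_magnetic_laplacian E.
by apply: injective_projections; rewrite /= /v1 /v2; ring.
Qed.

(** * Every pair in the Dirichlet-to-Neumann graph lies in the multiplier *)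

Section DirichletToNeumann.
Variables (nu : R) (theta : R -> R).
Hypothesis hnu : 0 <= nu < 1.
Hypothesis theta_smooth : smooth_on_unit_interval theta.
Hypothesis theta_pos : forall r, 0 < r <= 1 -> 0 < theta r.
Hypothesis theta_0 : theta 0 = 0.
Hypothesis theta'_0 : right_derivative_at_0 theta 1.

(** Testing the equation against a mode gives [f'' = - (theta' / theta) f' + ((k - nu) / theta) ^ 2
    f]. With [p = theta f'] this is the system [f' = p / theta], [p' = (k - nu) ^ 2 f / theta],
    whose solutions bounded near 0 satisfy a first order relation. *)
Lemma harmonic_mode_first_order (v : R -> R -> C) k w1 w2 :
  C2_interior v ->
  (forall r phi, 0 < r < 1 -> v r (phi + 2 * PI) = v r phi) ->
  (forall r phi, 0 < r < 1 -> neg_magnetic_laplacian theta nu v r phi = RtoC 0) ->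
  trig_pair (IZR k) w1 w2 ->
  (exists d K, 0 < d /\ forall r, 0 < r < 1 -> r < d ->
     Rabs (pairing w1 w2 (fun x => Re (v r x)) (fun x => Im (v r x))) <= K) ->
  forall r, 0 < r < 1 ->
    theta r * pairing w1 w2 (fun x => Re (d_r v r x)) (fun x => Im (d_r v r x)) =
    Rabs (IZR k - nu) * pairing w1 w2 (fun x => Re (v r x)) (fun x => Im (v r x)).
Proof.
move=> [/C1_interior_iff [Hv1 Hv2] [/C1_interior_iff [Hr1 Hr2] /C1_interior_iff [Hp1 Hp2]]] Hper Heq Hw Hb.
have Hcw x := trig_pair_continuous _ _ _ x Hw.
have [s [Hs1 [_ [Hs2 _]]]] := radial_variable_exists theta theta_smooth theta_pos theta_0 theta'_0.
pose f r := pairing w1 w2 (fun x => Re (v r x)) (fun x => Im (v r x)).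
pose f' r := pairing w1 w2 (fun x => Re (d_r v r x)) (fun x => Im (d_r v r x)).
pose f'' r := pairing w1 w2 (fun x => Re (d_r (d_r v) r x)) (fun x => Im (d_r (d_r v) r x)).
have Hf r : 0 < r < 1 -> is_derive f r (f' r).
  by move=> Hr; apply: (is_derive_pairing w1 w2 (fun r x => Re (v r x)) (fun r x => Im (v r x))).
have Hf' r : 0 < r < 1 -> is_derive f' r (f'' r).
  by move=> Hr; apply: (is_derive_pairing w1 w2 (fun r x => Re (d_r v r x)) (fun r x => Im (d_r v r x))).
have Hode r : 0 < r < 1 -> f'' r = - (Derive theta r / theta r) * f' r + (IZR k - nu) ^ 2 / theta r ^ 2 * f r.
  move=> Hr; have Hth := theta_pos r ltac:(lra).
  have S1 := C1_strip_smooth1 _ r Hv1 Hr; have S2 := C1_strip_smooth1 _ r Hv2 Hr.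
  have S3 := C1_strip_smooth1 _ r Hp1 Hr; have S4 := C1_strip_smooth1 _ r Hp2 Hr.
  have T1 := C1_strip_smooth1 _ r Hr1 Hr; have T2 := C1_strip_smooth1 _ r Hr2 Hr.
  have HDD := pairing_covariant_twice (IZR k) nu w1 w2 (fun x => Re (v r x)) (fun x => Im (v r x)) Hw S1 S2 S3 S4
     ltac:(by move=> x; cbv beta; rewrite Hper) ltac:(by move=> x; cbv beta; rewrite Hper).
  cbv zeta in HDD.
  set g1 := (fun x => Derive (fun x => Re (v r x)) x + nu * Im (v r x)) in HDD.
  set g2 := (fun x => Derive (fun x => Im (v r x)) x + - nu * Re (v r x)) in HDD.
  have G1 : smooth1 g1 by apply: smooth1_plus_scal.
  have G2 : smooth1 g2 by apply: smooth1_plus_scal.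
  have Hc1 x : continuous (fun x => Derive g1 x + nu * g2 x) x.
    apply: (continuous_plus (V := R_NormedModule)); first exact: (proj2 G1).
    by apply: (continuous_scal_r (V := R_NormedModule)); apply: smooth1_continuous.
  have Hc2 x : continuous (fun x => Derive g2 x + - nu * g1 x) x.
    apply: (continuous_plus (V := R_NormedModule)); first exact: (proj2 G2).
    by apply: (continuous_scal_r (V := R_NormedModule)); apply: smooth1_continuous.
  have HL := pairing_lin w1 w2 (fun x => Re (d_r v r x)) (fun x => Im (d_r v r x))
    (fun x => Derive g1 x + nu * g2 x) (fun x => Derive g2 x + - nu * g1 x)
    (- (Derive theta r / theta r)) (- (1 / theta r ^ 2)) Hcw
    ltac:(move=> x; exact: (smooth1_continuous _ x T1)) ltac:(move=> x; exact: (smooth1_continuous _ x T2)) Hc1 Hc2.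
  rewrite HDD in HL.
  have E : f'' r = - (Derive theta r / theta r) * f' r + - (1 / theta r ^ 2) * (- (IZR k - nu) ^ 2 * f r).
    rewrite /f' /f -HL /f'' /pairing; apply: RInt_eq => x.
    have := Heq r x Hr; rewrite neg_magnetic_laplacian_components => HC.
    have HRe := f_equal Re HC; have HIm := f_equal Im HC.
    rewrite /= in HRe HIm.
    congr (_ * _ + _ * _); [move: HRe | move: HIm]; rewrite /d_r /C_derive /= /g1 /g2 /Rdiv; lra.
  by rewrite E; field; lra.
have := bounded_radial_solution theta s f (fun r => theta r * f' r) (Rabs (IZR k - nu)) (Rabs_pos _)
  (fun r Hr => theta_pos r ltac:(lra)) Hs1 Hs2.
apply => //.
- move=> r Hr; have Hth := theta_pos r ltac:(lra).
  have -> : theta r * f' r / theta r = f' r by field; lra.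
  exact: Hf.
- move=> r Hr; have Hth := theta_pos r ltac:(lra).
  have [Hd _] := theta_derive theta theta_smooth r Hr.
  rewrite pow2_abs.
  have -> : (IZR k - nu) ^ 2 * f r / theta r = plus (mult (Derive theta r) (f' r)) (mult (theta r) (f'' r)).
    rewrite Hode // /plus /mult /=; field; lra.
  apply: (is_derive_mult (K := R_AbsRing) theta f') => //; first exact: Hf'.
  exact: Rmult_comm.
Qed.

Lemma DN_operator_diag Psi Phi : DN_operator theta nu Psi Phi ->
  diag_graph (fun k => Rabs (IZR k - nu) / theta 1) Psi Phi.
Proof.
move=> [HPsi [HPhi [v [HC2 [Hper [Heq [Hb [Hlim1 Hlim2]]]]]]]].
split=> //; split=> // k.
have [/C1_interior_iff [Hv1 Hv2] [/C1_interior_iff [Hr1 Hr2] _]] := HC2.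
have Hpi := PI_RGT_0.
have Hfc r : 0 < r < 1 -> fourier_coef (v r) k = _ :=
  fun Hr => fourier_coef_components (v r) k
    (fun x => smooth1_continuous _ x (C1_strip_smooth1 _ r Hv1 Hr))
    (fun x => smooth1_continuous _ x (C1_strip_smooth1 _ r Hv2 Hr)).
have Hfcd r : 0 < r < 1 -> fourier_coef (d_r v r) k = _ :=
  fun Hr => fourier_coef_components (d_r v r) k
    (fun x => smooth1_continuous _ x (C1_strip_smooth1 _ r Hr1 Hr))
    (fun x => smooth1_continuous _ x (C1_strip_smooth1 _ r Hr2 Hr)).
have [d [K [Hd HK]]] := Hb k.
have Hscale x : Rabs (/ (2 * PI) * x) <= K -> Rabs x <= 2 * PI * K.
  have H2pi : 0 < 2 * PI by lra.
  rewrite Rabs_mult Rabs_inv (Rabs_pos_eq (2 * PI)); last lra.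
  move=> H; have := Rmult_le_compat_l _ _ _ (Rlt_le _ _ H2pi) H.
  by rewrite -Rmult_assoc Rinv_r ?Rmult_1_l //; lra.
have Him z : Rabs (Im z) <= Cmod z by apply: Rle_trans (Rmax_r _ _) (Rmax_Cmod z).
have Hre := re_le_Cmod.
(* The projection [p] stands for [Re] or [Im], each with its matching trigonometric pair, so that
   the passage to the boundary is made once. *)
have HthPhi (p : C -> R) w1 w2 : (forall z, Rabs (p z) <= Cmod z) -> (forall z w, p (z - w)%C = p z - p w) ->
   trig_pair (IZR k) w1 w2 ->
   (forall r, 0 < r < 1 -> p (fourier_coef (v r) k) =
      / (2 * PI) * pairing w1 w2 (fun x => Re (v r x)) (fun x => Im (v r x))) ->
   (forall r, 0 < r < 1 -> p (fourier_coef (d_r v r) k) =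
      / (2 * PI) * pairing w1 w2 (fun x => Re (d_r v r x)) (fun x => Im (d_r v r x))) ->
   theta 1 * p (Phi k) = Rabs (IZR k - nu) * p (Psi k).
  move=> Hp Hpm Hw Ep1 Ep2.
  have Hbd : exists d K, 0 < d /\ forall r, 0 < r < 1 -> r < d ->
     Rabs (pairing w1 w2 (fun x => Re (v r x)) (fun x => Im (v r x))) <= K.
    exists d, (2 * PI * K); split=> // r Hr Hrd; apply: Hscale.
    by rewrite -Ep1 //; apply: Rle_trans (Hp _) (HK r Hr Hrd).
  have Hm := harmonic_mode_first_order v k w1 w2 HC2 Hper Heq Hw Hbd.
  apply: (boundary_limit (at_left 1) theta (fun r => p (fourier_coef (d_r v r) k)) (fun r => p (fourier_coef (v r) k))).
  - by move=> eps Heps; apply: theta_lim_1.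
  - move=> eps Heps.
    have H : at_left 1 (fun r => Cmod (fourier_coef (d_r v r) k - Phi k)%C < mkposreal _ Heps).
      exact (ell2_lim_coord (at_left 1) _ _ k (mkposreal _ Heps) Hlim2).
    apply: filter_imp H => r H; rewrite -Hpm; exact: Rle_lt_trans (Hp _) H.
  - move=> eps Heps.
    have H : at_left 1 (fun r => Cmod (fourier_coef (v r) k - Psi k)%C < mkposreal _ Heps).
      exact (ell2_lim_coord (at_left 1) _ _ k (mkposreal _ Heps) Hlim1).
    apply: filter_imp H => r H; rewrite -Hpm; exact: Rle_lt_trans (Hp _) H.
  - apply/at_left_iff; exists 1; split; first lra.
    move=> r Hr; have Hr' : 0 < r < 1 by lra.
    rewrite Ep1 // Ep2 //.
    have := Hm r Hr'; set P := pairing _ _ _ _; set Q := pairing _ _ _ _ => H.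
    have -> : theta r * (/ (2 * PI) * P) = / (2 * PI) * (theta r * P) by ring.
    by rewrite H; ring.
have Hth1 := theta_pos 1 ltac:(lra).
have H1 := HthPhi Re _ _ Hre ltac:(by []) (trig_pair_cos_sin k)
  ltac:(by move=> r Hr; rewrite Hfc) ltac:(by move=> r Hr; rewrite Hfcd).
have H2 := HthPhi Im _ _ Him ltac:(by []) (trig_pair_sin_cos k)
  ltac:(by move=> r Hr; rewrite Hfc) ltac:(by move=> r Hr; rewrite Hfcd).
have Hs (p q m : R) : theta 1 * p = m * q -> p = m / theta 1 * q.
  by move=> H; apply: (Rmult_eq_reg_l (theta 1)); [rewrite H; field | ]; lra.
apply: injective_projections; rewrite /=.
  by rewrite -[fst (Phi k)]/(Re (Phi k)) (Hs _ _ _ H1) /Re; ring.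
by rewrite -[snd (Phi k)]/(Im (Phi k)) (Hs _ _ _ H2) /Im; ring.
Qed.

End DirichletToNeumann.

(** * Harmonic extension of boundary data *)

Lemma C1_strip_ext u v : (forall r phi, 0 < r < 1 -> u r phi = v r phi) -> C1_strip u -> C1_strip v.
Proof.
move=> E Hu r phi Hr; have [H1 [H2 [H3 H4]]] := Hu r phi Hr.
have Hloc : locally r (fun y => 0 < y < 1) by apply: (locally_open_interval 0 1).
have Eloc x p : 0 < x < 1 -> locally x (fun y => u y p = v y p).
  by move=> Hx; apply: (locally_open_interval 0 1) => // y Hy; apply: E.
have Esec x : 0 < x < 1 -> u x = v x.
  by move=> Hx; apply: functional_extensionality => p; apply: E.
have Hloc2 : locally (r, phi) (fun p : R * R => 0 < fst p < 1).
  by have [d Hd] := Hloc; exists d => -[y z] [Hy _]; apply: Hd.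
split; first by apply: ex_derive_ext_loc H1; apply: Eloc.
split; first by rewrite -Esec.
split.
  apply: continuous_ext_loc H3; apply: filter_imp Hloc2 => -[y z] /= Hy.
  by apply: Derive_ext_loc; apply: Eloc.
by apply: continuous_ext_loc H4; apply: filter_imp Hloc2 => -[y z] /= Hy; rewrite Esec.
Qed.

Section HarmonicExtension.
Variables (nu : R) (theta s : R -> R).
Hypothesis hnu : 0 <= nu < 1.
Hypothesis theta_smooth : smooth_on_unit_interval theta.
Hypothesis theta_pos : forall r, 0 < r <= 1 -> 0 < theta r.
Hypothesis Hs1 : forall r, 0 < r < 1 -> is_derive s r (- / theta r).
Hypothesis Hs2 : forall r, 0 < r < 1 -> 0 < s r.
Hypothesis Hs3 : forall eps, 0 < eps -> at_left 1 (fun r => s r < eps).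

Let mu (k : Z) : R := Rabs (IZR k - nu).

Lemma mode_rate_lb k : Rabs (IZR k) - 1 <= mu k.
Proof.
have := Rabs_triang (IZR k - nu) nu; rewrite (Rabs_pos_eq nu); last lra.
have -> : IZR k - nu + nu = IZR k by ring.
rewrite /mu; lra.
Qed.

Lemma mode_rate_ge0 k : 0 <= mu k.
Proof. exact: Rabs_pos. Qed.

Lemma mode_rate_ub k : Rabs (mu k) <= 1 * (Rabs (IZR k) + 1).
Proof.
rewrite /mu Rabs_Rabsolu.
have := Rabs_triang (IZR k) (- nu); rewrite Rabs_Ropp (Rabs_pos_eq nu); last lra.
rewrite /Rminus; lra.
Qed.

Lemma frequency_ub j k : Rabs (IZR (k - j)) <= (1 + Rabs (IZR j)) * (Rabs (IZR k) + 1).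
Proof.
rewrite minus_IZR.
have := Rabs_triang (IZR k) (- IZR j); rewrite Rabs_Ropp /Rminus.
have := Rabs_pos (IZR k); have := Rabs_pos (IZR j); nra.
Qed.

Lemma frequency0_ub k : Rabs (IZR k) <= 1 * (Rabs (IZR k) + 1).
Proof. by have := Rabs_pos (IZR k); lra. Qed.

Let dser := damped_series mu IZR.

Lemma damped_series_lin om a b a' b' c d sigma phi :
  subexponential a -> subexponential b -> subexponential a' -> subexponential b' -> 0 < sigma ->
  c * damped_series mu om a b sigma phi + d * damped_series mu om a' b' sigma phi =
  damped_series mu om (fun k => c * a k + d * a' k) (fun k => c * b k + d * b' k) sigma phi.
Proof.
move=> Ha Hb Ha' Hb' Hsg.
have E1 := ex_series_damped_term mu om mode_rate_lb mode_rate_ge0 a b sigma phi Ha Hb Hsg.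
have E2 := ex_series_damped_term mu om mode_rate_lb mode_rate_ge0 a' b' sigma phi Ha' Hb' Hsg.
symmetry; apply: is_series_unique.
have H1 := is_series_scal_l c _ _ (Series_correct _ E1).
have H2 := is_series_scal_l d _ _ (Series_correct _ E2).
apply: is_series_ext (is_series_plus _ _ _ _ H1 H2) => n.
rewrite /plus /scal /= /mult /= /fold_Z /damped_term; ring.
Qed.

(** The radial prefactor closes the class under differentiation: by the chain rule, d/dr of a
    function of [s r] brings out [- / theta r]. The extension itself has prefactor [one], its radial
    derivative has [h1]. *)
Definition wave (h : R -> R) (a b : Z -> R) (r phi : R) : R := h r * dser a b (s r) phi.

Lemma is_derive_wave_r h h' a b r phi : 0 < r < 1 -> is_derive h r (h' r) ->
  subexponential a -> subexponential b ->
  is_derive (fun rho => wave h a b rho phi) r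
    (wave h' a b r phi + wave (fun r => h r * - / theta r) (fun k => - (mu k * a k)) (fun k => - (mu k * b k)) r phi).
Proof.
move=> Hr Hh Ha Hb.
have Hd := is_derive_damped_series_sigma mu IZR mode_rate_lb mode_rate_ge0 mode_rate_ub
  a b (s r) phi Ha Hb (Hs2 r Hr).
have Hc := is_derive_comp (fun x => dser a b x phi) s r _ _ Hd (Hs1 r Hr).
have Hm := is_derive_mult (K := R_AbsRing) h (fun x => dser a b (s x) phi) r _ _ Hh Hc Rmult_comm.
have -> : wave h' a b r phi + wave (fun r => h r * - / theta r) (fun k => - (mu k * a k)) (fun k => - (mu k * b k)) r phi =
  plus (mult (h' r) (dser a b (s r) phi)) (mult (h r) (scal (- / theta r) (damped_series mu IZR (fun k => - (mu k * a k)) (fun k => - (mu k * b k)) (s r) phi))).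
  by rewrite /wave /dser /plus /mult /scal /= /mult /=; ring.
exact: Hm.
Qed.

Lemma is_derive_wave_phi h a b r phi : 0 < r < 1 -> subexponential a -> subexponential b ->
  is_derive (wave h a b r) phi (wave h (fun k => IZR k * b k) (fun k => - (IZR k * a k)) r phi).
Proof.
move=> Hr Ha Hb.
apply: (is_derive_scal (fun p => dser a b (s r) p)).
by apply: (is_derive_damped_series_phi mu IZR 1 mode_rate_lb mode_rate_ge0 frequency0_ub) => //; apply: Hs2.
Qed.

Lemma subexponential_rate a : subexponential a -> subexponential (fun k => - (mu k * a k)).
Proof. exact: (subexponential_mu mu mode_rate_ub). Qed.

Lemma subexponential_freq a : subexponential a -> subexponential (fun k => IZR k * a k).
Proof. exact: (subexponential_om IZR 1 frequency0_ub). Qed.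

Lemma continuous_wave h a b r phi : 0 < r < 1 -> continuous h r ->
  subexponential a -> subexponential b ->
  continuous (fun p : R * R => wave h a b (fst p) (snd p)) (r, phi).
Proof.
move=> Hr Hh Ha Hb.
apply: (continuous_mult (K := R_AbsRing) (fun p : R * R => h (fst p)) (fun p : R * R => dser a b (s (fst p)) (snd p))).
  by apply: (continuous_comp fst h) => //; apply: continuous_fst.
apply: (continuous_comp_2 (fun p : R * R => s (fst p)) (fun p : R * R => snd p) (dser a b)).
- apply: (continuous_comp fst s); first exact: continuous_fst.
  by apply: ex_derive_continuous_R; eexists; apply: Hs1.
- exact: continuous_snd.
- by apply: (continuous_damped_series mu IZR 1 mode_rate_lb mode_rate_ge0 mode_rate_ub frequency0_ub) => //; apply: Hs2.
Qed.

Lemma locally_strip r phi : 0 < r < 1 -> locally (r, phi) (fun p : R * R => 0 < fst p < 1).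
Proof.
move=> Hr; have [d Hd] : locally r (fun y => 0 < y < 1) by apply: (locally_open_interval 0 1).
by exists d => -[y z] [Hy _]; apply: Hd.
Qed.

Lemma C1_strip_wave h h' a b : (forall r, 0 < r < 1 -> is_derive h r (h' r)) ->
  (forall r, 0 < r < 1 -> continuous h' r) ->
  subexponential a -> subexponential b -> C1_strip (wave h a b).
Proof.
move=> Hh Hh' Ha Hb r phi Hr.
have Dr y p : 0 < y < 1 -> is_derive (fun rho => wave h a b rho p) y _ :=
  fun Hy => is_derive_wave_r h h' a b y p Hy (Hh y Hy) Ha Hb.
have Dp y p : 0 < y < 1 -> is_derive (wave h a b y) p _ :=
  fun Hy => is_derive_wave_phi h a b y p Hy Ha Hb.
have Hch y : 0 < y < 1 -> continuous h y by move=> Hy; apply: ex_derive_continuous_R; eexists; apply: Hh.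
have Hcth : continuous (fun r => - / theta r) r.
  apply: (continuous_opp (V := R_NormedModule)); apply: (continuous_comp theta Rinv).
    by apply: ex_derive_continuous_R; eexists; apply: (proj1 (theta_derive theta theta_smooth r Hr)).
  by apply: continuous_Rinv; have := theta_pos r ltac:(lra); lra.
split; first by eexists; apply: Dr.
split; first by eexists; apply: Dp.
split.
  apply: (continuous_ext_loc _ (fun p : R * R => wave h' a b (fst p) (snd p) +
     wave (fun r => h r * - / theta r) (fun k => - (mu k * a k)) (fun k => - (mu k * b k)) (fst p) (snd p))).
    apply: filter_imp (locally_strip r phi Hr) => p Hp.
    by symmetry; apply: is_derive_unique; apply: Dr.
  apply: (continuous_plus (V := R_NormedModule)); apply: continuous_wave => //.
  - exact: Hh'.
  - by apply: (continuous_mult (K := R_AbsRing) h) => //; apply: Hch.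
  - exact: subexponential_rate.
  - exact: subexponential_rate.
apply: (continuous_ext_loc _ (fun p : R * R => wave h (fun k => IZR k * b k) (fun k => - (IZR k * a k)) (fst p) (snd p))).
  apply: filter_imp (locally_strip r phi Hr) => p Hp.
  by symmetry; apply: is_derive_unique; apply: Dp.
apply: continuous_wave => //.
- exact: Hch.
- exact: subexponential_freq.
- by apply: subexponential_opp; apply: subexponential_freq.
Qed.

Let h1 (r : R) : R := - / theta r.
Let h1' (r : R) : R := Derive theta r / theta r ^ 2.

Lemma is_derive_h1 r : 0 < r < 1 -> is_derive h1 r (h1' r).
Proof.
move=> Hr; have [Hd _] := theta_derive theta theta_smooth r Hr; have Hth := theta_pos r ltac:(lra).
rewrite /h1 /h1'; auto_derive; first by repeat split; [eexists; exact: Hd | lra].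
have -> : Derive (fun x => theta x) r = Derive theta r by [].
by field; lra.
Qed.

Lemma continuous_h1' r : 0 < r < 1 -> continuous h1' r.
Proof.
move=> Hr; have [Hd Hc] := theta_derive theta theta_smooth r Hr; have Hth := theta_pos r ltac:(lra).
apply: (continuous_mult (K := R_AbsRing) (Derive theta) (fun r => / theta r ^ 2)) => //.
apply: ex_derive_continuous_R; auto_derive; repeat split; first by eexists; exact: Hd.
by apply: Rmult_integral_contrapositive; lra.
Qed.

Let one (r : R) : R := 1.

Lemma is_derive_one r : is_derive one r 0.
Proof. exact: (is_derive_const (K := R_AbsRing) (V := R_NormedModule) 1 r). Qed.

Lemma wave_zero a b r phi : wave (fun _ => 0) a b r phi = 0.
Proof. by rewrite /wave; ring. Qed.

Lemma Derive_wave_r a b r phi : 0 < r < 1 -> subexponential a -> subexponential b ->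
  Derive (fun rho => wave one a b rho phi) r =
  wave h1 (fun k => - (mu k * a k)) (fun k => - (mu k * b k)) r phi.
Proof.
move=> Hr Ha Hb; rewrite (is_derive_unique _ _ _ (is_derive_wave_r one (fun _ => 0) a b r phi Hr (is_derive_one r) Ha Hb)).
by rewrite wave_zero /wave /one /h1; ring.
Qed.

Lemma Derive_wave_phi h a b r phi : 0 < r < 1 -> subexponential a -> subexponential b ->
  Derive (wave h a b r) phi = wave h (fun k => IZR k * b k) (fun k => - (IZR k * a k)) r phi.
Proof. by move=> Hr Ha Hb; apply: is_derive_unique; apply: is_derive_wave_phi. Qed.

Lemma wave_C2 a b : subexponential a -> subexponential b ->
  C1_strip (wave one a b) /\ C1_strip (fun r phi => Derive (fun rho => wave one a b rho phi) r) /\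
  C1_strip (fun r phi => Derive (wave one a b r) phi).
Proof.
move=> Ha Hb.
have Hone r : 0 < r < 1 -> is_derive one r 0 by move=> _; apply: is_derive_one.
have Hz r : 0 < r < 1 -> continuous (fun _ : R => 0) r by move=> _; apply: continuous_const.
split; first exact: (C1_strip_wave one (fun _ => 0)).
split.
  apply: (C1_strip_ext (wave h1 (fun k => - (mu k * a k)) (fun k => - (mu k * b k)))).
    by move=> r phi Hr; rewrite Derive_wave_r.
  apply: (C1_strip_wave h1 h1' _ _ is_derive_h1 continuous_h1'); exact: subexponential_rate.
apply: (C1_strip_ext (wave one (fun k => IZR k * b k) (fun k => - (IZR k * a k)))).
  by move=> r phi Hr; rewrite Derive_wave_phi.
apply: (C1_strip_wave one (fun _ => 0)) => //; first exact: subexponential_freq.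
by apply: subexponential_opp; apply: subexponential_freq.
Qed.

(** Two radial derivatives give [mu k ^ 2 / theta ^ 2] and a term in theta' that cancels against the
    first order term; the angular part gives the same square with the opposite sign, since
    [mu k ^ 2 = (k - nu) ^ 2]. This is the real part of the equation for coefficients x + i y; the
    imaginary part is the case (y, -x), multiplication by -i. *)
Lemma wave_laplacian x y r phi : 0 < r < 1 -> subexponential x -> subexponential y ->
  let v1 := wave one x (fun k => - y k) in let v2 := wave one y x in
  let g1 z := Derive (v1 r) z + nu * v2 r z in let g2 z := Derive (v2 r) z + - nu * v1 r z in
  - Derive (fun rho => Derive (fun t => v1 t phi) rho) r
  - Derive theta r / theta r * Derive (fun rho => v1 rho phi) r
  - 1 / theta r ^ 2 * (Derive g1 phi + nu * g2 phi) = 0.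
Proof.
move=> Hr Hx Hy v1 v2 g1 g2.
have Hth := theta_pos r ltac:(lra).
have Hy' := subexponential_opp y Hy.
have Hsr := Hs2 r Hr.
pose d k := IZR k - nu.
have Hd a : subexponential a -> subexponential (fun k => d k * a k).
  by move=> Ha; apply: subexponential_mult Ha => k; have := mode_rate_ub k; rewrite Rabs_Rabsolu; apply.
have E1 : g1 = wave one (fun k => - (d k * y k)) (fun k => - (d k * x k)) r.
  apply: functional_extensionality => z; rewrite /g1 /v1 Derive_wave_phi // /v2 /wave /one !Rmult_1_l.
  rewrite -[dser _ _ (s r) z]Rmult_1_l /dser damped_series_lin //; first last.
  - by apply: subexponential_opp; apply: subexponential_freq.
  - exact: subexponential_freq.
  by congr (damped_series _ _ _ _ _ _); apply: functional_extensionality => k; rewrite /d; ring.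
have E2 : g2 = wave one (fun k => d k * x k) (fun k => - (d k * y k)) r.
  apply: functional_extensionality => z; rewrite /g2 /v2 Derive_wave_phi // /v1 /wave /one !Rmult_1_l.
  rewrite -[dser (fun k => IZR k * x k) _ (s r) z]Rmult_1_l /dser damped_series_lin //; first last.
  - by apply: subexponential_opp; apply: subexponential_freq.
  - exact: subexponential_freq.
  by congr (damped_series _ _ _ _ _ _); apply: functional_extensionality => k; rewrite /d; ring.
have E3 : Derive g1 phi + nu * g2 phi = dser (fun k => - (d k * (d k * x k))) (fun k => d k * (d k * y k)) (s r) phi.
  rewrite E1 E2 Derive_wave_phi //; try by apply: subexponential_opp; apply: Hd.
  rewrite /wave /one !Rmult_1_l -[dser _ _ (s r) phi]Rmult_1_l /dser damped_series_lin //.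
  - by congr (damped_series _ _ _ _ _ _); apply: functional_extensionality => k; rewrite /d; ring.
  - by apply: subexponential_freq; apply: subexponential_opp; apply: Hd.
  - by apply: subexponential_opp; apply: subexponential_freq; apply: subexponential_opp; apply: Hd.
  - exact: Hd.
  - by apply: subexponential_opp; apply: Hd.
have Hmx := subexponential_rate x Hx; have Hmy := subexponential_rate _ Hy'.
have E4 : Derive (fun rho => Derive (fun t => v1 t phi) rho) r =
   wave h1' (fun k => - (mu k * x k)) (fun k => - (mu k * - y k)) r phi +
   wave (fun r => h1 r * - / theta r) (fun k => - (mu k * - (mu k * x k))) (fun k => - (mu k * - (mu k * - y k))) r phi.
  rewrite -(is_derive_unique _ _ _ (is_derive_wave_r h1 h1' _ _ r phi Hr (is_derive_h1 r Hr) Hmx Hmy)).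
  apply: Derive_ext_loc; apply: (locally_open_interval 0 1) => // z Hz.
  exact: Derive_wave_r.
rewrite E4 E3 [Derive (fun rho => v1 rho phi) r]Derive_wave_r // /wave /h1 /h1'.
have Hmu k : mu k * mu k = d k * d k by rewrite /mu -Rabs_mult Rabs_pos_eq //; apply: Rle_0_sqr.
have E5 : dser (fun k => - (mu k * - (mu k * x k))) (fun k => - (mu k * - (mu k * - y k))) (s r) phi =
   -1 * dser (fun k => - (d k * (d k * x k))) (fun k => d k * (d k * y k)) (s r) phi + 0 * dser x y (s r) phi.
  rewrite /dser damped_series_lin //; [| by apply: subexponential_opp; apply: (Hd _ (Hd _ Hx)) | exact: (Hd _ (Hd _ Hy))].
  congr (damped_series _ _ _ _ _ _); apply: functional_extensionality => k.
    have -> : - (mu k * - (mu k * x k)) = (mu k * mu k) * x k by ring.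
    by rewrite Hmu; ring.
  have -> : - (mu k * - (mu k * - y k)) = - (mu k * mu k) * y k by ring.
  by rewrite Hmu; ring.
by rewrite E5; field; lra.
Qed.

(** Real and imaginary parts of the sum over k of [c k * exp (- |k - nu| * s r)] times the character
    of index k. *)
Definition harmonic_extension (c : ell2_type) (r phi : R) : C :=
  (wave one (fun k => Re (c k)) (fun k => - Im (c k)) r phi,
   wave one (fun k => Im (c k)) (fun k => Re (c k)) r phi).

(** The addition formulas turn the tested integrand into a damped series with frequencies shifted by
    k, whose integral over a period retains only the term j = k. *)
Lemma wave_pairing h x y r k : 0 < r < 1 -> subexponential x -> subexponential y ->
  pairing (fun phi => cos (IZR k * phi)) (fun phi => sin (IZR k * phi))
    (wave h x (fun k => - y k) r) (wave h y x r) = 2 * PI * (h r * exp (- (mu k * s r)) * x k) /\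
  pairing (fun phi => - sin (IZR k * phi)) (fun phi => cos (IZR k * phi))
    (wave h x (fun k => - y k) r) (wave h y x r) = 2 * PI * (h r * exp (- (mu k * s r)) * y k).
Proof.
move=> Hr Hx Hy; have Hy' := subexponential_opp y Hy; have Hsr := Hs2 r Hr.
pose om j := IZR (j - k).
have HI a b := RInt_damped_series mu om _ a b (s r) k mode_rate_lb mode_rate_ge0 mode_rate_ub (frequency_ub k)
  (fun j => ex_intro _ (j - k)%Z eq_refl)
  (fun j => ltac:(rewrite /om; split; [move/eq_IZR; lia | move=> ->; rewrite Z.sub_diag //])).
have Ex a b phi := fun Ha Hb => Series_correct _ (ex_series_damped_term mu IZR mode_rate_lb mode_rate_ge0 a b (s r) phi Ha Hb Hsr).
have Hang j phi : om j * phi = IZR j * phi - IZR k * phi by rewrite /om minus_IZR; ring.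
split.
- have [Hex Hval] := HI x (fun k => - y k) Hx Hy' Hsr.
  transitivity (RInt (fun phi => h r * damped_series mu om x (fun k => - y k) (s r) phi + 0 * damped_series mu om x (fun k => - y k) (s r) phi) 0 (2 * PI)).
    apply: RInt_eq => phi; rewrite Rmult_0_l Rplus_0_r /wave.
    have -> : damped_series mu om x (fun k => - y k) (s r) phi =
       cos (IZR k * phi) * dser x (fun k => - y k) (s r) phi + sin (IZR k * phi) * dser y x (s r) phi.
      apply: is_series_unique.
      apply: is_series_ext (is_series_plus _ _ _ _ (is_series_scal_l (cos (IZR k * phi)) _ _ (Ex _ _ phi Hx Hy'))
        (is_series_scal_l (sin (IZR k * phi)) _ _ (Ex _ _ phi Hy Hx))) => n.
      rewrite /plus /scal /= /mult /= /fold_Z /damped_term !Hang !cos_minus !sin_minus; ring.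
    ring.
  by rewrite RInt_lin // Hval; ring.
- have [Hex Hval] := HI y x Hy Hx Hsr.
  transitivity (RInt (fun phi => h r * damped_series mu om y x (s r) phi + 0 * damped_series mu om y x (s r) phi) 0 (2 * PI)).
    apply: RInt_eq => phi; rewrite Rmult_0_l Rplus_0_r /wave.
    have -> : damped_series mu om y x (s r) phi =
       - sin (IZR k * phi) * dser x (fun k => - y k) (s r) phi + cos (IZR k * phi) * dser y x (s r) phi.
      apply: is_series_unique.
      apply: is_series_ext (is_series_plus _ _ _ _ (is_series_scal_l (- sin (IZR k * phi)) _ _ (Ex _ _ phi Hx Hy'))
        (is_series_scal_l (cos (IZR k * phi)) _ _ (Ex _ _ phi Hy Hx))) => n.
      rewrite /plus /scal /= /mult /= /fold_Z /damped_term !Hang !cos_minus !sin_minus; ring.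
    ring.
  by rewrite RInt_lin // Hval; ring.
Qed.

Lemma fourier_coef_wave (f : R -> C) h x y r k : 0 < r < 1 -> subexponential x -> subexponential y ->
  (forall phi, f phi = ((wave h x (fun k => - y k) r phi, wave h y x r phi) : C)) ->
  fourier_coef f k = (RtoC (h r * exp (- (mu k * s r))) * (x k, y k))%C.
Proof.
move=> Hr Hx Hy Hf; have Hpi := PI_RGT_0.
have Hy' := subexponential_opp y Hy.
have Hc a b phi : subexponential a -> subexponential b -> continuous (wave h a b r) phi.
  by move=> Ha Hb; apply: ex_derive_continuous_R; eexists; apply: is_derive_wave_phi.
have E : f = fun phi => ((wave h x (fun k => - y k) r phi, wave h y x r phi) : C).
  by apply: functional_extensionality.
rewrite E fourier_coef_components; [|by move=> z; apply: Hc|by move=> z; apply: Hc].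
have [H1 H2] := wave_pairing h x y r k Hr Hx Hy.
rewrite [pairing (fun phi => cos _) _ _ _]H1 [pairing (fun phi => - sin _) _ _ _]H2.
by apply: injective_projections; rewrite /=; field; lra.
Qed.

Lemma diag_DN_operator Psi Phi :
  diag_graph (fun k => Rabs (IZR k - nu) / theta 1) Psi Phi -> DN_operator theta nu Psi Phi.
Proof.
move=> [HPsi [HPhi HE]]; split=> //; split=> //.
have Hth1 := theta_pos 1 ltac:(lra).
pose x k := Re (Psi k); pose y k := Im (Psi k).
have Hx : subexponential x.
  apply: (subexponential_bounded _ (ell2_norm Psi)) => k.
  exact: Rle_trans (re_le_Cmod _) (Cmod_le_ell2_norm _ k HPsi).
have Hy : subexponential y.
  apply: (subexponential_bounded _ (ell2_norm Psi)) => k.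
  by apply: Rle_trans (Cmod_le_ell2_norm _ k HPsi); apply: Rle_trans (Rmax_r _ _) (Rmax_Cmod _).
have Hy' := subexponential_opp y Hy.
have Hmx := subexponential_rate x Hx; have Hmy := subexponential_rate y Hy.
have Hmy' := subexponential_rate _ Hy'.
pose v := harmonic_extension Psi.
have Hfc r k : 0 < r < 1 -> fourier_coef (v r) k = (RtoC (exp (- (mu k * s r))) * Psi k)%C.
  move=> Hr; rewrite (fourier_coef_wave (v r) one x y r k Hr Hx Hy) // /one Rmult_1_l.
  by rewrite /x /y; case: (Psi k).
(* The coefficient is [mu k / theta r * exp (- (mu k * s r)) * Psi k]. Rewriting [mu k * Psi k] as
   [theta 1 * Phi k] puts the growing factor into [Phi], which is square summable and can therefore
   dominate. *)
have Hfcd r k : 0 < r < 1 -> fourier_coef (d_r v r) k = (RtoC (theta 1 / theta r * exp (- (mu k * s r))) * Phi k)%C.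
  move=> Hr; have Hth := theta_pos r ltac:(lra).
  rewrite (fourier_coef_wave (d_r v r) h1 (fun k => - (mu k * x k)) (fun k => - (mu k * y k)) r k Hr) //.
    rewrite HE /x /y /h1; apply: injective_projections; rewrite /= /mu /Re /Im; field; lra.
  move=> phi; rewrite /d_r /C_derive /v /harmonic_extension.
  rewrite [X in (X, _)](Derive_wave_r x (fun k => - y k)) // [X in (_, X)](Derive_wave_r y x) //.
  congr (_, _); congr (wave _ _ _ _ _).
  by apply: functional_extensionality => j; ring.
have [C1 [C2 C3]] := wave_C2 x (fun k => - y k) Hx Hy'.
have [D1 [D2 D3]] := wave_C2 y x Hy Hx.
exists v; split.
  split; first by apply/C1_interior_iff.
  by split; apply/C1_interior_iff.
split.
  move=> r phi Hr; rewrite /v /harmonic_extension.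
  have Hp a b : wave one a b r (phi + 2 * PI) = wave one a b r phi.
    rewrite /wave; congr (_ * _); apply: Series_ext => n.
    have Ht k : damped_term mu IZR a b (s r) (phi + 2 * PI) k = damped_term mu IZR a b (s r) phi k.
      rewrite /damped_term; have -> : IZR k * (phi + 2 * PI) = IZR k * phi + IZR k * (2 * PI) by ring.
      by rewrite cos_plus sin_plus cos_period_Z sin_period_Z; congr (_ * _); ring.
    by rewrite /fold_Z !Ht.
  by rewrite !Hp.
split.
  move=> r phi Hr; rewrite neg_magnetic_laplacian_components.
  have L1 := wave_laplacian x y r phi Hr Hx Hy.
  (* The imaginary part of the equation for [Psi] is the real part for -i [Psi], whose coefficients
     are (y, -x). *)
  have L2 := wave_laplacian y (fun k => - x k) r phi Hr Hy (subexponential_opp x Hx).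
  have Ex : (fun k => - - x k) = x by apply: functional_extensionality => k; ring.
  have En r' z : wave one (fun k => - x k) y r' z = - 1 * wave one x (fun k => - y k) r' z.
    rewrite /wave /one !Rmult_1_l; rewrite /dser.
    rewrite /damped_series -Series_scal_l; apply: Series_ext => n; rewrite /fold_Z /damped_term; ring.
  rewrite /= Ex in L1 L2.
  have EF r' : wave one (fun k => - x k) y r' = fun z => - 1 * wave one x (fun k => - y k) r' z.
    by apply: functional_extensionality => z; apply: En.
  rewrite !EF in L2.
  apply: injective_projections; rewrite /= /v /harmonic_extension /=; first exact: L1.
  rewrite -[RHS]L2; congr (_ - _ * (_ + _)).
    apply: Derive_ext => z; congr (_ + _); rewrite /x /y; ring.
  rewrite Derive_scal -[Derive (fun p => wave _ _ _ r p) phi]/(Derive (wave one x (fun k => - y k) r) phi) /x /y.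
  ring.
split.
  move=> k; exists 1, (Cmod (Psi k)); split; first lra.
  move=> r Hr _; rewrite Hfc // Cmod_mult Cmod_R Rabs_pos_eq; last exact: Rlt_le (exp_pos _).
  have Hu : 0 <= mu k * s r by apply: Rmult_le_pos; [exact: mode_rate_ge0 | apply: Rlt_le; apply: Hs2].
  have [[_ H] _] := exp_neg_bounds _ Hu.
  have := Cmod_ge_0 (Psi k); nra.
have Hexp r k : 0 < r < 1 -> 0 <= 1 - exp (- (mu k * s r)) <= Rmin 1 (mu k * s r).
  move=> Hr; have Hu : 0 <= mu k * s r by apply: Rmult_le_pos; [exact: mode_rate_ge0 | apply: Rlt_le; apply: Hs2].
  have [[H0 H] _] := exp_neg_bounds _ Hu; have := exp_pos (- (mu k * s r)) => H1.
  by split; [lra | apply: Rmin_glb; lra].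
have Hin : at_left 1 (fun r => 0 < r < 1).
  by apply/at_left_iff; exists 1; split; [lra | move=> r Hr; lra].
have Hmus k eps : 0 < eps -> at_left 1 (fun r => mu k * s r < eps).
  move=> Heps; have Hm := mode_rate_ge0 k.
  have Hq : 0 < eps / (mu k + 1) by apply: Rdiv_lt_0_compat; lra.
  apply: filter_imp (filter_and _ _ Hin (Hs3 _ Hq)) => r [Hr Hlt].
  have Hsr := Hs2 r Hr.
  apply: Rle_lt_trans (_ : (mu k + 1) * s r < _); first nra.
  have -> : eps = (mu k + 1) * (eps / (mu k + 1)) by field; lra.
  by apply: Rmult_lt_compat_l; lra.
split.
  apply: (ell2_lim_dominated _ _ _ Psi 1 HPsi).
    apply: filter_imp Hin => r Hr k; rewrite Hfc //.
    have -> : (RtoC (exp (- (mu k * s r))) * Psi k - Psi k)%C = (RtoC (exp (- (mu k * s r)) - 1) * Psi k)%C.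
      by rewrite RtoC_minus; ring.
    rewrite Cmod_mult Cmod_R; apply: Rmult_le_compat_r; first exact: Cmod_ge_0.
    have [H1 H2] := Hexp r k Hr; have := Rmin_l 1 (mu k * s r).
    by rewrite Rabs_left1; lra.
  move=> k eps Heps.
  have H : at_left 1 (fun r => Cmod (RtoC (exp (- (mu k * s r)) - 1) * Psi k)%C < eps).
    apply: filter_Cmod_mult_small eps Heps => eps Heps.
    apply: filter_imp (filter_and _ _ Hin (Hmus k _ Heps)) => r [Hr Hlt].
    have [H1 H2] := Hexp r k Hr; have := Rmin_r 1 (mu k * s r).
    by rewrite Rabs_left1; lra.
  apply: filter_imp (filter_and _ _ Hin H) => r [Hr]; rewrite Hfc //.
  have -> : (RtoC (exp (- (mu k * s r))) * Psi k - Psi k)%C = (RtoC (exp (- (mu k * s r)) - 1) * Psi k)%C.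
    by rewrite RtoC_minus; ring.
  by [].
have Hthhalf : at_left 1 (fun r => Rabs (theta r - theta 1) < theta 1 / 2).
  by apply: theta_lim_1 => //; lra.
have Ediff r k : (RtoC (theta 1 / theta r * exp (- (mu k * s r))) * Phi k - Phi k)%C =
    (RtoC (theta 1 / theta r * exp (- (mu k * s r)) - 1) * Phi k)%C.
  by rewrite RtoC_minus; ring.
(* The multiplier error is split into the variation of [theta] and the loss of the exponential;
   [theta r > theta 1 / 2] bounds the common factor [/ theta r]. *)
have Hratio r k : 0 < r < 1 -> Rabs (theta r - theta 1) < theta 1 / 2 ->
   Rabs (theta 1 / theta r * exp (- (mu k * s r)) - 1) <=
     2 / theta 1 * Rabs (theta r - theta 1) + 2 * (1 - exp (- (mu k * s r))).
  move=> Hr Habs; have [H1 H2] := Hexp r k Hr.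
  have Hd := Rabs_def2 _ _ Habs.
  have Hthr : theta 1 / 2 < theta r by lra.
  have Hi : / theta r <= 2 / theta 1.
    have -> : 2 / theta 1 = / (theta 1 / 2) by field; lra.
    by apply: Rinv_le_contravar; lra.
  have Hi0 : 0 < / theta r by apply: Rinv_0_lt_compat; lra.
  have -> : theta 1 / theta r * exp (- (mu k * s r)) - 1 =
     - (/ theta r * ((theta r - theta 1) + theta 1 * (1 - exp (- (mu k * s r))))) by field; lra.
  rewrite Rabs_Ropp Rabs_mult (Rabs_pos_eq (/ theta r)); last lra.
  have Ht := Rabs_triang (theta r - theta 1) (theta 1 * (1 - exp (- (mu k * s r)))).
  rewrite (Rabs_pos_eq (theta 1 * _)) in Ht; last by apply: Rmult_le_pos; lra.
  apply: Rle_trans (Rmult_le_compat _ _ _ _ (Rlt_le _ _ Hi0) (Rabs_pos _) Hi Ht) _.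
  by apply: Req_le; field; lra.
(* The constant is 3 = 1 + 2: when [theta r] is within [theta 1 / 2] of [theta 1], the first summand
   of [Hratio] is at most 1, and the second is always at most 2. *)
apply: (ell2_lim_dominated _ _ _ Phi 3 HPhi).
  apply: filter_imp (filter_and _ _ Hin Hthhalf) => r [Hr Hhalf] k; rewrite Hfcd // Ediff.
  rewrite Cmod_mult Cmod_R; apply: Rmult_le_compat_r; first exact: Cmod_ge_0.
  apply: Rle_trans (Hratio r k Hr Hhalf) _.
  have [H1 H2] := Hexp r k Hr; have H3 := Rmin_l 1 (mu k * s r).
  have : 2 / theta 1 * Rabs (theta r - theta 1) <= 2 / theta 1 * (theta 1 / 2).
    by apply: Rmult_le_compat_l; [apply: Rlt_le; apply: Rdiv_lt_0_compat|]; lra.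
  have -> : 2 / theta 1 * (theta 1 / 2) = 1 by field; lra.
  lra.
move=> k eps Heps.
have H : at_left 1 (fun r => Cmod (RtoC (theta 1 / theta r * exp (- (mu k * s r)) - 1) * Phi k)%C < eps).
  apply: filter_Cmod_mult_small eps Heps => eps Heps.
  (* These thresholds make each of the two summands of [Hratio] smaller than eps/2. *)
  have He1 : 0 < eps * theta 1 / 4 by have := Rmult_lt_0_compat _ _ Heps Hth1; lra.
  have He2 : 0 < eps / 4 by lra.
  have Hlim := theta_lim_1 theta theta_smooth _ He1.
  apply: filter_imp (filter_and _ _ Hin (filter_and _ _ Hthhalf (filter_and _ _ Hlim (Hmus k _ He2)))) => r [Hr [Hhalf [Hl Hm]]].
  apply: Rle_lt_trans (Hratio r k Hr Hhalf) _.
  have [H1 H2] := Hexp r k Hr; have H3 := Rmin_r 1 (mu k * s r).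
  have : 2 / theta 1 * Rabs (theta r - theta 1) < 2 / theta 1 * (eps * theta 1 / 4).
    by apply: Rmult_lt_compat_l => //; apply: Rdiv_lt_0_compat; lra.
  have -> : 2 / theta 1 * (eps * theta 1 / 4) = eps / 2 by field; lra.
  lra.
by apply: filter_imp (filter_and _ _ Hin H) => r [Hr]; rewrite Hfcd // Ediff.
Qed.

End HarmonicExtension.

(** * Equality with the multiplier and the trace formula *)

Lemma DN_operator_iff nu theta : 0 <= nu < 1 -> smooth_on_unit_interval theta ->
  (forall r, 0 < r <= 1 -> 0 < theta r) -> theta 0 = 0 -> right_derivative_at_0 theta 1 ->
  forall Psi Phi, DN_operator theta nu Psi Phi <->
    diag_graph (fun k => Rabs (IZR k - nu) / theta 1) Psi Phi.
Proof.
move=> hnu smth pos th0 th'0 Psi Phi; split; first exact: DN_operator_diag.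
have [s [Hs1 [Hs2 [_ Hs3]]]] := radial_variable_exists theta smth pos th0 th'0.
exact: (diag_DN_operator nu theta s hnu smth pos Hs1 Hs2 Hs3).
Qed.

Lemma is_exp_semigroup_graph_ext M N E : (forall x y, M x y <-> N x y) ->
  is_exp_semigroup M E -> is_exp_semigroup N E.
Proof.
move=> H [H1 [H2 [H3 [H4 H5]]]]; do 4 (split => //).
by move=> x y Hx Hy; rewrite -H; apply: H5.
Qed.

Theorem mainTheorem5 (nu : R) (theta : R -> R)
  (hnu : 0 <= nu < 1)
  (theta_smooth : smooth_on_unit_interval theta)
  (theta_pos : forall r, 0 < r <= 1 -> 0 < theta r)
  (theta_0 : theta 0 = 0)
  (theta'_0 : right_derivative_at_0 theta 1) :
  (exists E, is_exp_semigroup (DN_operator theta nu) E) /\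
  forall E, is_exp_semigroup (DN_operator theta nu) E ->
    forall t, 0 < t ->
      is_trace (E t)
        (RtoC (cosh (t / theta 1 * (nu - 1 / 2)) / sinh (t / (2 * theta 1)))).
Proof.
have Hth1 := theta_pos 1 ltac:(lra).
pose lam k := Rabs (IZR k - nu) / theta 1.
have Hlam k : 0 <= lam k.
  by apply: Rmult_le_pos; [exact: Rabs_pos | apply: Rlt_le; apply: Rinv_0_lt_compat].
have HDN := DN_operator_iff nu theta hnu theta_smooth theta_pos theta_0 theta'_0.
split.
  exists (diag_semigroup lam).
  apply: (is_exp_semigroup_graph_ext (diag_graph lam)); first by move=> x y; rewrite HDN.
  exact: diag_is_exp_semigroup.
move=> E HE t Ht.
have HE' : is_exp_semigroup (diag_graph lam) E := is_exp_semigroup_graph_ext _ _ E HDN HE.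
apply: (diag_is_trace (fun k => exp (- (t * lam k)))).
- by move=> k; apply: diag_semigroup_coef => //; lra.
- have Ha : 0 < t / theta 1 by apply: Rdiv_lt_0_compat.
  have -> : t / (2 * theta 1) = t / theta 1 / 2 by field; lra.
  apply: is_series_ext (is_series_exp_abs_shift nu (t / theta 1) hnu Ha) => n.
  have El k : t / theta 1 * Rabs (IZR k - nu) = t * lam k by rewrite /lam; field; lra.
  by rewrite /fold_Z !El.
- by apply: (proj1 HE); lra.
- by move=> x Hx; apply: diag_exp_semigroup_unique => //; lra.
Qed.
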